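(* Let $\theta\in\Theta_{pe}$ and let $(U_n)_{n\ge0}$ be the stationary process defined in the context. Let $m\ge1$ and let $h:\mathbb R^d\to\mathbb R^m$ be Borel measurable. If $\lVert h(U_0)\rVert$ is square-integrable, then, as $n\to\infty$, $$\frac1{\sqrt n}\sum_{k=1}^n h(U_k)Z_k\ \stackrel{\mathcal D}{\longrightarrow}\ N\bigl(0,\sigma^2E(h(U_1)h(U_1)^T)\bigr),$$ where $\stackrel{\mathcal D}{\to}$ means convergence in distribution.
   Context: All random variables are defined on a probability space $(\Omega,\mathcal F,P)$. Fix $d\in\mathbb N$, $d\ge1$, and $\theta=(\theta_1,\dots,\theta_d)^T\in\mathbb R^d$. $(Z_n)_{n\ge1}$ is an i.i.d. sequence of real random variables with $Z_1$ square-integrable, $E(Z_1)=0$ and $\sigma^2=\mathrm{Var}(Z_1)>0$ ($\sigma>0$). $B=B(\theta)\in\mathbb R^{d\times d}$ is the companion matrix whose first row is $(\theta_1,\dots,\theta_d)$ and whose $i$-th row, $2\le i\le d$, is $e_{i-1}^T$ ($e_1,\dots,e_d$ the unit vectors of $\mathbb R^d$; for $d=1$, $B=\theta_1$). $W_n=(Z_n,0,\dots,0)^T=Z_ne_1$. $\Theta_{pe}$ is the set of $\theta\in\mathbb R^d$ such that all complex eigenvalues of $B(\theta)$ have absolute value $>1$; for such $\theta$, $\theta_d\neq0$ and $B$ is invertible. The standing assumption is $\theta\in\Theta_{pe}$. We write $B^{-j}=(B^{-1})^j$. The process $(Y_n)_{n\ge-d+1}$ satisfies $Y_n=\theta_1Y_{n-1}+\dots+\theta_dY_{n-d}+Z_n$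 for $n\ge1$, and $U_n=(Y_n,Y_{n-1},\dots,Y_{n-d+1})^T$, $n\ge0$, so $U_n=BU_{n-1}+W_n$ for $n\ge1$; the initial value is $U_0=(Y_0,\dots,Y_{-d+1})^T=-\sum_{j=1}^\infty B^{-j}W_j$ (the series converges absolutely almost surely). Consequently $U_n=-\sum_{k=1}^\infty B^{-k}e_1Z_{n+k}$ almost surely for $n\ge0$. $\lVert\cdot\rVert$ is the Euclidean norm. $N(0,C)$ is the (possibly degenerate) centered normal distribution with covariance matrix $C$. *)

(* Defs.v *)
From HB Require Import structures.
From mathcomp Require Import all_boot all_order all_algebra.
From mathcomp Require Import all_classical all_reals all_analysis.
From mathcomp Require Import complex.

Set Implicit Arguments.
Unset Strict Implicit.
Unset Printing Implicit Defensive.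

Import Order.TTheory GRing.Theory Num.Theory.
Import numFieldNormedType.Exports.

Local Open Scope classical_set_scope.
Local Open Scope ring_scope.

Notation borel V := (g_sigma_algebraType (@open V)).

Section Companion.
Context {R : realType} {d : nat}.

(* Indices are shifted by one: theta_i is [theta (i-1) 0], and row i >= 1 of the
   matrix (counted from 0) is the unit vector with a 1 in column i - 1. *)
Definition companion (theta : 'cV[R]_d) : 'M[R]_d :=
  \matrix_(i, j) if i == 0%N :> nat then theta j 0 else (i == j.+1 :> nat)%:R.

Definition purely_explosive (theta : 'cV[R]_d) : Prop :=
  forall z : R[i],
    eigenvalue (map_mx (real_complex R) (companion theta)) z -> 1 < `|z|.

Definition first_coord (x : R) : 'cV[R]_d :=
  \col_i if i == 0%N :> nat then x else 0.

(* The Euclidean norm; the library's norm on matrices is the sup norm. *)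
Definition euclid_norm (v : 'cV[R]_d) : R := Num.sqrt (\sum_i v i 0 ^+ 2).

End Companion.

Section Probability.
Context {R : realType} {disp : measure_display} {T : measurableType disp}.
Variable P : probability T R.

Definition mutually_independent (X : nat -> {RV P >-> R}) : Prop :=
  forall (s : seq nat) (A : nat -> set R),
    uniq s -> (forall k, measurable (A k)) ->
    P (\bigcap_(k in [set` s]) X k @^-1` A k) =
    (\prod_(k <- s) P (X k @^-1` A k))%E.

Definition identically_distributed (X : nat -> {RV P >-> R}) : Prop :=
  forall (k : nat) (A : set R), measurable A ->
    distribution P (X k) A = distribution P (X 0%N) A.

Definition iid (X : nat -> {RV P >-> R}) : Prop :=
  mutually_independent X /\ identically_distributed X.

Definition mx_expectation {m n : nat} (M : T -> 'M[R]_(m, n)) : 'M[R]_(m, n) :=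
  \matrix_(i, j) fine ('E_P[fun w => M w i j])%E.

Definition cvg_in_distribution {V : ptopologicalType} (X : nat -> T -> V)
    (mu : probability (borel V) R) : Prop :=
  forall f : V -> R, continuous f -> bounded_fun f ->
    ('E_P[f \o X n])%E @[n --> \oo] --> (\int[mu]_x (f x)%:E)%E.

(* The state vector (Y_n, ..., Y_(n-d+1)). *)
Definition state {d : nat} (Y : int -> {RV P >-> R}) (n : nat) (w : T) :
    'cV[R]_d :=
  \col_(i < d) Y (n%:Z - i%:Z) w.

(* Y is the AR(d) process driven by Z_1, Z_2, ... whose initial state is
   - \sum_(j >= 1) B^(-j) W_j. Only Y_n with n >= - d + 1 and Z_n with n >= 1
   are constrained. *)
Definition explosive_AR {d : nat} (theta : 'cV[R]_d)
    (Z : nat -> {RV P >-> R}) (Y : int -> {RV P >-> R}) : Prop :=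
  (forall n : nat, (0 < n)%N ->
    {ae P, forall w, Y n%:Z w =
       \sum_(i < d) theta i 0 * Y (n%:Z - i.+1%:Z) w + Z n w}) /\
  {ae P, forall w,
    \sum_(1 <= j < N.+1)
       (invmx (companion theta)) ^+ j *m first_coord (Z j w)
     @[N --> \oo] --> - @state d Y 0%N w}.

End Probability.

Section Normal.
Context {R : realType}.

(* The library's [normal_prob 0 s] is not the Dirac mass when s = 0. *)
Definition normal_law (v : R) : set R -> \bar R :=
  if v == 0 then \d_(0 : R) else normal_prob 0 (Num.sqrt v).

(* N(0, C) is the law on R^m all of whose one-dimensional projections
   x |-> t^T x are N(0, t^T C t). *)
Definition is_centered_normal {m : nat} (C : 'M[R]_m)
    (mu : probability (borel 'cV[R]_m) R) : Prop :=
  forall (t : 'cV[R]_m) (A : set R), measurable A ->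
    mu [set x | A ((t^T *m (x : 'cV[R]_m)) 0 0)] =
    normal_law ((t^T *m C *m t) 0 0) A.

End Normal.

(* Main.v *)
Require Import Defs.
From HB Require Import structures.
From mathcomp Require Import all_boot all_order all_algebra.
From mathcomp Require Import all_classical all_reals all_analysis measurable_realfun.
From mathcomp Require Import complex zify ring lra.
Import HBSimple.

Set Implicit Arguments.
Unset Strict Implicit.
Unset Printing Implicit Defensive.

Import Order.TTheory GRing.Theory Num.Theory.
Import numFieldNormedType.Exports.

Local Open Scope classical_set_scope.
Local Open Scope ring_scope.

(** The idea is to read the process backwards in time. Since [B] is invertible,
    which is what pure explosiveness gives, [U_k] is the sum of the series
    [- \sum_j B^-j e_1 Z_(k+j)]: it is a function of the innovations after time
    [k], and therefore independent of [Z_k]. The increments [h(U_k) Z_k] are thus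
    square-integrable, orthogonal, and martingale differences for the decreasing
    family of sigma-algebras generated by [Z_j], [j >= k].

    For a vector [t], let [g = t^T h], let [S_k] be the sum of [g(U_j) Z_j] over
    [k < j <= n], and let [phi_k] be the mean of [cos (S_k / sqrt n + c)]. A Taylor
    expansion gives
      [phi_k = phi_(k+1) - sigma^2 / (2 n) E[cos (S_(k+1) / sqrt n + c) g(U_(k+1))^2]
               + o(1 / n)],
    where the remainder is uniform in [k] by the Lindeberg bound [cosD_rem] and
    stationarity ([cos_tail_step]). The mean of the product splits, up to [o(1)],
    into the product of the means ([cos_tail_decoupling]): [g^2] is approached in
    L1 by a bounded continuous function ([L1_density]), [U_(k+1)] by a function of
    the next [M] innovations ([state_version_approx]), and dropping [M] terms of
    the sum costs [O(M / sqrt n)]. So [phi_k] is [phi_(k+1)] times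
    [exp (- v / (2 n))] up to [o(1 / n)], with [v = sigma^2 E g(U_1)^2], and [n]
    steps give the limit [cos c * exp (- v / 2)] ([reverse_martingale_clt]).

    Two facts turn these limits into convergence in distribution. First, a centred
    Gaussian law with an arbitrary covariance matrix exists and has exactly these
    cosine means: the one-dimensional case is Stein's identity ([normal_cos]), the
    general one a Cholesky recursion ([exists_gaussian]), and its projections are
    normal because cosine means determine a law ([gaussian_centered_normal]).
    Second, trigonometric polynomials approximate continuous functions uniformly
    on cubes ([stone_weierstrass]), while Chebyshev's inequality controls the
    complement of a large cube uniformly in [n] ([cvg_mean_continuous]). *)

(** * The Borel sets of the Euclidean space *)

Section BorelVectors.
Context {R : realType}.

(** Open sets are described with one radius for all coordinates, so that the
    two-index topology of matrices does not appear later. *)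
Lemma cV_openP (m : nat) (W : set 'cV[R]_m) : open W <->
  forall x, W x -> exists2 e : R, 0 < e &
    forall y : 'cV[R]_m, (forall i, `|x i 0 - y i 0| < e) -> W y.
Proof.
rewrite openE; split => [oW x Wx|H x Wx].
  have := oW x Wx; rewrite /interior -nbhs_ballE => -[e /= e0 sub].
  exists e => // y xy; apply: sub; split => // i j.
  by rewrite /ball /= (ord1 j); exact: xy.
have [e e0 sub] := H x Wx.
rewrite /interior -nbhs_ballE; exists e => // y [_ xy].
by apply: sub => i; have := xy i 0.
Qed.

(** An open set is a countable union of cubes with rational centres and radii
    [1 / n]; for [m = 0] the empty intersection still gives the whole space. *)
Lemma measurable_cV d (T : measurableType d) (m : nat) (f : T -> 'cV[R]_m) :
  (forall i, measurable_fun setT (fun x => f x i 0)) ->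
  measurable_fun setT (f : T -> borel 'cV[R]_m).
Proof.
move=> mf; apply: (@measurability _ _ T (borel 'cV[R]_m) setT f (@open 'cV[R]_m)) => //.
move=> _ [W oW <-]; rewrite setTI.
pose box (qn : 'cV[rat]_m * nat) : set T :=
  \bigcap_(i in [set: 'I_m]) [set w | `|f w i 0 - ratr (qn.1 i 0)| < qn.2.+1%:R^-1].
have mbox qn : measurable (box qn).
  apply: fin_bigcap_measurable => [|i _]; first exact: finite_finset.
  rewrite -[X in measurable X]setTI.
  have mg : measurable_fun setT (fun w => `|f w i 0 - ratr (qn.1 i 0)|).
    apply: measurableT_comp => //; apply: measurable_funB => //.
  have -> : [set w | `|f w i 0 - ratr (qn.1 i 0)| < qn.2.+1%:R^-1] =
    (fun w => `|f w i 0 - ratr (qn.1 i 0)|) @^-1` `]-oo, qn.2.+1%:R^-1[%classic.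
    by apply/seteqP; split => w /=; rewrite in_itv.
  exact: mg.
have -> : f @^-1` W = \bigcup_(qn in [set qn | box qn `<=` f @^-1` W]) box qn.
  apply/seteqP; split => [w Ww|w [qn /= sub bw]]; last exact: sub.
  have [e e0 sub] := (cV_openP W).1 oW _ Ww.
  have [n nlt] : exists n, n.+1%:R^-1 < e / 2.
    near \oo => n; exists n; near: n.
    by apply: near_infty_natSinv_lt (PosNum (_ : 0 < e / 2)); rewrite divr_gt0.
  have n0 : 0 < n.+1%:R^-1 :> R by rewrite invr_gt0.
  have /choice [q Hq] : forall i : 'I_m, exists q : rat, `|f w i 0 - ratr q| < n.+1%:R^-1.
    move=> i.
    have lt0 : f w i 0 - n.+1%:R^-1 < f w i 0 + n.+1%:R^-1 by rewrite ltrBlDr -addrA ltrDl addr_gt0.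
    have [q] := rat_in_itvoo lt0.
    rewrite in_itv /= => /andP[h1 h2]; exists q.
    by rewrite ltr_distlC h1 h2.
  exists (\col_i q i, n) => /=; last by move=> i _ /=; rewrite mxE.
  move=> v bv /=; apply: sub => i.
  have := bv i I; rewrite /= mxE => h1.
  have -> : f w i 0 - f v i 0 = (f w i 0 - ratr (q i)) - (f v i 0 - ratr (q i)) by ring.
  apply: le_lt_trans (ler_normB _ _) _.
  by rewrite [ltRHS](_ : e = e / 2 + e / 2) ?ltrD ?(lt_trans _ nlt) //; lra.
rewrite bigcup_mkcond; apply: countable_bigcupT_measurable => [|qn].
  exact: countableP.
by case: ifP => _; [exact: mbox|exact: measurable0].
Unshelve. all: end_near. Qed.

Lemma continuous_measurable_borel (V : ptopologicalType) (f : V -> R) :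
  continuous f -> measurable_fun setT (f : borel V -> R).
Proof.
move=> cf; apply: (@measurability _ _ (borel V) R setT f _ (RGenOpens.measurableE R)).
move=> _ [_ [a [b ->]] <-]; rewrite setTI.
apply: sub_sigma_algebra; apply: open_comp; last exact: interval_open.
by move=> x _; exact: cf.
Qed.

Lemma measurable_coord (m : nat) (i : 'I_m) :
  measurable_fun setT (fun x : borel 'cV[R]_m => (x : 'cV[R]_m) i 0).
Proof. by apply: continuous_measurable_borel; exact: coord_continuous. Qed.

End BorelVectors.

(** * Means of real random variables *)

Notation int1 P f := (P.-integrable setT (EFin \o f)).

Section Mean.
Context {d} {T : measurableType d} {R : realType} (P : probability T R).
Implicit Types f g : T -> R.

Definition mean f : R := \int[P]_x f x.

Lemma int1_meas f : int1 P f -> measurable_fun setT f.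
Proof. by move=> /integrableP[/measurable_EFinP]. Qed.

Lemma int1_le f g : measurable_fun setT f -> (forall x, `|f x| <= g x) ->
  int1 P g -> int1 P f.
Proof.
move=> mf fg; apply: le_integrable => //; first exact/measurable_EFinP.
by move=> x _; rewrite /= lee_fin (le_trans (fg x))// ler_norm.
Qed.

Lemma int1_cst (c : R) : int1 P (fun=> c).
Proof. exact: finite_measure_integrable_cst. Qed.

Lemma int1_bdd f M : measurable_fun setT f -> (forall x, `|f x| <= M) -> int1 P f.
Proof. by move=> mf fM; apply: (int1_le mf fM); exact: int1_cst. Qed.

Lemma int1D f g : int1 P f -> int1 P g -> int1 P (fun x => f x + g x).
Proof. by move=> intf intg; apply: (integrableD measurableT intf intg). Qed.

Lemma int1B f g : int1 P f -> int1 P g -> int1 P (fun x => f x - g x).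
Proof. by move=> intf intg; apply: (integrableB measurableT intf intg). Qed.

Lemma int1Z (c : R) f : int1 P f -> int1 P (fun x => c * f x).
Proof. by move=> intf; apply: (integrableZl measurableT c intf). Qed.

Lemma int1_norm f : int1 P f -> int1 P (fun x => `|f x|).
Proof. by move=> intf; apply: (integrable_norm intf). Qed.

Lemma int1_mul_bdd f g M : measurable_fun setT f -> (forall x, `|f x| <= M) ->
  int1 P g -> int1 P (fun x => f x * g x).
Proof.
move=> mf fM intg.
apply: (@int1_le _ (fun x => M * `|g x|)).
- by apply: measurable_funM => //; exact: int1_meas.
- by move=> x; rewrite normrM ler_wpM2r.
- exact/int1Z/int1_norm.
Qed.

Lemma meanD f g : int1 P f -> int1 P g -> mean (fun x => f x + g x) = mean f + mean g.
Proof. by move=> intf intg; exact: RintegralD. Qed.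

Lemma meanB f g : int1 P f -> int1 P g -> mean (fun x => f x - g x) = mean f - mean g.
Proof. by move=> intf intg; exact: RintegralB. Qed.

Lemma meanZ (c : R) f : int1 P f -> mean (fun x => c * f x) = c * mean f.
Proof. by move=> intf; exact: RintegralZl. Qed.

Lemma mean_cst (c : R) : mean (fun=> c) = c.
Proof. by rewrite /mean Rintegral_cst// [X in fine X]probability_setT mulr1. Qed.

Lemma mean_le f g : int1 P f -> int1 P g -> (forall x, f x <= g x) -> mean f <= mean g.
Proof. by move=> intf intg fg; apply: le_Rintegral. Qed.

Lemma mean_ge0 f : (forall x, 0 <= f x) -> 0 <= mean f.
Proof. by move=> f0; apply: Rintegral_ge0. Qed.

Lemma mean_norm f : int1 P f -> `|mean f| <= mean (fun x => `|f x|).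
Proof. by move=> intf; apply: le_normr_Rintegral. Qed.

Lemma mean_norm_le f g : measurable_fun setT f -> int1 P g ->
  (forall x, `|f x| <= g x) -> `|mean f| <= mean g.
Proof.
move=> mf intg fg; have intf := int1_le mf fg intg.
by apply: le_trans (mean_norm intf) _; apply: mean_le => //; exact: int1_norm.
Qed.

Lemma mean_norm_le_cst f M : measurable_fun setT f -> (forall x, `|f x| <= M) ->
  `|mean f| <= M.
Proof.
by move=> mf fM; rewrite -[leRHS]mean_cst; apply: mean_norm_le => //; exact: int1_cst.
Qed.

Lemma EFin_mean f : int1 P f -> (\int[P]_x (f x)%:E)%E = (mean f)%:E.
Proof. by move=> intf; rewrite /mean /Rintegral fineK// integrable_fin_num. Qed.

Lemma mean_ext_ae f g : measurable_fun setT f -> measurable_fun setT g ->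
  {ae P, forall x, f x = g x} -> mean f = mean g.
Proof.
move=> mf mg fg; rewrite /mean /Rintegral; congr fine.
apply: ae_eq_integral => //; try exact/measurable_EFinP.
by apply: filterS fg => x -> _.
Qed.

Lemma int1_ext_ae f g : int1 P f -> measurable_fun setT g ->
  {ae P, forall x, f x = g x} -> int1 P g.
Proof.
move=> intf mg fg.
apply/integrableP; split; first exact/measurable_EFinP.
have /integrableP[_] := intf.
rewrite (ae_eq_integral (fun x => `|(EFin \o f) x|)%E (fun x => `|(EFin \o g) x|)%E) //.
- by apply: measurableT_comp => //; exact/measurable_EFinP.
- by apply: measurableT_comp => //; exact/measurable_EFinP/int1_meas.
- by apply: filterS fg => x /= -> _.
Qed.

Lemma mean_dct (f_ : nat -> T -> R) f g :
  (forall n, measurable_fun setT (f_ n)) -> measurable_fun setT f ->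
  {ae P, forall x, f_ n x @[n --> \oo] --> f x} ->
  int1 P g -> (forall n x, `|f_ n x| <= g x) ->
  mean (f_ n) @[n --> \oo] --> mean f.
Proof.
move=> mf_ mf cvf intg fg.
have [|||||intf _] := @dominated_convergence _ _ _ P setT measurableT
  (fun n => EFin \o f_ n) (EFin \o f) (EFin \o g).
- by move=> n; exact/measurable_EFinP.
- exact/measurable_EFinP.
- by apply: filterS cvf => x h _ /=; apply/fine_cvgP; split; [exact: nearW|].
- exact: intg.
- by apply: aeW => x n _; rewrite /= lee_fin.
move=> cvi; have ifin : (\int[P]_x (EFin \o f) x \is a fin_num)%E.
  exact: integrable_fin_num.
by move: cvi; rewrite -(fineK ifin) => /fine_cvg.
Qed.

End Mean.

(** Equality of laws is used between random variables on different probability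
    spaces as well as between two variables on the same space. *)
Section SameLaw.
Context d d' d'' (T : measurableType d) (S : measurableType d')
  (V : measurableType d'') (R : realType) (P : probability T R) (Q : probability S R).
Variables (X : T -> V) (Y : S -> V) (f : V -> R).
Hypotheses (mX : measurable_fun setT X) (mY : measurable_fun setT Y)
  (mf : measurable_fun setT f).
Hypothesis PQ : forall A, measurable A -> P (X @^-1` A) = Q (Y @^-1` A).

Let X' : {mfun T >-> V} := mfun_Sub (mem_set mX).
Let Y' : {mfun S >-> V} := mfun_Sub (mem_set mY).

Let distE (g : V -> \bar R) :
  (\int[distribution P X']_y g y = \int[distribution Q Y']_y g y)%E.
Proof. by apply: eq_measure_integral => A mA _; exact: PQ. Qed.

Lemma same_law_int1 : int1 P (f \o X) -> int1 Q (f \o Y).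
Proof.
move=> /integrableP[_ h]; apply/integrableP; split.
  by apply/measurable_EFinP; exact: measurableT_comp.
have ma : measurable_fun setT (fun y => `|(f y)%:E|%E).
  by apply: measurableT_comp => //; exact/measurable_EFinP.
have hX := ge0_integral_distribution (X' : {RV P >-> V}) ma (fun=> abse_ge0 _).
have hY := ge0_integral_distribution (Y' : {RV Q >-> V}) ma (fun=> abse_ge0 _).
move: h; have -> : (\int[P]_x `|(EFin \o (f \o X)) x| =
  \int[distribution P X']_y `|(f y)%:E|)%E by rewrite hX.
by rewrite distE hY.
Qed.

Lemma same_law_mean : int1 P (f \o X) -> mean P (f \o X) = mean Q (f \o Y).
Proof.
move=> intX; have intY := same_law_int1 intX.
have mf' : measurable_fun setT (EFin \o f) by exact/measurable_EFinP.
have hX := integral_distribution (X := X' : {RV P >-> V}) mf' intX.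
have hY := integral_distribution (X := Y' : {RV Q >-> V}) mf' intY.
by rewrite /mean /Rintegral; congr fine; rewrite -[LHS]hX -[RHS]hY distE.
Qed.

End SameLaw.

(** * Independence and product laws *)

Section Independence.
Context {d} {T : measurableType d} {R : realType} (P : probability T R).

Definition indep d1 d2 (V1 : measurableType d1) (V2 : measurableType d2)
    (X : T -> V1) (Y : T -> V2) :=
  forall A B, measurable A -> measurable B ->
    P (X @^-1` A `&` Y @^-1` B) = (P (X @^-1` A) * P (Y @^-1` B))%E.

Definition law d1 (V : measurableType d1) (X : T -> V)
    (mX : measurable_fun setT X) : probability V R :=
  distribution P (mfun_Sub (mem_set mX) : {mfun T >-> V}).

(** Both sides agree on rectangles, and a product measure is determined by its
    values there. *)
Lemma indep_law d1 d2 (V1 : measurableType d1) (V2 : measurableType d2)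
    (X : T -> V1) (Y : T -> V2)
    (mX : measurable_fun setT X) (mY : measurable_fun setT Y) : indep X Y ->
  forall Z, measurable Z ->
    P ((fun w => (X w, Y w)) @^-1` Z) = (law mX \x law mY)%E Z.
Proof.
move=> XY Z mZ.
have mXY : measurable_fun setT (fun w => (X w, Y w)) by exact: measurable_fun_pair.
symmetry.
apply: (product_measure_unique (m1 := law mX) (m2 := law mY) (m' := law mXY)) => //.
Qed.

(** Fubini under the product of the two laws. *)
Lemma indep_mean (X Y : T -> R) : int1 P X -> int1 P Y -> indep X Y ->
  int1 P (fun w => X w * Y w) /\ mean P (fun w => X w * Y w) = mean P X * mean P Y.
Proof.
move=> iX iY XY.
have mX := int1_meas iX; have mY := int1_meas iY.
have PQ := indep_law mX mY XY.
have mXY : measurable_fun setT (fun w => (X w, Y w)) by exact: measurable_fun_pair.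
have mid : measurable_fun setT (id : R * R -> R * R) by [].
have mm : measurable_fun setT (fun z : R * R => z.1 * z.2) by apply: measurable_funM.
have QP : forall Z, measurable Z -> (law mX \x law mY)%E (id @^-1` Z) =
    P ((fun w => (X w, Y w)) @^-1` Z) by move=> Z mZ; rewrite PQ.
have lawX (Z : T -> R) (mZ : measurable_fun setT Z) : int1 P Z -> int1 (law mZ) id /\ mean (law mZ) id = mean P Z.
  move=> iZ; split.
    by apply: (same_law_int1 (P := P) (X := Z) (f := id)) => //.
  by symmetry; apply: (same_law_mean (P := P) (X := Z) (f := id)) => //.
have [iX' eX] := lawX _ mX iX.
have [iY' eY] := lawX _ mY iY.
have iprod : int1 (law mX \x law mY)%E (fun z : R * R => z.1 * z.2).
  apply/integrable12ltyP; first exact/measurable_EFinP.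
  under eq_integral => x _.
    under eq_integral => y _ do rewrite /= normrM EFinM.
    rewrite ge0_integralZl_EFin //; last first.
      by apply/measurable_EFinP; exact: normr_measurable.
    rewrite (EFin_mean (int1_norm iY')) -EFinM mulrC.
    over.
  rewrite (EFin_mean (int1Z _ (int1_norm iX'))); exact: ltry.
split.
  exact: (same_law_int1 mid mXY mm QP iprod).
rewrite -[LHS](same_law_mean mid mXY mm QP iprod).
rewrite {1}/mean /Rintegral -(integral12_prod_meas1 iprod) /fubini_F.
rewrite (eq_integral (fun x => (mean (law mY) id * x)%:E)); last first.
  move=> x _; rewrite -[LHS]/(\int[law mY]_y (x * y)%:E)%E.
  by rewrite (EFin_mean (int1Z x iY')) meanZ // mulrC.
by rewrite (EFin_mean (int1Z _ iX')) /= meanZ // mulrC eX eY.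
Qed.

End Independence.

(** This is the source of all stationarity statements: the state and the
    innovation just before it are independent, so that the law of the pair
    cannot depend on time as soon as the marginals do not. *)
Lemma indep_same_law d d' d1 d2 (T : measurableType d) (S : measurableType d')
  (V1 : measurableType d1) (V2 : measurableType d2) (R : realType)
  (P : probability T R) (Q : probability S R)
  (X : T -> V1) (Y : T -> V2) (X' : S -> V1) (Y' : S -> V2) :
  measurable_fun setT X -> measurable_fun setT Y ->
  measurable_fun setT X' -> measurable_fun setT Y' ->
  indep P X Y -> indep Q X' Y' ->
  (forall A, measurable A -> P (X @^-1` A) = Q (X' @^-1` A)) ->
  (forall A, measurable A -> P (Y @^-1` A) = Q (Y' @^-1` A)) ->
  forall Z, measurable Z -> P ((fun w => (X w, Y w)) @^-1` Z) =
                            Q ((fun w => (X' w, Y' w)) @^-1` Z).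
Proof.
move=> mX mY mX' mY' XY XY' lX lY Z mZ.
rewrite (indep_law mX' mY' XY' mZ).
have mXY : measurable_fun setT (fun w => (X w, Y w)) by exact: measurable_fun_pair.
symmetry.
apply: (product_measure_unique (m1 := law Q mX') (m2 := law Q mY') (m' := law P mXY)) => //.
move=> A B mA mB; rewrite -[LHS]/(P (X @^-1` A `&` Y @^-1` B)) XY //.
by rewrite lX // lY.
Qed.

Section LawMeans.
Context d d' (T : measurableType d) (V : measurableType d') (R : realType)
  (P : probability T R) (X : T -> V) (mX : measurable_fun setT X).

Lemma mean_law (f : V -> R) : measurable_fun setT f -> int1 P (f \o X) ->
  mean (law P mX) f = mean P (f \o X).
Proof.
move=> mf iX; symmetry.
by apply: (same_law_mean (P := P) (Q := law P mX) (X := X) (Y := id) (f := f)).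
Qed.

Lemma int1_law (f : V -> R) : measurable_fun setT f -> int1 P (f \o X) ->
  int1 (law P mX) f.
Proof.
move=> mf iX.
by apply: (same_law_int1 (P := P) (Q := law P mX) (X := X) (Y := id) (f := f)).
Qed.

End LawMeans.

(** * Blocks of innovations *)

Section Cylinders.
Context {d} {T : measurableType d} {R : realType} (P : probability T R).
Variable Z : nat -> {RV P >-> R}.

(** The events that restrict finitely many of the [Z j] with [D j]. The sets
    [A j] run over all indices and are full outside of this finite range, so that
    intersections are taken index by index. *)
Definition cyl (D : pred nat) : set (set T) :=
  [set E | exists (N : nat) (A : nat -> set R),
     [/\ forall j, measurable (A j),
         forall j, ~~ (D j && (j < N)%N) -> A j = setT &
         E = [set w | forall j, A j (Z j w)]]].

Lemma cyl_measurable D : cyl D `<=` measurable.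
Proof.
move=> _ [N [A [mA AT ->]]].
have -> : [set w | forall j, A j (Z j w)] = \bigcap_j (Z j @^-1` A j).
  by apply/seteqP; split => w /= h j; [move=> _; exact: h|exact: (h j I)].
by apply: bigcapT_measurable => j; rewrite -[X in measurable X]setTI; exact: measurable_funP.
Qed.

Lemma cylT D : cyl D setT.
Proof.
exists 0%N, (fun=> setT); split => //.
by apply/seteqP; split.
Qed.

Lemma cyl_setI D : setI_closed (cyl D).
Proof.
move=> _ _ [N [A [mA AT ->]]] [M [B [mB BT ->]]].
exists (maxn N M), (fun j => A j `&` B j); split.
- by move=> j; exact: measurableI.
- move=> j; rewrite negb_and => /orP[nD|].
    by rewrite AT ?(negPf nD) // BT ?(negPf nD) // setIT.
  rewrite -leqNgt geq_max => /andP[h1 h2].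
  by rewrite AT ?BT ?setIT // negb_and -leqNgt ?h1 ?h2 orbT.
- by apply/seteqP; split => w /=; [move=> [h1 h2] j; split; [exact: h1|exact: h2]|move=> h; split => j; case: (h j)].
Qed.

Hypothesis Zind : mutually_independent Z.

Lemma cyl_prob N (A : nat -> set R) : (forall j, measurable (A j)) ->
  (forall j, (N <= j)%N -> A j = setT) ->
  P [set w | forall j, A j (Z j w)] = (\prod_(j <- iota 0 N) P (Z j @^-1` A j))%E.
Proof.
move=> mA AT; rewrite -(Zind (iota_uniq 0 N) mA); congr (P _).
apply/seteqP; split => w /= h j; first by move=> _; exact: h.
have [jN|Nj] := ltnP j N; first by apply: (h j); rewrite /= mem_iota.
by rewrite AT.
Qed.

Lemma cyl_indep (D1 D2 : pred nat) E1 E2 : (forall j, ~~ (D1 j && D2 j)) ->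
  cyl D1 E1 -> cyl D2 E2 -> P (E1 `&` E2) = (P E1 * P E2)%E.
Proof.
move=> D12 [N [A [mA AT ->]]] [M [B [mB BT ->]]].
have AT' j : (maxn N M <= j)%N -> A j = setT.
  by rewrite geq_max => /andP[h _]; apply: AT; rewrite negb_and -leqNgt h orbT.
have BT' j : (maxn N M <= j)%N -> B j = setT.
  by rewrite geq_max => /andP[_ h]; apply: BT; rewrite negb_and -leqNgt h orbT.
have -> : [set w | forall j, A j (Z j w)] `&` [set w | forall j, B j (Z j w)] =
  [set w | forall j, (A j `&` B j) (Z j w)].
  by apply/seteqP; split => w /=; [move=> [h1 h2] j; split; [exact: h1|exact: h2]|move=> h; split => j; case: (h j)].
rewrite (cyl_prob (N := maxn N M) (A := fun j => A j `&` B j)); first last.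
- by move=> j h; rewrite AT' // BT' // setIT.
- by move=> j; exact: measurableI.
rewrite (cyl_prob mA AT') (cyl_prob mB BT') -big_split /=.
apply: eq_bigr => j _.
have [D1j|D1j] := boolP (D1 j).
  have BjT : B j = setT.
    by apply: BT; have := D12 j; rewrite D1j /= => /negPf ->.
  by rewrite BjT setIT preimage_setT [X in (_ * X)%E]probability_setT mule1.
have AjT : A j = setT by apply: AT; rewrite (negPf D1j).
by rewrite AjT setTI preimage_setT [X in (X * _)%E]probability_setT mul1e.
Qed.

(** The measures [A |-> P (A `&` E2)] and [P E2 * P] agree on a class stable
    under intersections, hence on the sigma-algebra that it generates. *)
Let indep_step (G : set (set T)) (E2 : set T) : G `<=` measurable -> G setT ->
  setI_closed G -> measurable E2 ->
  (forall A, G A -> P (A `&` E2) = (P A * P E2)%E) ->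
  forall A, <<s G >> A -> P (A `&` E2) = (P A * P E2)%E.
Proof.
move=> Gm GT GI mE2 GE A sA.
have PE2 : (fine (P E2))%:E = P E2 by rewrite fineK // fin_num_measure.
have r0 : 0 <= fine (P E2) by rewrite fine_ge0.
pose m1 := mrestr P mE2.
pose m2 := mscale (NngNum r0) P.
have m2E B : m2 B = (P B * P E2)%E by rewrite -PE2 muleC.
have H : forall B, G B -> m1 B = m2 B.
  by move=> B GB; rewrite m2E -GE.
rewrite -m2E; apply: (@g_sigma_algebra_measure_unique _ _ _ G Gm (fun=> setT) (fun=> GT) _ m1 m2 GI H _ A sA).
- by rewrite bigcup_const //; exists 0%N.
- by move=> k /=; rewrite /mrestr setTI (le_lt_trans (probability_le1 _ _)) // ltry.
Qed.

(** The extension from cylinders to the sigma-algebras that they generate is made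
    in one argument at a time. *)
Lemma sigma_cyl_indep (D1 D2 : pred nat) E1 E2 : (forall j, ~~ (D1 j && D2 j)) ->
  <<s cyl D1 >> E1 -> <<s cyl D2 >> E2 -> P (E1 `&` E2) = (P E1 * P E2)%E.
Proof.
move=> D12 sE1 sE2.
have sm D : <<s cyl D >> `<=` measurable.
  by apply: smallest_sub; [exact: sigma_algebra_measurable|exact: cyl_measurable].
apply: (indep_step (G := cyl D1)) => //; try exact: cyl_measurable; try exact: cylT; try exact: cyl_setI; first exact: sm sE2.
move=> A cA; rewrite setIC muleC.
apply: (indep_step (G := cyl D2)) => //; try exact: cyl_measurable; try exact: cylT; try exact: cyl_setI.
- exact: (cyl_measurable cA).
by move=> B cB; rewrite setIC muleC; exact: cyl_indep cA cB.
Qed.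

(** The sample space with the sigma-algebra generated by the [Z j], [D j]: being
    a function of these variables becomes measurability from this type, and the
    closure properties of measurable functions apply without change. *)
Definition sigT (D : pred nat) := g_sigma_algebraType (cyl D).

Lemma sigT_sub (D1 D2 : pred nat) d' (V : measurableType d') (X : T -> V) :
  {subset D1 <= D2} -> measurable_fun setT (X : sigT D1 -> V) ->
  measurable_fun setT (X : sigT D2 -> V).
Proof.
move=> D12 mX _ B mB.
have := mX measurableT B mB; rewrite !setTI.
apply: sub_smallest2r; first exact: smallest_sigma_algebra.
move=> E [N [A [mA AT ->]]]; exists N, A; split => // j h.
by apply: AT; apply: contra h => /andP[D1j ->]; rewrite andbT; exact: D12 D1j.
Qed.

Lemma sigT_meas (D : pred nat) d' (V : measurableType d') (X : T -> V) :
  measurable_fun setT (X : sigT D -> V) -> measurable_fun setT X.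
Proof.
move=> mX _ B mB; have := mX measurableT B mB; rewrite !setTI.
by apply: smallest_sub; [exact: sigma_algebra_measurable|exact: cyl_measurable].
Qed.

Lemma sigT_Z (D : pred nat) j : D j -> measurable_fun setT (Z j : sigT D -> R).
Proof.
move=> Dj _ B mB; rewrite setTI; apply: sub_sigma_algebra.
exists j.+1, (fun i => if i == j then B else setT); split.
- by move=> i; case: eqP.
- by move=> i; case: eqP => // ->; rewrite Dj ltnS leqnn.
- apply/seteqP; split => w /=; last by move=> /(_ j); rewrite eqxx.
  by move=> h i; case: eqP => // ->.
Qed.

Lemma sigT_indep (D1 D2 : pred nat) d1 d2 (V1 : measurableType d1)
    (V2 : measurableType d2) (X : T -> V1) (Y : T -> V2) :
  (forall j, ~~ (D1 j && D2 j)) ->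
  measurable_fun setT (X : sigT D1 -> V1) ->
  measurable_fun setT (Y : sigT D2 -> V2) -> indep P X Y.
Proof.
move=> D12 mX mY A B mA mB; apply: (sigma_cyl_indep D12).
  by have := mX measurableT A mA; rewrite setTI.
by have := mY measurableT B mB; rewrite setTI.
Qed.

End Cylinders.

(** * Cosine means of the normal law *)

Section NormalCharacteristic.
Context {R : realType}.
Notation leb := (@lebesgue_measure R).

Lemma integral_normal_prob (s : R) (f : R -> R) : int1 (normal_prob 0 s) f ->
  mean (normal_prob 0 s) f = \int[leb]_x (f x * normal_pdf 0 s x).
Proof.
move=> intf; have dom := normal_prob_dominates 0 s.
rewrite /mean /Rintegral; congr fine.
have mpdf : measurable_fun setT (fun x => (normal_pdf 0 s x)%:E).
  by apply/measurable_EFinP; exact: measurable_normal_pdf.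
rewrite -(Radon_Nikodym_change_of_variables dom) //=.
apply: ae_eq_integral => //.
- apply: emeasurable_funM; first exact: (measurable_int _ intf).
  apply: (measurable_int leb); exact: Radon_Nikodym_integrable.
- under eq_fun do rewrite EFinM.
  by apply: emeasurable_funM; first exact: (measurable_int _ intf).
- under [X in ae_eq _ _ _ X]eq_fun do rewrite EFinM.
  apply: ae_eqe_mul2l.
  rewrite Radon_NikodymE.
  case: cid => /= h [h1 h2 h3].
  apply: (@integral_ae_eq _ _ _ _ _ measurableT) => //=.
  by move=> E _ mE; rewrite -h3.
Qed.

(** The fundamental theorem on [-n-1, n+1], then dominated convergence. *)
Lemma integral_derivative0 (f F : R -> R) :
  (forall x : R, is_derive x 1 F (f x)) -> continuous f -> leb.-integrable setT (EFin \o f) ->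
  F n.+1%:R @[n --> \oo] --> 0 -> F (- n.+1%:R) @[n --> \oo] --> 0 ->
  \int[leb]_x f x = 0.
Proof.
move=> dF cf intf Fp Fm.
have mf : measurable_fun setT f by exact: continuous_measurable_fun.
pose I (n : nat) : set R := `[- n.+1%:R, n.+1%:R]%classic.
have mI n : measurable (I n) by exact: measurable_itv.
have [|||||_ _] := @dominated_convergence _ _ _ leb setT measurableT
  (fun n x => ((f \_ (I n)) x)%:E) (EFin \o f) (fun x => `|f x|%:E).
- move=> n; apply/measurable_EFinP.
  exact: ((measurable_restrictT f (mI n)).1 (measurable_funS measurableT (@subsetT _ _) mf)).
- exact/measurable_EFinP.
- apply: aeW => x _ /=; apply: cvg_near_cst; near=> n.
  rewrite patchE mem_set //; rewrite /I /= in_itv /= -ler_norml.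
  apply: (@le_trans _ _ n%:R); last by rewrite ler_nat.
  by near: n; exact: nbhs_infty_ger.
- exact: integrable_norm intf.
- apply: aeW => x n _; rewrite lee_fin patchE; case: ifP => //.
  by rewrite normr0.
have FTC n : (\int[leb]_x ((f \_ (I n)) x)%:E = (F n.+1%:R - F (- n.+1%:R))%:E)%E.
  transitivity (\int[leb]_x ((EFin \o f) \_ (I n)) x)%E.
    by apply: eq_integral => x _; rewrite !patchE; case: ifP.
  rewrite -integral_mkcond (@continuous_FTC2 _ f F) //.
  - by rewrite -subr_gt0 opprK addr_gt0.
  - exact: continuous_subspaceT.
  - have cF : continuous F.
      by move=> x; apply/differentiable_continuous/derivable1_diffP; have [] := dF x.
    split; first by move=> x _; have [] := dF x.
    + exact/cvg_at_right_filter/cF.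
    + exact/cvg_at_left_filter/cF.
  - by move=> x _; rewrite derive1E; have [_ ->] := dF x.
under [X in (X @ _ --> _) -> _]eq_fun do rewrite FTC.
move=> h.
have h0 : (F n.+1%:R - F (- n.+1%:R))%:E @[n --> \oo] --> (0:R)%:E.
  apply: cvg_EFin; first exact: nearW.
  by rewrite -[X in _ --> X](subr0 0); exact: cvgB.
by rewrite /Rintegral (cvg_unique _ h h0).
Unshelve. all: end_near. Qed.

Variable s : R.
Hypothesis s0 : s != 0.
Notation p := (normal_pdf 0 s).

Lemma is_derive_normal_pdf (x : R) : is_derive x 1 p (- (x / s ^+ 2) * p x).
Proof.
rewrite (normal_pdfE 0 s0) /normal_fun.
have s2 : s ^+ 2 != 0 by rewrite expf_neq0.
have H : is_derive x 1 (fun x : R => - (x - 0) ^+ 2 / (s ^+ 2 *+ 2)) (- (x / s ^+ 2)).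
  apply: is_derive_eq.
  by rewrite /GRing.scale /=; field.
have H2 : is_derive x 1 (fun x : R => normal_peak s * expR (- (x - 0) ^+ 2 / (s ^+ 2 *+ 2)))
  (normal_peak s *: (expR (- (x - 0) ^+ 2 / (s ^+ 2 *+ 2)) * (- (x / s ^+ 2)))).
  exact: (is_deriveZ _ (is_derive1_comp (is_derive_expR _) H)).
apply: (is_derive_eq H2).
by rewrite /GRing.scale /=; ring.
Qed.

(** From [y <= (1 + y ^+ 2) / 2], a linear factor is absorbed by half of the
    exponent, that is by a Gaussian whose standard deviation is [sqrt 2] times
    larger. This gives at once the integrability of [x * p x] and the decay of
    [p]. *)
Lemma normal_pdf_tail (x : R) :
  `|x| * p x <= `|s| * (normal_peak s / normal_peak (Num.sqrt 2 * s)) *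
     normal_pdf 0 (Num.sqrt 2 * s) x.
Proof.
have r2 : Num.sqrt 2 != 0 :> R by rewrite gt_eqF // sqrtr_gt0.
have rs0 : Num.sqrt 2 * s != 0 by rewrite mulf_neq0.
rewrite (normal_pdfE 0 s0) (normal_pdfE 0 rs0) /normal_fun subr0.
set k' := normal_peak (Num.sqrt 2 * s).
have k'0 : 0 < k' by exact: normal_peak_gt0.
have k0 : 0 < normal_peak s by exact: normal_peak_gt0.
pose u : R := x ^+ 2 / (4 * s ^+ 2).
have -> : - x ^+ 2 / (s ^+ 2 *+ 2) = - u - u by rewrite /u; field.
have -> : - x ^+ 2 / ((Num.sqrt 2 * s) ^+ 2 *+ 2) = - u.
  by rewrite /u exprMn sqr_sqrtr //; field.
rewrite expRD.
have -> : `|s| * (normal_peak s / k') * (k' * expR (- u)) = `|s| * (normal_peak s * expR (- u)).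
  by field; rewrite gt_eqF.
have xs : `|x| * expR (- u) <= `|s|.
  rewrite expRN ler_pdivrMr ?expR_gt0 //.
  apply: (@le_trans _ _ (`|s| * (1 + u))); last first.
    by rewrite ler_wpM2l // expR_ge1Dx.
  have as0 : 0 < `|s| by rewrite normr_gt0.
  have -> : u = (`|x| / (2 * `|s|)) ^+ 2.
    by rewrite /u exprMn exprVn exprMn !real_normK ?num_real //; congr (_ / (_ * _)); ring.
  set y := `|x| / (2 * `|s|).
  have -> : `|x| = `|s| * (2 * y) by rewrite /y; field; rewrite gt_eqF.
  rewrite ler_wpM2l //; have := sqr_ge0 (y - 1); rewrite sqrrB; lra.
have := ler_wpM2r (ltW (mulr_gt0 k0 (expR_gt0 (- u)))) xs.
by apply: le_trans; rewrite le_eqVlt; apply/orP; left; apply/eqP; ring.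
Qed.

Lemma integrable_abs_normal_pdf : leb.-integrable setT (EFin \o (fun x => `|x| * p x)).
Proof.
apply: (@le_integrable _ _ _ leb _ measurableT _ (fun x => (`|s| * (normal_peak s / normal_peak (Num.sqrt 2 * s)) *
     normal_pdf 0 (Num.sqrt 2 * s) x)%:E)).
- apply/measurable_EFinP; apply: measurable_funM; last exact: measurable_normal_pdf.
  exact: normr_measurable.
- move=> x _; rewrite /= lee_fin [leRHS]ger0_norm; last first.
    by apply: le_trans (normal_pdf_tail x); rewrite mulr_ge0 // normal_pdf_ge0.
  by rewrite normrM normr_id (ger0_norm (normal_pdf_ge0 _ _ _)) normal_pdf_tail.
- under eq_fun do rewrite EFinM.
  by apply: integrableZl => //; exact: integrable_normal_pdf.
Qed.

Lemma normal_pdf_small (n : nat) (x : R) : `|x| = n.+1%:R ->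
  p x <= (`|s| * normal_peak s) * n.+1%:R^-1.
Proof.
move=> xn; rewrite -xn.
have x0 : 0 < `|x| by rewrite xn.
rewrite ler_pdivlMr // mulrC.
have r2 : Num.sqrt 2 != 0 :> R by rewrite gt_eqF // sqrtr_gt0.
have rs0 : Num.sqrt 2 * s != 0 by rewrite mulf_neq0.
apply: le_trans (normal_pdf_tail x) _.
rewrite -mulrA ler_wpM2l // mulrAC ler_pdivrMr ?normal_peak_gt0 //.
by rewrite ler_wpM2l ?normal_peak_ge0 // normal_pdf_ub.
Qed.

Lemma bounded_normal_pdf_integrable (f : R -> R) : measurable_fun setT f ->
  (forall x, `|f x| <= 1) -> leb.-integrable setT (EFin \o (fun x => f x * p x)).
Proof.
move=> mf f1.
apply: (@le_integrable _ _ _ leb _ measurableT _ (fun x => (p x)%:E)).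
- apply/measurable_EFinP; apply: measurable_funM => //; exact: measurable_normal_pdf.
- move=> x _; rewrite /= lee_fin normrM (ger0_norm (normal_pdf_ge0 _ _ _)).
  by rewrite ler_piMl // normal_pdf_ge0.
- exact: integrable_normal_pdf.
Qed.

Let carg (g : R -> R) (t b : R) : continuous g -> continuous (fun x : R => g (t * x + b)).
Proof.
move=> cg x; apply: (continuous_comp (f := fun x : R => t * x + b)); last exact: cg.
by apply: cvgD; [apply: cvgM; [exact: cvg_cst|exact: cvg_id]|exact: cvg_cst].
Qed.

Let marg (g : R -> R) (t b : R) : continuous g -> measurable_fun setT (fun x : R => g (t * x + b)).
Proof. by move=> cg; apply: continuous_measurable_fun; exact: carg. Qed.

Let sin_small (u : nat -> R) (t b : R) : (forall n, `|u n| = n.+1%:R) ->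
  sin (t * u n + b) * p (u n) @[n --> \oo] --> 0.
Proof.
move=> un; apply/cvgr0Pnorm_le => e e0.
have h : (`|s| * normal_peak s) * n.+1%:R^-1 @[n --> \oo] --> (`|s| * normal_peak s) * 0.
  by apply: cvgM; [exact: cvg_cst|exact: cvg_harmonic].
rewrite mulr0 in h; move/cvgr0Pnorm_le : h => /(_ e e0); apply: filterS => n.
apply: le_trans; rewrite normrM (ger0_norm (normal_pdf_ge0 _ _ _)).
rewrite [leRHS]ger0_norm; last by rewrite !mulr_ge0 // normal_peak_ge0.
apply: le_trans (normal_pdf_small (un n)).
by rewrite ler_piMl ?normal_pdf_ge0 // sin_max.
Qed.

(** Stein's identity for the test function [sin (t * x + b)]: integrate the
    derivative of [sin (t * x + b) * p x], using [p' x = - (x / s ^+ 2) * p x]. *)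
Lemma normal_stein (t b : R) :
  \int[leb]_x (x * sin (t * x + b) * p x) =
  s ^+ 2 * t * \int[leb]_x (cos (t * x + b) * p x).
Proof.
have s2 : s ^+ 2 != 0 by rewrite expf_neq0.
have intc : leb.-integrable setT (EFin \o (fun x => cos (t * x + b) * p x)).
  apply: bounded_normal_pdf_integrable; first exact: (marg _ _ (@continuous_cos R)).
  by move=> x; exact: cos_max.
have ints : leb.-integrable setT (EFin \o (fun x => x * sin (t * x + b) * p x)).
  apply: le_integrable integrable_abs_normal_pdf => //.
    apply/measurable_EFinP; apply: measurable_funM; last exact: measurable_normal_pdf.
    by apply: measurable_funM => //; exact: (marg _ _ (@continuous_sin R)).
  move=> x _; rewrite /= lee_fin !normrM normr_id ler_wpM2r //.
  by rewrite ler_piMr // sin_max.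
have := @integral_derivative0 (fun x => t * (cos (t * x + b) * p x) - (s ^+ 2)^-1 * (x * sin (t * x + b) * p x))
  (fun x => sin (t * x + b) * p x).
rewrite RintegralB //; first last.
- exact: (integrableZl measurableT (s ^+ 2)^-1 ints).
- exact: (integrableZl measurableT t intc).
rewrite !RintegralZl // => h.
suff : t * \int[leb]_x (cos (t * x + b) * p x) -
       (s ^+ 2)^-1 * \int[leb]_x (x * sin (t * x + b) * p x) = 0.
  by rewrite -mulrA => /subr0_eq ->; rewrite mulrA divff // mul1r.
apply: h.
- move=> x.
  have dsin : is_derive x 1 (fun x : R => sin (t * x + b)) (cos (t * x + b) * t).
    have da : is_derive x 1 (fun x : R => t * x + b) t.
      by apply: is_derive_eq; rewrite /GRing.scale /=; ring.
    exact: (is_derive1_comp (is_derive_sin _) da).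
  have dp := is_derive_normal_pdf x.
  apply: is_derive_eq.
  by rewrite /GRing.scale /=; ring.
- move=> x; apply: cvgB; (apply: cvgM; [exact: cvg_cst|apply: cvgM; last exact: continuous_normal_pdf]).
    exact: (@carg cos t b (@continuous_cos R) x).
  by apply: cvgM; [exact: cvg_id|exact: (@carg sin t b (@continuous_sin R) x)].
- exact: (integrableB measurableT (integrableZl measurableT t intc) (integrableZl measurableT (s ^+ 2)^-1 ints)).
- apply: (@sin_small (fun n => n.+1%:R) t b) => n; exact: ger0_norm.
- apply: (@sin_small (fun n => - n.+1%:R) t b) => n; rewrite normrN; exact: ger0_norm.
Qed.

(** Differentiation under the integral sign produces [x * sin (t * x + b)],
    which Stein's identity turns back into the cosine: the mean solves a linear
    differential equation in [t]. *)
Lemma is_derive_normal_cos (b t : R) :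
  is_derive t 1 (fun t => \int[leb]_x (cos (t * x + b) * p x))
    (- (s ^+ 2 * t * \int[leb]_x (cos (t * x + b) * p x))).
Proof.
have dcos (u x : R) : is_derive u 1 (fun u => cos (u * x + b) * p x) (- (x * sin (u * x + b) * p x)).
  have da : is_derive u 1 (fun u : R => u * x + b) x.
    by apply: is_derive_eq; rewrite /GRing.scale /=; ring.
  have dc := is_derive1_comp (is_derive_cos _) da.
  have -> : (fun u => cos (u * x + b) * p x) = (fun u => p x * (cos \o (fun u : R => u * x + b)) u).
    by apply/funext => v; rewrite mulrC.
  apply: (is_derive_eq (is_deriveZ (p x) dc)).
  by rewrite /GRing.scale /=; ring.
have intf (u : R) : `]t - 1, t + 1[%classic u -> leb.-integrable setT (EFin \o (fun x => cos (u * x + b) * p x)).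
  move=> _; apply: bounded_normal_pdf_integrable; first exact: (marg _ _ (@continuous_cos R)).
  by move=> x; exact: cos_max.
have tI : `]t - 1, t + 1[%classic t by rewrite /= in_itv /=; lra.
have der (u x : R) : `]t - 1, t + 1[%classic u -> [set: R] x -> derivable (fun u : R => cos (u * x + b) * p x) u 1.
  by move=> _ _; have [] := dcos u x.
have G0 (x : R) : 0 <= `|x| * p x by rewrite mulr_ge0 // normal_pdf_ge0.
have ub (u x : R) : `]t - 1, t + 1[%classic u -> [set: R] x ->
    `|partial1of2 (fun u x : R => cos (u * x + b) * p x) u x| <= `|x| * p x.
  move=> _ _; rewrite partial1of2E; have [_ ->] := dcos u x.
  rewrite normrN !normrM (ger0_norm (normal_pdf_ge0 _ _ _)) ler_wpM2r ?normal_pdf_ge0 //.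
  by rewrite ler_piMr // sin_max.
have D := derivable_under_integral measurableT tI intf der G0 integrable_abs_normal_pdf ub.
have E := differentiation_under_integral measurableT tI intf der G0 integrable_abs_normal_pdf ub.
apply: DeriveDef; first exact: D.
rewrite -derive1E E -normal_stein.
transitivity (\int[leb]_x ((-1) * (x * sin (t * x + b) * p x))).
  by apply: eq_Rintegral => x _; rewrite partial1of2E; have [_ ->] := dcos t x; rewrite mulN1r.
rewrite RintegralZl // ?mulN1r //.
apply: le_integrable integrable_abs_normal_pdf => //.
  apply/measurable_EFinP; apply: measurable_funM; last exact: measurable_normal_pdf.
  by apply: measurable_funM => //; exact: (marg _ _ (@continuous_sin R)).
move=> x _; rewrite /= lee_fin !normrM normr_id ler_wpM2r //.
by rewrite ler_piMr // sin_max.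
Qed.

(** The product of the mean with [expR (s ^+ 2 * t ^+ 2 / 2)] has zero
    derivative in [t], and its value at [t = 0] is [cos b]. *)
Lemma normal_cos (b t : R) :
  mean (normal_prob 0 s) (fun x => cos (t * x + b)) =
  cos b * expR (- (s ^+ 2 * t ^+ 2 / 2)).
Proof.
rewrite integral_normal_prob; last first.
  apply: (@int1_bdd _ _ _ _ _ 1); first exact: (marg _ _ (@continuous_cos R)).
  by move=> x; exact: cos_max.
pose phi (t : R) : R := \int[leb]_x (cos (t * x + b) * p x).
pose g (t : R) : R := expR (s ^+ 2 / 2 * t ^+ 2).
have dg (u : R) : is_derive u 1 g (g u * (s ^+ 2 * u)).
  have da : is_derive u 1 (fun u : R => s ^+ 2 / 2 * u ^+ 2) (s ^+ 2 * u).
    by apply: is_derive_eq; rewrite /GRing.scale /=; field.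
  exact: (is_derive1_comp (is_derive_expR _) da).
have H : forall u : R, is_derive u 1 (fun t : R => phi t * g t) 0.
  move=> u; have dphi : is_derive u 1 phi (- (s ^+ 2 * u * phi u)) := is_derive_normal_cos b u.
  by apply: is_derive_eq; rewrite /GRing.scale /=; ring.
have := is_derive_0_is_cst t 0 H.
rewrite {2}/g expr0n /= mulr0 expR0 mulr1 {2}/phi.
have -> : \int[leb]_x (cos (0 * x + b) * p x) = \int[leb]_x (cos b * p x).
  by apply: eq_Rintegral => x _; rewrite mul0r add0r.
rewrite RintegralZl //; last exact: integrable_normal_pdf.
have -> : \int[leb]_x p x = 1 by rewrite /Rintegral integral_normal_pdf.
rewrite mulr1 => <-.
by rewrite /g -mulrA -expRD mulrAC subrr expR0 mulr1.
Qed.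

End NormalCharacteristic.

(** * Uniform approximation by trigonometric polynomials *)

Section TrigonometricApproximation.
Context {R : realType} {m : nat}.
Notation E := 'cV[R]_m.
Implicit Types (f g p q : E -> R) (t x y z : E).

Definition dotp (t x : E) : R := (t^T *m x) 0 0.

Lemma dotpE t x : dotp t x = \sum_i t i 0 * x i 0.
Proof. by rewrite /dotp mxE; apply: eq_bigr => i _; rewrite mxE. Qed.

Lemma dotpD t u x : dotp (t + u) x = dotp t x + dotp u x.
Proof. by rewrite /dotp linearD mulmxDl mxE. Qed.

Lemma dotpB t u x : dotp (t - u) x = dotp t x - dotp u x.
Proof. by rewrite /dotp linearB mulmxBl !mxE. Qed.

Lemma dotp0 x : dotp 0 x = 0.
Proof. by rewrite /dotp trmx0 mul0mx mxE. Qed.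

Lemma dotpDr t x y : dotp t (x + y) = dotp t x + dotp t y.
Proof. by rewrite /dotp mulmxDr mxE. Qed.

Lemma dotpZr t (c : R) x : dotp t (c *: x) = c * dotp t x.
Proof. by rewrite /dotp -scalemxAr mxE. Qed.

Lemma continuous_dotp t : continuous (dotp t).
Proof.
have -> : dotp t = (fun x => \sum_i t i 0 * x i 0) by apply/funext => x; exact: dotpE.
apply: (@continuous_big R _ +%R 0 xpredT _ E _ (fun i x => t i 0 * x i 0)).
  exact: (@pseudometric_normed_Zmodule.add_continuous R R).
move=> i _ x; exact: (cvgM (cvg_cst _) (@coord_continuous R m 1 i 0 x)).
Qed.

(** Real trigonometric polynomials. The phase [b] lets cosines alone span the
    sines as well, and a product of two cosines is again a sum of two cosines. *)
Inductive trig : (E -> R) -> Prop :=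
| trig_nil : trig (fun=> 0)
| trig_cons c t b f : trig f -> trig (fun x => c * cos (dotp t x + b) + f x).

Lemma trigD p q : trig p -> trig q -> trig (fun x => p x + q x).
Proof.
elim=> [|c t b f _ IH] tq; first by under eq_fun do rewrite add0r.
by under eq_fun do rewrite -addrA; apply: trig_cons; exact: IH.
Qed.

Lemma trigZ (a : R) p : trig p -> trig (fun x => a * p x).
Proof.
elim=> [|c t b f _ IH]; first by under eq_fun do rewrite mulr0; exact: trig_nil.
by under eq_fun do rewrite mulrDr mulrA; exact: trig_cons.
Qed.

Lemma trig_cst (c : R) : trig (fun=> c).
Proof.
have -> : (fun=> c) = (fun x : E => c * cos (dotp 0 x + 0) + 0).
  by apply/funext => x; rewrite dotp0 !addr0 cos0 mulr1.
by apply: trig_cons; exact: trig_nil.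
Qed.

Lemma trig_cos t b : trig (fun x => cos (dotp t x + b)).
Proof.
have -> : (fun x : E => cos (dotp t x + b)) = (fun x : E => 1 * cos (dotp t x + b) + 0).
  by apply/funext => x; rewrite mul1r addr0.
by apply: trig_cons; exact: trig_nil.
Qed.

Lemma trigM p q : trig p -> trig q -> trig (fun x => p x * q x).
Proof.
elim=> [|c t b f _ IH] tq.
  by under eq_fun do rewrite mul0r; exact: trig_nil.
under eq_fun do rewrite mulrDl -mulrA.
apply: trigD; last exact: IH; apply: trigZ.
elim: tq => [|c' t' b' f' _ IH'].
  by under eq_fun do rewrite mulr0; exact: trig_nil.
have -> : (fun x : E => cos (dotp t x + b) * (c' * cos (dotp t' x + b') + f' x)) =
  (fun x : E => (c' / 2) * cos (dotp (t + t') x + (b + b')) +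
     ((c' / 2) * cos (dotp (t - t') x + (b - b')) + cos (dotp t x + b) * f' x)).
  apply/funext => x; rewrite dotpD dotpB.
  have -> : dotp t x + dotp t' x + (b + b') = (dotp t x + b) + (dotp t' x + b') by ring.
  have -> : dotp t x - dotp t' x + (b - b') = (dotp t x + b) - (dotp t' x + b') by ring.
  move: (dotp t x + b) (dotp t' x + b') => A A'.
  by rewrite cosD cosB; field.
by do 2 apply: trig_cons.
Qed.

Lemma trig_bounded p : trig p -> exists2 M : R, 0 <= M & forall x, `|p x| <= M.
Proof.
elim=> [|c t b f _ [M M0 fM]]; first by exists 0 => // x; rewrite normr0.
exists (`|c| + M) => [|x]; first exact: addr_ge0.
apply: le_trans (ler_normD _ _) _; apply: lerD => //.
by rewrite normrM ler_piMr // cos_max.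
Qed.

Lemma trig_continuous p : trig p -> continuous p.
Proof.
elim=> [|c t b f _ IH] x; first exact: (@cst_continuous E R 0 x).
have H : {for x, continuous (fun x => cos (dotp t x + b))}.
  apply: (continuous_comp (f := fun x => dotp t x + b)); last exact: continuous_cos.
  exact: (cvgD (@continuous_dotp t x) (cvg_cst b)).
exact: (cvgD (cvgM (cvg_cst c) H) (IH x)).
Qed.

(** In a coordinate where [x] and [y] differ, a cosine whose phase is [0] at
    [x] and [pi] at [y] takes the values [1] and [-1] there. *)
Lemma trig_two_points x y (a c : R) : x <> y -> exists2 p, trig p & p x = a /\ p y = c.
Proof.
move=> xy.
have [i xyi] : exists i, x i 0 != y i 0.
  apply: contrapT => /forallNP h; apply: xy; apply/colP => i.
  by have /negP := h i; rewrite negbK => /eqP.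
pose k := pi / (y i 0 - x i 0).
have yx0 : y i 0 - x i 0 != 0 by rewrite subr_eq0 eq_sym.
pose t : E := \col_j (if j == i then k else 0).
have tE z : dotp t z = k * z i 0.
  rewrite dotpE (bigD1 i) //= mxE eqxx big1 ?addr0 // => j /negPf ji.
  by rewrite mxE ji mul0r.
exists (fun z => (c - a) / 2 + a + ((a - c) / 2) * cos (dotp t z + - (k * x i 0))).
  by apply: trigD; [exact: trig_cst|apply: trigZ; exact: trig_cos].
split.
  by rewrite tE subrr cos0; field.
rewrite tE -mulrBr (_ : k * _ = pi) ?cospi; last by rewrite /k divfK.
by field.
Qed.

(** The closure is for uniform convergence on the whole space, not only on
    compact sets, so that means under any probability pass to the limit. *)
Definition uctrig f := forall e : R, 0 < e -> exists2 p, trig p & forall x, `|f x - p x| <= e.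

Lemma uctrig_trig p : trig p -> uctrig p.
Proof. by move=> tp e e0; exists p => // x; rewrite subrr normr0 ltW. Qed.

Lemma uctrig_bounded f : uctrig f -> exists2 M : R, 0 < M & forall x, `|f x| <= M.
Proof.
move=> /(_ 1 ltr01)[p /trig_bounded[M M0 pM] fp].
exists (1 + M) => [|x]; first by rewrite ltr_wpDr.
rewrite -[f x](subrK (p x)); apply: le_trans (ler_normD _ _) _.
exact: lerD.
Qed.

Lemma uctrig_lim f : (forall e : R, 0 < e -> exists2 g, uctrig g & forall x, `|f x - g x| <= e) ->
  uctrig f.
Proof.
move=> H e e0; have e20 : 0 < e / 2 by rewrite divr_gt0.
have [g ug fg] := H _ e20; have [p tp gp] := ug _ e20.
exists p => // x; rewrite -[f x](subrK (g x)) -addrA.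
by apply: le_trans (ler_normD _ _) _; rewrite [leRHS](splitr e); exact: lerD.
Qed.

Lemma uctrigD f g : uctrig f -> uctrig g -> uctrig (fun x => f x + g x).
Proof.
move=> uf ug e e0; have e20 : 0 < e / 2 by rewrite divr_gt0.
have [p tp fp] := uf _ e20; have [q tq gq] := ug _ e20.
exists (fun x => p x + q x) => [|x]; first exact: trigD.
by rewrite opprD addrACA; apply: le_trans (ler_normD _ _) _; rewrite [leRHS](splitr e); exact: lerD.
Qed.

Lemma uctrigM f g : uctrig f -> uctrig g -> uctrig (fun x => f x * g x).
Proof.
move=> uf ug e e0.
have [M M0 fM] := uctrig_bounded uf.
have e2 : 0 < e / 2 / M by rewrite !divr_gt0.
have [q tq gq] := ug _ e2.
have [N N0 qN] := trig_bounded tq.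
have N1 : 0 < 1 + N by rewrite ltr_wpDr.
have e1 : 0 < e / 2 / (1 + N) by rewrite !divr_gt0.
have [p tp fp] := uf _ e1.
exists (fun x => p x * q x) => [|x]; first exact: trigM.
have -> : f x * g x - p x * q x = f x * (g x - q x) + q x * (f x - p x) by ring.
apply: le_trans (ler_normD _ _) _; rewrite [leRHS](splitr e) !normrM; apply: lerD.
  by rewrite -[leRHS](divfK (lt0r_neq0 M0)) mulrC ler_pM.
rewrite -[leRHS](divfK (lt0r_neq0 N1)) mulrC ler_pM //.
by apply: le_trans (qN x) _; rewrite lerDr.
Qed.

Lemma uctrigZ (c : R) f : uctrig f -> uctrig (fun x => c * f x).
Proof. by move=> uf; apply: uctrigM => //; apply: uctrig_trig; exact: trig_cst. Qed.

Lemma uctrigN f : uctrig f -> uctrig (fun x => - f x).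
Proof. by move=> uf; under eq_fun do rewrite -mulN1r; exact: uctrigZ. Qed.

(** The iteration [q |-> q + (y ^+ 2 - q ^+ 2) / 2] increases to [`|y|] on
    [-1, 1], with polynomial iterates. *)
Fixpoint abs_approx (n : nat) (y : R) : R :=
  if n is n'.+1 then abs_approx n' y + (y ^+ 2 - abs_approx n' y ^+ 2) / 2 else 0.

(** The gap [D] satisfies [D' <= D * (1 - D / 2)], and [D <= 2 / k] implies
    [D' <= 2 / (k + 1)]. *)
Lemma abs_approxP n (y : R) : `|y| <= 1 ->
  0 <= abs_approx n y /\ 0 <= `|y| - abs_approx n y <= 2 / n.+2%:R.
Proof.
move=> y1; have y2 : y ^+ 2 = `|y| ^+ 2 by rewrite real_normK ?num_real.
have y0 : 0 <= `|y| by exact: normr_ge0.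
elim: n => [|n [p0 /andP[d0 dn]]] /=.
  by rewrite subr0 lexx y0 divff.
rewrite y2; set a := `|y| in y1 y0 d0 dn *; set q := abs_approx n y in p0 d0 dn *.
have n2 : 0 < n.+2%:R :> R by [].
have n3 : 0 < n.+3%:R :> R by [].
split; first by nra.
apply/andP; split; first by nra.
have -> : a - (q + (a ^+ 2 - q ^+ 2) / 2) = (a - q) * (1 - (a + q) / 2) by field.
apply: (@le_trans _ _ ((a - q) * (1 - (a - q) / 2))); first by rewrite ler_wpM2l //; lra.
have -> : n.+3%:R = n.+2%:R + 1 :> R by rewrite -natr1.
set k : R := n.+2%:R in n2 dn *.
have k2 : 2 <= k by rewrite /k -[2]/(2%:R) ler_nat.
set dd := a - q in d0 dn *.
have h1 : 2 / k <= 1 by rewrite ler_pdivrMr // mul1r.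
apply: (@le_trans _ _ (2 / k * (1 - (2 / k) / 2))).
  move: dn h1; set c := 2 / k => dn h1.
  rewrite -subr_ge0 (_ : _ - _ = (c - dd) * (1 - (c + dd) / 2)); last by field.
  by apply: mulr_ge0; lra.
rewrite ler_pdivlMr ?addr_gt0 //.
have -> : 2 / k * (1 - 2 / k / 2) * (k + 1) = 2 * ((k ^+ 2 - 1) / k ^+ 2).
  by field; rewrite gt_eqF.
rewrite ler_piMr // ler_pdivrMr ?exprn_gt0 // mul1r; lra.
Qed.

(** Rescaled to take values in [-1, 1], [f] can be substituted in the polynomial
    approximations of the absolute value. *)
Lemma uctrig_abs f : uctrig f -> uctrig (fun x => `|f x|).
Proof.
move=> uf; have [M M0 fM] := uctrig_bounded uf.
have uscaled n : uctrig (fun x => abs_approx n (M^-1 * f x)).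
  elim: n => [|n IH] /=; first exact/uctrig_trig/trig_nil.
  apply: uctrigD => //.
  under eq_fun do rewrite mulrC !expr2 -mulNr.
  apply: uctrigZ; apply: uctrigD; apply: uctrigM => //; try exact: uctrigN; exact: uctrigZ.
apply: uctrig_lim => e e0.
have [n nlt] : exists n, n.+1%:R^-1 < e / (2 * M).
  near \oo => n; exists n; near: n.
  by apply: near_infty_natSinv_lt (PosNum (_ : 0 < e / (2 * M))); rewrite divr_gt0 // mulr_gt0.
exists (fun x => M * abs_approx n.+1 (M^-1 * f x)) => [|x]; first exact/uctrigZ/uscaled.
have M1 : `|M^-1 * f x| <= 1.
  by rewrite normrM normfV (gtr0_norm M0) mulrC ler_pdivrMr // mul1r.
have [_ /andP[h0 h1]] := abs_approxP n.+1 M1.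
have -> : `|f x| - M * abs_approx n.+1 (M^-1 * f x) =
  M * (`|M^-1 * f x| - abs_approx n.+1 (M^-1 * f x)).
  by rewrite mulrBr normrM normfV (gtr0_norm M0) mulrA divff ?gt_eqF // mul1r.
rewrite normrM (gtr0_norm M0) (ger0_norm h0).
apply: (@le_trans _ _ (M * (2 * n.+1%:R^-1))).
  rewrite ler_pM2l //; apply: le_trans h1 _.
  by rewrite ler_pM2l // lef_pV2 ?posrE // ler_nat leqW // leqW.
rewrite mulrA -ler_pdivlMl ?mulr_gt0 // mulrC (mulrC M); exact: ltW.
Unshelve. all: end_near. Qed.

Lemma uctrig_max f g : uctrig f -> uctrig g -> uctrig (fun x => Num.max (f x) (g x)).
Proof.
move=> uf ug.
have -> : (fun x => Num.max (f x) (g x)) = (fun x => 2^-1 * ((f x + g x) + `|f x + - g x|)).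
  apply/funext => x; rewrite maxr_absE mulrC //.
by apply: uctrigZ; apply: uctrigD; [|apply: uctrig_abs]; apply: uctrigD => //; exact: uctrigN.
Qed.

Lemma uctrig_min f g : uctrig f -> uctrig g -> uctrig (fun x => Num.min (f x) (g x)).
Proof.
move=> uf ug.
have -> : (fun x => Num.min (f x) (g x)) = (fun x => - Num.max (- f x) (- g x)).
  by apply/funext => x; rewrite oppr_max !opprK.
by apply: uctrigN; apply: uctrig_max; exact: uctrigN.
Qed.

Lemma uctrig_continuous f : uctrig f -> continuous f.
Proof.
move=> uf; suff H (x : E) : f @ x --> f x by exact: H.
apply/(@cvgrPdist_lt _ _ _ _ (nbhs_filter x)) => e e0.
have e30 : 0 < e / 3 by rewrite divr_gt0.
have [p tp fp] := uf _ e30.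
have pc : p @ x --> p x by exact: trig_continuous.
move/(@cvgrPdist_lt _ _ _ _ (nbhs_filter x)) : pc => /(_ _ e30); apply: filterS => y pxy.
have -> : f x - f y = (f x - p x) + (p x - p y) - (f y - p y) by ring.
apply: le_lt_trans (ler_normB _ _) _; apply: le_lt_trans (lerD (ler_normD _ _) (lexx _)) _.
have := fp x; have := fp y; lra.
Qed.

Lemma uctrig_min_seq (G : E -> E -> R) (y0 : E) (s : seq E) :
  (forall y, uctrig (G y)) ->
  exists2 g, uctrig g & forall z, (forall y, y \in y0 :: s -> g z <= G y z) /\
                                 exists2 y, y \in y0 :: s & g z = G y z.
Proof.
move=> uG; elim: s => [|y s [g ug gP]].
  exists (G y0) => // z; split; first by move=> y; rewrite inE => /eqP ->.
  by exists y0; rewrite ?inE.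
exists (fun z => Num.min (G y z) (g z)) => [|z]; first exact: uctrig_min.
have [gle [y' y's gE]] := gP z; split.
  move=> u; rewrite !inE ge_min => /or3P[/eqP ->|/eqP ->|us].
  - by rewrite (gle y0) ?orbT // inE eqxx.
  - by rewrite lexx.
  - by rewrite (gle u) ?orbT // inE us orbT.
case: (leP (G y z) (g z)) => h; first by exists y => //; rewrite !inE eqxx orbT.
by exists y' => //; move: y's; rewrite !inE => /orP[->|->]; rewrite ?orbT.
Qed.

Lemma uctrig_max_seq (G : E -> E -> R) (y0 : E) (s : seq E) :
  (forall y, uctrig (G y)) ->
  exists2 g, uctrig g & forall z, (forall y, y \in y0 :: s -> G y z <= g z) /\
                                 exists2 y, y \in y0 :: s & g z = G y z.
Proof.
move=> uG; have [g ug gP] := @uctrig_min_seq (fun y z => - G y z) y0 s (fun y => uctrigN (uG y)).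
exists (fun z => - g z) => [|z]; first exact: uctrigN.
have [h1 [y ys gE]] := gP z; split; last by exists y => //; rewrite gE opprK.
by move=> u us; rewrite lerNr; exact: h1.
Qed.

(** Lattice form of the theorem of Stone and Weierstrass. For fixed [x],
    functions [h x y] interpolate [f] at [x] and [y]; by compactness a finite
    minimum over [y] is exact at [x] and below [f + e] on [K], and a finite
    maximum of these over [x] is also above [f - e]. *)
Lemma stone_weierstrass (K : set E) f (e : R) : compact K -> continuous f -> 0 < e ->
  exists2 g, uctrig g & forall x, K x -> `|f x - g x| <= e.
Proof.
rewrite compact_cover => cK cf e0.
have H (xy : E * E) : exists p : E -> R, trig p /\ p xy.1 = f xy.1 /\ p xy.2 = f xy.2.
  have [xy12|xyN] := pselect (xy.1 = xy.2).
    by exists (fun=> f xy.1); split; [exact: trig_cst|rewrite -xy12].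
  by have [p tp hp] := trig_two_points (f xy.1) (f xy.2) xyN; exists p.
have [h' hP'] := choice H.
pose h x y := h' (x, y).
have hP x y : trig (h x y) /\ h x y x = f x /\ h x y y = f y := hP' (x, y).
have oplus (g : E -> R) (c : R) : continuous g -> open [set z | g z < f z + c].
  move=> cg.
  have -> : [set z | g z < f z + c] = (fun z => g z - f z) @^-1` [set r | r < c].
    by apply/seteqP; split => z /=; rewrite ltrBlDr addrC.
  apply: open_comp; last exact: open_lt.
  by move=> z _; exact: (cvgB (cg z) (cf z)).
have step x : exists g, [/\ uctrig g, g x = f x & forall z, K z -> g z < f z + e].
  have [||s _ sK] := cK _ setT (fun y => [set z | h x y z < f z + e]).
  - by move=> y _; apply: oplus; exact: trig_continuous (hP x y).1.
  - by move=> z _; exists z => //=; rewrite (hP x z).2.2 ltrDl.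
  have [g ug gP] := @uctrig_min_seq (h x) x (finmap.enum_fset s) (fun y => uctrig_trig (hP x y).1).
  exists g; split => //.
    by have [_ [y _ ->]] := gP x; have [_ []] := hP x y.
  move=> z Kz; have [y ys hyz] := sK z Kz.
  have [gle _] := gP z; apply: le_lt_trans hyz; apply: gle.
  by rewrite inE; apply/orP; right.
have [g gP] := choice step.
have [||s _ sK] := cK _ setT (fun x => [set z | - g x z < - f z + e]).
- move=> x _; have [ug _ _] := gP x.
  have -> : [set z | - g x z < - f z + e] = (fun z => f z - g x z) @^-1` [set r | r < e].
    by apply/seteqP; split => z /=; lra.
  apply: open_comp; last exact: open_lt.
  by move=> z _; exact: (cvgB (cf z) (uctrig_continuous ug (x := z))).
- by move=> z _; exists z => //=; have [_ -> _] := gP z; rewrite ltrDl.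
have [G uG GP] := @uctrig_max_seq g 0 (finmap.enum_fset s) (fun x => let: And3 u _ _ := gP x in u).
exists G => // z Kz; have [leG [y _ GE]] := GP z.
have [x xs hx] := sK z Kz.
have xs' : x \in 0 :: finmap.enum_fset s by rewrite inE; apply/orP; right.
have := leG x xs'; rewrite /= in hx; have [_ _ /(_ z Kz)] := gP y.
by rewrite -GE ler_norml => h1 h2; apply/andP; split; lra.
Qed.

End TrigonometricApproximation.

(** * Convergence in distribution from cosine means *)

Lemma cvg_le_eps (R : realType) (u : nat -> R) (l : R) :
  (forall e : R, 0 < e -> exists N, forall n, (N <= n)%N -> `|u n - l| <= e) ->
  u n @[n --> \oo] --> l.
Proof.
move=> H; apply/cvgrPdist_le => e e0; have [N HN] := H e e0.
by exists N => // n /= Nn; rewrite distrC; exact: HN.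
Qed.

Lemma cvg_eps (R : realType) (u : nat -> R) (l e : R) : u n @[n --> \oo] --> l -> 0 < e ->
  exists N, forall n, (N <= n)%N -> `|u n - l| <= e.
Proof.
move=> /cvgrPdist_le /(_ e) H e0; have [N _ HN] := H e0.
by exists N => n Nn; rewrite distrC; exact: HN.
Qed.

Section Portmanteau.
Context {R : realType} {m : nat}.
Notation E := 'cV[R]_m.

Definition cube (r : R) : set E := [set x | forall i, `|x i 0| <= r].

Lemma compact_cube r : compact (cube r).
Proof.
have cr := @rV_compact R m (fun=> `[- r, r]%classic) (fun=> @segment_compact _ _ _).
have -> : cube r = (fun v : 'rV[R]_m => v^T) @`
   [set v : 'rV[R]_m | forall i, `[- r, r]%classic (v ord0 i)].
  apply/seteqP; split => [x xr|_ [v vr <-] i]; last first.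
    by rewrite mxE ler_norml; have := vr i; rewrite /= in_itv.
  exists x^T; last by rewrite trmxK.
  by move=> i; rewrite /= mxE in_itv /= -ler_norml; exact: xr.
apply: continuous_compact => //; apply: continuous_subspaceT.
apply/continuousP => W oW.
have := oW; rewrite !openE => {}oW v Wv.
have := oW _ Wv; rewrite /interior -!nbhs_ballE => -[e /= e0 sub].
exists e => // u [_ vu]; apply: sub; split => // i j.
by rewrite !mxE; exact: vu.
Qed.

Lemma measurable_cube r : measurable (cube r : set (borel E)).
Proof.
have -> : cube r = \bigcap_(i in [set: 'I_m]) (fun x : borel E => `|(x : E) i 0|) @^-1` `]-oo, r]%classic.
  apply/seteqP; split => x /= h i; first by move=> _ /=; rewrite in_itv /=; exact: h.
  by have := h i I; rewrite /= in_itv.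
apply: fin_bigcap_measurable => [|i _]; first exact: finite_finset.
rewrite -[X in measurable X]setTI.
have mg : measurable_fun setT (fun x : borel E => `|(x : E) i 0|).
  by apply: measurableT_comp => //; exact: measurable_coord.
exact: mg.
Qed.

(** The complements of the cubes decrease to the empty set. *)
Lemma tight_probability (mu : probability (borel E) R) (e : R) : 0 < e ->
  exists r, fine (mu (~` cube r)) <= e.
Proof.
move=> e0.
have cvm : mu (\bigcap_n (~` cube n%:R)) = 0%E.
  have -> : \bigcap_n (~` cube n%:R) = set0; last by rewrite measure0.
  apply/seteqP; split => // x /= H.
  pose M := \sum_i `|x i 0|.
  have := H (Num.bound M) I; apply => i.
  apply: (@le_trans _ _ M); last first.
    by apply/ltW/archi_boundP; exact: sumr_ge0.
  by rewrite /M (bigD1 i) //= lerDl sumr_ge0.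
have h : mu (~` cube n%:R) @[n --> \oo] --> mu (\bigcap_n (~` cube n%:R)).
  apply: nonincreasing_cvg_mu.
  - by rewrite (le_lt_trans (probability_le1 _ _)) ?ltry //; apply: measurableC; exact: measurable_cube.
  - by move=> n; apply: measurableC; exact: measurable_cube.
  - by apply: bigcapT_measurable => n; apply: measurableC; exact: measurable_cube.
  - move=> i j ij; apply/subsetPset/subsetC => x xi k; apply: le_trans (xi k) _.
    by rewrite ler_nat.
rewrite cvm in h; have /fine_cvg h' := h.
have [N HN] := cvg_eps h' e0; exists N%:R.
by have := HN N (leqnn _); rewrite subr0 ger0_norm // fine_ge0.
Qed.

Lemma mean_indic d (T : measurableType d) (P : probability T R) (A : set T) : measurable A ->
  mean P (\1_A) = fine (P A).
Proof. by move=> mA; rewrite /mean /Rintegral integral_indic // setIT. Qed.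

Lemma int1_indic d (T : measurableType d) (P : probability T R) (A : set T) : measurable A ->
  int1 P (\1_A : T -> R).
Proof. by move=> mA; exact: integrable_indic. Qed.

Section Convergence.
Context d (T : measurableType d) (P : probability T R).
Variables (X : nat -> T -> E) (mu : probability (borel E) R).
Hypothesis mX : forall n, measurable_fun setT (X n : T -> borel E).
Hypothesis tightX : forall e : R, 0 < e ->
  exists r, forall n, fine (P (X n @^-1` (~` cube r))) <= e.
Hypothesis cosX : forall t b,
  mean P (fun w => cos (dotp t (X n w) + b)) @[n --> \oo] -->
  mean mu (fun x => cos (dotp t x + b)).

Let mcomp (f : E -> R) n : continuous f -> measurable_fun setT (f \o X n).
Proof. by move=> cf; apply: measurableT_comp (mX n); exact: continuous_measurable_borel. Qed.

Let cvg_trig (p : E -> R) : trig p ->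
  mean P (p \o X n) @[n --> \oo] --> mean mu p.
Proof.
elim=> [|c t b f tf IH].
  rewrite [X in _ --> X]mean_cst.
  have -> : (fun n => mean P ((fun=> 0) \o X n)) = (fun=> 0).
    by apply/funext => n; exact: mean_cst.
  exact: cvg_cst.
have ic n : int1 P (fun w => cos (dotp t (X n w) + b)).
  apply: (@int1_bdd _ _ _ _ _ 1); last by move=> w; exact: cos_max.
  exact: (mcomp n (trig_continuous (trig_cos t b))).
have ic' : int1 mu (fun x => cos (dotp t x + b)).
  apply: (@int1_bdd _ _ _ _ _ 1); last by move=> w; exact: cos_max.
  exact: (continuous_measurable_borel (trig_continuous (trig_cos t b))).
have [M M0 fM] := trig_bounded tf.
have if_ n : int1 P (f \o X n).
  by apply: (@int1_bdd _ _ _ _ _ M) => [|w]; [exact: (mcomp n (trig_continuous tf))|exact: fM].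
have if' : int1 mu f.
  by apply: (@int1_bdd _ _ _ _ _ M) => [|w]; [exact: (continuous_measurable_borel (trig_continuous tf))|exact: fM].
have -> : mean mu (fun x => c * cos (dotp t x + b) + f x) =
  c * mean mu (fun x => cos (dotp t x + b)) + mean mu f.
  by rewrite meanD // ?meanZ //; exact: int1Z.
have -> : (fun n => mean P ((fun x => c * cos (dotp t x + b) + f x) \o X n)) =
  (fun n => c * mean P (fun w => cos (dotp t (X n w) + b)) + mean P (f \o X n)).
  apply/funext => n; rewrite -meanZ // -meanD //; exact: int1Z.
have H := @cosX t b.
apply: cvgD IH; apply: cvgM H; exact: cvg_cst.
Qed.

(** A uniform error on the function is a uniform error on all the means. *)
Let cvg_uctrig (g : E -> R) : uctrig g ->
  mean P (g \o X n) @[n --> \oo] --> mean mu g.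
Proof.
move=> ug; apply: cvg_le_eps => e e0; have e3 : 0 < e / 3 by rewrite divr_gt0.
have [p tp gp] := ug _ e3.
have [N HN] := cvg_eps (cvg_trig tp) e3.
exists N => n Nn; have := HN n Nn => {}HN.
have [M M0 gM] := uctrig_bounded ug.
have [M' M0' pM] := trig_bounded tp.
have cg := uctrig_continuous ug; have cp := trig_continuous tp.
have ig : int1 P (g \o X n) by apply: (@int1_bdd _ _ _ _ _ M) => [|w]; [exact: mcomp|exact: gM].
have ip : int1 P (p \o X n) by apply: (@int1_bdd _ _ _ _ _ M') => [|w]; [exact: mcomp|exact: pM].
have ig' : int1 mu g by apply: (@int1_bdd _ _ _ _ _ M) => [|w]; [exact: continuous_measurable_borel|exact: gM].
have ip' : int1 mu p by apply: (@int1_bdd _ _ _ _ _ M') => [|w]; [exact: continuous_measurable_borel|exact: pM].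
have h1 : `|mean P (g \o X n) - mean P (p \o X n)| <= e / 3.
  rewrite -meanB //; apply: mean_norm_le_cst => [|w]; last exact: gp.
  by apply: measurable_funB; exact: mcomp.
have h2 : `|mean mu g - mean mu p| <= e / 3.
  rewrite -meanB //; apply: mean_norm_le_cst => [|w]; last exact: gp.
  by apply: measurable_funB; exact: continuous_measurable_borel.
by move: HN h1 h2; rewrite !ler_norml; lra.
Qed.

(** On a cube [f] is uniformly close to a member [g] of the uniform closure of
    the trigonometric polynomials, clipped to [-M, M]; clipping keeps it in the
    closure, and outside of the cube, where nothing is known on [f - g] beyond
    [2 * M], tightness takes over. *)
Lemma cvg_mean_continuous (f : E -> R) (M : R) : continuous f -> (forall x, `|f x| <= M) ->
  mean P (f \o X n) @[n --> \oo] --> mean mu f.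
Proof.
move=> cf fM.
have M0 : 0 <= M := le_trans (normr_ge0 _) (fM 0).
have N0 : 0 < M + M + 1 by rewrite ltr_wpDl // addr_ge0.
apply: cvg_le_eps => e e0.
have e5 : 0 < e / 5 by rewrite divr_gt0.
have e5' : 0 < e / 5 / (M + M + 1) by rewrite divr_gt0.
have [r1 Hr1] := tightX e5'; have [r2 Hr2] := tight_probability mu e5'.
pose r := Num.max r1 r2.
have tail1 n : fine (P (X n @^-1` (~` cube r))) <= e / 5 / (M + M + 1).
  apply: le_trans (Hr1 n); apply: fine_le; rewrite ?fin_num_measure //.
  - by rewrite -[X in measurable X]setTI; apply: mX => //; apply: measurableC; exact: measurable_cube.
  - by rewrite -[X in measurable X]setTI; apply: mX => //; apply: measurableC; exact: measurable_cube.
  - apply: le_measure; rewrite ?inE.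
    + by rewrite -[X in measurable X]setTI; apply: mX => //; apply: measurableC; exact: measurable_cube.
    + by rewrite -[X in measurable X]setTI; apply: mX => //; apply: measurableC; exact: measurable_cube.
    + apply: preimage_subset; apply: subsetC => x xr i; apply: le_trans (xr i) _.
      by rewrite le_max lexx.
have tail2 : fine (mu (~` cube r)) <= e / 5 / (M + M + 1).
  apply: le_trans Hr2; apply: fine_le; rewrite ?fin_num_measure //.
  - by apply: measurableC; exact: measurable_cube.
  - by apply: measurableC; exact: measurable_cube.
  - apply: le_measure; rewrite ?inE; try by apply: measurableC; exact: measurable_cube.
    apply: subsetC => x xr i; apply: le_trans (xr i) _.
    by rewrite le_max lexx orbT.
have [g0 ug0 fg0] := stone_weierstrass (compact_cube (r := r)) cf e5.
pose g x := Num.max (- M) (Num.min (g0 x) M).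
have ug : uctrig g.
  by apply: uctrig_max; [|apply: uctrig_min => //]; apply: uctrig_trig; exact: trig_cst.
have gM x : `|g x| <= M.
  by rewrite ler_norml /g le_max lexx /= ge_max ge_min lexx orbT andbT; lra.
have fg x : cube r x -> `|f x - g x| <= e / 5.
  move=> xr; apply: le_trans (fg0 x xr).
  have := fM x; rewrite /g ler_norml => /andP[fM1 fM2].
  case: (leP (g0 x) M) => h1; case: (leP (- M) _) => h2 //; rewrite ler_norml; apply/andP; split;
   have := ler_norm (f x - g0 x); have := ler_norm (- (f x - g0 x)); rewrite normrN; lra.
have fg' x : `|f x - g x| <= e / 5 + (M + M + 1) * \1_(~` cube r) x.
  rewrite indicE; have [xr|xr] := pselect (cube r x).
    rewrite memNset ?mulr0 ?addr0; last by move=> /=; apply.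
    exact: fg.
  rewrite mem_set // mulr1; apply: le_trans (ler_normB _ _) _.
  have := fM x; have := gM x; lra.
have [N HN] := cvg_eps (cvg_uctrig ug) e5.
exists N => n Nn; have {}HN := HN n Nn.
have cg := uctrig_continuous ug.
have if1 : int1 P (f \o X n) by apply: (@int1_bdd _ _ _ _ _ M) => [|w]; [exact: mcomp|exact: fM].
have ig1 : int1 P (g \o X n) by apply: (@int1_bdd _ _ _ _ _ M) => [|w]; [exact: mcomp|exact: gM].
have if2 : int1 mu f by apply: (@int1_bdd _ _ _ _ _ M) => [|w]; [exact: continuous_measurable_borel|exact: fM].
have ig2 : int1 mu g by apply: (@int1_bdd _ _ _ _ _ M) => [|w]; [exact: continuous_measurable_borel|exact: gM].
have mA : measurable (X n @^-1` (~` cube r)).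
  by rewrite -[X in measurable X]setTI; apply: mX => //; apply: measurableC; exact: measurable_cube.
have mB : measurable (~` cube r : set (borel E)) by apply: measurableC; exact: measurable_cube.
have h1 : `|mean P (f \o X n) - mean P (g \o X n)| <= e / 5 + e / 5.
  rewrite -meanB //.
  apply: (@le_trans _ _ (mean P (fun w => e / 5 + (M + M + 1) * \1_(X n @^-1` (~` cube r)) w))).
    apply: mean_norm_le.
    - by apply: measurable_funB; exact: mcomp.
    - by apply: int1D; [exact: int1_cst|apply: int1Z; exact: int1_indic].
    - by move=> w; have := fg' (X n w).
  rewrite meanD; [|exact: int1_cst|by apply: int1Z; exact: int1_indic].
  rewrite mean_cst meanZ; last exact: int1_indic.
  rewrite mean_indic // lerD2l.
  by have := ler_wpM2l (ltW N0) (tail1 n); rewrite mulrC [leRHS]mulrC divfK ?gt_eqF // mulrC.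
have h2 : `|mean mu f - mean mu g| <= e / 5 + e / 5.
  rewrite -meanB //.
  apply: (@le_trans _ _ (mean mu (fun x => e / 5 + (M + M + 1) * \1_(~` cube r) x))).
    apply: mean_norm_le.
    - by apply: measurable_funB; exact: continuous_measurable_borel.
    - by apply: int1D; [exact: int1_cst|apply: int1Z; exact: int1_indic].
    - by move=> w; have := fg' w.
  rewrite meanD; [|exact: int1_cst|by apply: int1Z; exact: int1_indic].
  rewrite mean_cst meanZ; last exact: int1_indic.
  rewrite mean_indic // lerD2l.
  by have := ler_wpM2l (ltW N0) tail2; rewrite mulrC [leRHS]mulrC divfK ?gt_eqF // mulrC.
by move: HN h1 h2; rewrite !ler_norml; lra.
Qed.

End Convergence.

(** A constant sequence of laws is tight, so that uniqueness is a special case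
    of convergence. *)
Lemma mean_eq_continuous (mu nu : probability (borel E) R) :
  (forall t b, mean mu (fun x => cos (dotp t x + b)) = mean nu (fun x => cos (dotp t x + b))) ->
  forall (f : E -> R) (M : R), continuous f -> (forall x, `|f x| <= M) -> mean mu f = mean nu f.
Proof.
move=> H f M cf fM.
have := @cvg_mean_continuous _ (borel E) mu (fun _ x => x) nu _ _ _ f M cf fM.
move=> h; have {}h : mean mu f @[_ --> \oo] --> mean nu f.
  apply: h.
  - by move=> _ _ A mA; rewrite setTI preimage_id.
  - move=> e e0; have [r Hr] := tight_probability mu e0; exists r => _; exact: Hr.
  - by move=> t b; rewrite H; exact: cvg_cst.
have h' : mean mu f @[_ --> \oo] --> mean mu f by exact: cvg_cst.
exact: cvg_unique h' h.
Qed.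

End Portmanteau.

(** * Continuous functions determine a probability *)

Section BoxesAndDensity.
Context {R : realType} {m : nat}.
Notation E := 'cV[R]_m.

Definition orthant (c : E) : set E := [set x | forall i, x i 0 < c i 0].
Definition orthants : set (set E) := range orthant.

Lemma orthant_measurable c : measurable (orthant c : set (borel E)).
Proof.
have -> : orthant c = \bigcap_(i in [set: 'I_m]) (fun x : borel E => (x : E) i 0) @^-1` `]-oo, c i 0[%classic.
  apply/seteqP; split => x /= h i; first by move=> _ /=; rewrite in_itv /=; exact: h.
  by have := h i I; rewrite /= in_itv.
apply: fin_bigcap_measurable => [|i _]; first exact: finite_finset.
by rewrite -[X in measurable X]setTI; exact: (measurable_coord i).
Qed.

Lemma orthants_setI : setI_closed orthants.
Proof.
move=> _ _ [c _ <-] [c' _ <-]; exists (\col_i Num.min (c i 0) (c' i 0)) => //.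
apply/seteqP; split => x /=.
  by move=> h; split => i; have := h i; rewrite mxE lt_min => /andP[].
by move=> [h1 h2] i; rewrite mxE lt_min h1 h2.
Qed.

Lemma bigcup_orthant : \bigcup_n orthant (const_mx n%:R) = setT.
Proof.
apply/seteqP; split => // x _.
pose M := \sum_i `|x i 0|.
exists (Num.bound M) => //= i; rewrite mxE.
apply: le_lt_trans (archi_boundP _); last exact: sumr_ge0.
apply: le_trans (ler_norm _) _.
by rewrite /M (bigD1 i) //= lerDl sumr_ge0.
Qed.

(** The identity is measurable from the sigma-algebra generated by the orthants,
    since its coordinates are: a half space is a countable union of orthants. *)
Lemma sigma_orthants : @measurable _ (borel E) = <<s orthants >>.
Proof.
apply/seteqP; split; last first.
  apply: smallest_sub; first exact: sigma_algebra_measurable.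
  by move=> _ [c _ <-]; exact: orthant_measurable.
have mid : measurable_fun setT ((fun x => x) : g_sigma_algebraType orthants -> borel E).
  apply: measurable_cV => i.
  apply: (@measurability _ _ (g_sigma_algebraType orthants) R setT _ _ (RGenInftyO.measurableE R)).
  move=> _ [_ [c ->] <-]; rewrite setTI.
  have -> : (fun x : E => x i 0) @^-1` `]-oo, c[%classic =
    \bigcup_n orthant (\col_j if j == i then c else n%:R).
    apply/seteqP; split => x /=; rewrite in_itv /=; last first.
      by move=> [n _ /(_ i)]; rewrite mxE eqxx.
    move=> xc; have : (\bigcup_n orthant (const_mx n%:R)) x by rewrite bigcup_orthant.
    move=> [n _ xn]; exists n => // j; rewrite mxE; case: eqP => [-> //|_].
    by have := xn j; rewrite mxE.
  apply: bigcupT_measurable => n; apply: sub_sigma_algebra.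
  by eexists.
by move=> A mA; have := mid measurableT A mA; rewrite setTI preimage_id.
Qed.

(** Continuous functions increasing to the indicator of the open orthant: in each
    coordinate a ramp of slope [n] that vanishes from [c i 0] on. *)
Definition orthant_approx (c : E) (n : nat) (x : E) : R :=
  \prod_i Num.min 1 (n%:R * Num.max 0 (c i 0 - x i 0)).

Lemma orthant_approx_itv c n x : 0 <= orthant_approx c n x <= 1.
Proof.
apply/andP; split.
  by apply: prodr_ge0 => i _; rewrite le_min ler01 mulr_ge0 // le_max lexx.
apply: prodr_ile1 => i _; rewrite le_min ler01 mulr_ge0 ?ge_min ?lexx //.
by rewrite le_max lexx.
Qed.

Lemma orthant_approx_cvg c x :
  orthant_approx c n x @[n --> \oo] --> (\1_(orthant c) x : R).
Proof.
have -> : \1_(orthant c) x = \prod_(i < m) (x i 0 < c i 0)%R%:R :> R.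
  rewrite indicE; have [xc|xc] := pselect (orthant c x).
    by rewrite mem_set // big1 // => i _; rewrite xc.
  rewrite memNset //; have [i /negP/negPf xi] : exists i, ~ (x i 0 < c i 0) by apply/existsNP.
  by rewrite (bigD1 i) //= xi mul0r.
apply: (@cvg_big R _ *%R 1 xpredT).
  by move=> z; exact: mul_continuous.
move=> i _; case: (ltP (x i 0) (c i 0)) => h; last first.
  have -> : (fun n => Num.min 1 (n%:R * Num.max 0 (c i 0 - x i 0))) = fun=> 0.
    apply/funext => n; rewrite max_l ?subr_le0 // mulr0.
    by rewrite min_r.
  exact: cvg_cst.
have h0 : 0 < c i 0 - x i 0 by rewrite subr_gt0.
apply: cvg_near_cst; near=> n.
rewrite max_r ?ltW // min_l // -ler_pdivrMr // mul1r.
by near: n; exact: nbhs_infty_ger.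
Unshelve. all: end_near. Qed.

Lemma orthant_approx_continuous c n : continuous (orthant_approx c n).
Proof.
apply: (@continuous_big R _ *%R 1 xpredT _ E).
  by move=> z; exact: mul_continuous.
move=> i _.
pose g (a : R) : R := Num.min 1 (n%:R * Num.max 0 a).
have cg : continuous g.
  move=> a.
  have h0 : {for a, continuous ((cst 0 : R -> R^o) \max (id : R -> R^o))}.
    by apply: continuous_max; [exact: cvg_cst|exact: cvg_id].
  have h1 : {for a, continuous (fun a : R => n%:R * Num.max 0 a : R^o)}.
    exact: (cvgM (cvg_cst _) h0).
  have h2 : {for a, continuous (cst 1 : R -> R^o)} by exact: cvg_cst.
  exact: (continuous_min h2 h1).
suff H (x : E) : (fun x : E => g (c i 0 - x i 0)) @ x --> g (c i 0 - x i 0).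
  by move=> x; exact: H.
have h1 : {for x, continuous (fun x : E => c i 0 - x i 0)}.
  exact: (cvgB (cvg_cst _) (@coord_continuous R m 1 i 0 x)).
exact: (continuous_comp h1 (cg _)).
Qed.

Lemma int1_continuous_bdd (mu : probability (borel E) R) (f : E -> R) (M : R) :
  continuous f -> (forall x, `|f x| <= M) -> int1 mu f.
Proof.
move=> cf fM; apply: (@int1_bdd _ _ _ _ _ M) => //.
exact: continuous_measurable_borel.
Qed.

Lemma orthant_approx_norm c n x : `|orthant_approx c n x| <= 1.
Proof. by have /andP[h0 h1] := orthant_approx_itv c n x; rewrite ger0_norm. Qed.

Lemma cvg_mean_orthant (mu : probability (borel E) R) c :
  mean mu (orthant_approx c n) @[n --> \oo] --> fine (mu (orthant c)).
Proof.
have mo := orthant_measurable c.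
rewrite -mean_indic //.
apply: (@mean_dct _ _ _ _ _ _ (fun=> 1)).
- by move=> n; apply: continuous_measurable_borel; exact: orthant_approx_continuous.
- exact: measurable_indic.
- by apply: aeW => x; exact: orthant_approx_cvg.
- exact: int1_cst.
- by move=> n x; exact: orthant_approx_norm.
Qed.

(** Orthants are stable under intersection and generate the Borel sets, and the
    probability of an orthant is a limit of means of continuous functions. *)
Lemma probability_eq_continuous (mu nu : probability (borel E) R) :
  (forall (f : E -> R) (M : R), continuous f -> (forall x, `|f x| <= M) ->
     mean mu f = mean nu f) ->
  forall A, measurable A -> mu A = nu A.
Proof.
move=> H A mA.
apply: (@measure_unique _ R (borel E) orthants (fun n => orthant (const_mx n%:R)) sigma_orthants orthants_setI _ bigcup_orthant mu nu _ _ A mA).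
- by move=> n; exists (const_mx n%:R).
- move=> _ [c _ <-].
  rewrite -[LHS]fineK ?fin_num_measure //; last exact: orthant_measurable.
  rewrite -[RHS]fineK ?fin_num_measure //; last exact: orthant_measurable.
  congr (_%:E); have h1 := @cvg_mean_orthant mu c; have h2 := @cvg_mean_orthant nu c.
  have h3 : mean mu (orthant_approx c n) @[n --> \oo] --> fine (nu (orthant c)).
    have -> : (fun n => mean mu (orthant_approx c n)) = (fun n => mean nu (orthant_approx c n)).
      apply/funext => n; apply: (H _ 1); first exact: orthant_approx_continuous.
      by move=> x; exact: orthant_approx_norm.
    exact: h2.
  exact: cvg_unique h1 h3.
- by move=> n; rewrite (le_lt_trans (probability_le1 _ _)) ?ltry //; exact: orthant_measurable.
Qed.

(** Continuous approximations with values in [0, 1] are stable under complement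
    and product, which makes the approximable sets a sigma-algebra. *)
Section Density.
Variable nu : probability (borel E) R.

Definition approximable (A : set E) := measurable (A : set (borel E)) /\
  forall e : R, 0 < e -> exists g : E -> R,
    [/\ continuous g, forall x, 0 <= g x <= 1 &
        mean nu (fun x => `|\1_A x - g x|) <= e].

Let norm01 (a : R) : 0 <= a <= 1 -> `|a| <= 1.
Proof. by move=> /andP[a0 a1]; rewrite ger0_norm. Qed.

Let int1_diff (A : set E) (g : E -> R) : measurable (A : set (borel E)) -> continuous g ->
  (forall x, 0 <= g x <= 1) -> int1 nu (fun x => `|\1_A x - g x|).
Proof.
move=> mA cg g01; apply: int1_norm; apply: int1B; first exact: int1_indic.
by apply: (int1_continuous_bdd nu cg) => x; exact: norm01.
Qed.

Lemma approximable_orthant c : approximable (orthant c).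
Proof.
have mo := orthant_measurable c.
split => // e e0.
have h : mean nu (fun x => `|\1_(orthant c) x - orthant_approx c n x|) @[n --> \oo] --> mean nu (fun=> 0).
  apply: (@mean_dct _ _ _ _ _ _ (fun=> 2)).
  - move=> n; apply: int1_meas; apply: int1_diff => //; first exact: orthant_approx_continuous.
    by move=> x; exact: orthant_approx_itv.
  - exact: measurable_cst.
  - apply: aeW => x; rewrite -[X in _ --> X](@normr0 _ R) -(subrr (\1_(orthant c) x)).
    apply: cvg_norm; apply: cvgB; [exact: cvg_cst|exact: orthant_approx_cvg].
  - exact: int1_cst.
  - move=> n x; rewrite normr_id; apply: le_trans (ler_normB _ _) _.
    have h1 := orthant_approx_norm c n x.
    have h2 : `|\1_(orthant c) x : R| <= 1 by rewrite indicE; case: (_ \in _); rewrite ?normr1 ?normr0.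
    lra.
rewrite mean_cst in h; have [N HN] := cvg_eps h e0.
exists (orthant_approx c N); split; first exact: orthant_approx_continuous.
  by move=> x; exact: orthant_approx_itv.
by have := HN N (leqnn _); rewrite subr0; apply: le_trans; exact: ler_norm.
Qed.

Lemma approximableC A : approximable A -> approximable (~` A).
Proof.
move=> [mA HA]; split; first exact: measurableC.
move=> e e0; have [g [cg g01 gA]] := HA e e0.
exists (fun x => 1 - g x); split.
- suff H (x : E) : (fun x => 1 - g x) @ x --> 1 - g x by move=> x; exact: H.
  exact: (cvgB (cvg_cst _) (cg x)).
- by move=> x; have := g01 x; lra.
- have -> : (fun x => `|\1_(~` A) x - (1 - g x)|) = (fun x => `|\1_A x - g x|).
    apply/funext => x; rewrite !indicE in_setC distrC; congr (`|_|).
    by case: (x \in A) => /=; ring.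
  exact: gA.
Qed.

Lemma approximableI A B : approximable A -> approximable B -> approximable (A `&` B).
Proof.
move=> [mA HA] [mB HB]; split; first exact: measurableI.
move=> e e0; have e2 : 0 < e / 2 by rewrite divr_gt0.
have [g [cg g01 gA]] := HA _ e2; have [k [ck k01 kB]] := HB _ e2.
have cgk : continuous (fun x => g x * k x).
  suff H (x : E) : (fun x => g x * k x) @ x --> g x * k x by move=> x; exact: H.
  exact: (cvgM (cg x) (ck x)).
have gk01 x : 0 <= g x * k x <= 1.
  have /andP[g0 g1] := g01 x; have /andP[k0 k1] := k01 x.
  by rewrite mulr_ge0 //= mulr_ile1.
exists (fun x => g x * k x); split => //.
rewrite [leRHS](splitr e); apply: le_trans (lerD gA kB).
rewrite -meanD; [|exact: int1_diff|exact: int1_diff].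
apply: mean_le.
- by apply: int1_diff => //; exact: measurableI.
- by apply: int1D; exact: int1_diff.
- move=> x; have -> : \1_(A `&` B) x = \1_A x * \1_B x :> R.
    by rewrite !indicE in_setI; case: (x \in A); case: (x \in B); rewrite ?mulr1 ?mulr0.
  have -> : \1_A x * \1_B x - g x * k x = (\1_A x - g x) * \1_B x + g x * (\1_B x - k x) by ring.
  apply: le_trans (ler_normD _ _) _; rewrite !normrM; apply: lerD.
    by rewrite ler_piMr // indicE; case: (_ \in _); rewrite ?normr1 ?normr0.
  by rewrite ler_piMl // norm01.
Qed.

(** Finite unions reduce to intersections and complements; a countable union is
    then approached by its partial unions. *)
Lemma approximable_bigcup (F : nat -> set E) : (forall n, approximable (F n)) ->
  approximable (\bigcup_n F n).
Proof.
move=> HF.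
have a0 : approximable set0.
  split; first exact: measurable0.
  move=> e e0; exists (fun=> 0); split.
  - exact: cst_continuous.
  - by move=> _; rewrite lexx ler01.
  - have -> : (fun x : E => `|\1_set0 x - 0| : R) = (fun=> 0).
      by apply/funext => x; rewrite indicE in_set0 subr0 normr0.
    by rewrite mean_cst ltW.
pose G n := \big[setU/set0]_(i < n) F i.
have aG n : approximable (G n).
  elim: n => [|n IH]; first by rewrite /G big_ord0.
  rewrite /G big_ord_recr /= -/(G n).
  rewrite -[X in approximable X]setCK setCU.
  by apply: approximableC; apply: approximableI; exact: approximableC.
have mU : measurable (\bigcup_n F n : set (borel E)).
  by apply: bigcupT_measurable => n; have [] := HF n.
split => // e e0; have e2 : 0 < e / 2 by rewrite divr_gt0.
have h : mean nu (fun x => `|\1_(\bigcup_n F n) x - \1_(G n) x|) @[n --> \oo] --> mean nu (fun=> 0).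
  apply: (@mean_dct _ _ _ _ _ _ (fun=> 1)).
  - move=> n; apply: int1_meas; apply: int1_norm; apply: int1B; apply: int1_indic => //.
    by have [] := aG n.
  - exact: measurable_cst.
  - apply: aeW => x; rewrite -[X in _ --> X](@normr0 _ R) -(subrr (\1_(\bigcup_n F n) x)).
    apply: cvg_norm; apply: cvgB; first exact: cvg_cst.
    apply: cvg_near_cst.
    have [xU|xU] := pselect ((\bigcup_n F n) x); last first.
      apply: nearW => n; rewrite !indicE memNset; last first.
        by rewrite /G -bigcup_mkord => -[i _ Fi]; apply: xU; exists i.
      by rewrite memNset.
    have [k _ Fk] := xU.
    near=> n; rewrite !indicE mem_set; last first.
      rewrite /G -bigcup_mkord; exists k => //=.
      by near: n; exact: nbhs_infty_gt.
    by rewrite mem_set.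
  - exact: int1_cst.
  - move=> n x; rewrite normr_id !indicE.
    by case: (_ \in _); case: (_ \in _); rewrite ?subrr ?subr0 ?sub0r ?normrN ?normr1 ?normr0.
rewrite mean_cst in h; have [N HN] := cvg_eps h e2.
have {}HN := HN N (leqnn _); rewrite subr0 in HN.
have [g [cg g01 gG]] := (aG N).2 _ e2.
exists g; split => //.
rewrite [leRHS](splitr e).
apply: le_trans (lerD (le_trans (ler_norm _) HN) gG).
have iU : int1 nu (fun x => `|\1_(\bigcup_n F n) x - \1_(G N) x|).
  by apply: int1_norm; apply: int1B; apply: int1_indic => //; have [] := aG N.
rewrite -meanD //; last by apply: int1_diff => //; have [] := aG N.
apply: mean_le.
- exact: int1_diff.
- by apply: int1D => //; apply: int1_diff => //; have [] := aG N.
- by move=> x; exact: ler_distD.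
Unshelve. exact: nu. end_near. Qed.

Lemma approximable_measurable A : measurable (A : set (borel E)) -> approximable A.
Proof.
rewrite sigma_orthants; move: A.
apply: smallest_sub; last by move=> _ [c _ <-]; exact: approximable_orthant.
have a0 : approximable set0.
  have := approximableI (approximable_orthant 0) (approximableC (approximable_orthant 0)).
  by rewrite setICr.
split => //.
- by move=> A aA; rewrite setTD; exact: approximableC.
- by move=> F HF; exact: approximable_bigcup.
Qed.

End Density.
End BoxesAndDensity.

(** * Density of bounded continuous functions *)

Section L1Density.
Context {R : realType} {m : nat}.
Notation E := 'cV[R]_m.
Variable nu : probability (borel E) R.

Definition L1_approximable (f : E -> R) := int1 nu f /\
  forall e : R, 0 < e -> exists (g : E -> R) (M : R),
    [/\ continuous g, forall x, `|g x| <= M & mean nu (fun x => `|f x - g x|) <= e].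

Lemma L1_approximableD f g : L1_approximable f -> L1_approximable g ->
  L1_approximable (fun x => f x + g x).
Proof.
move=> [fi Hf] [gi Hg]; split; first exact: int1D.
move=> e e0; have e2 : 0 < e / 2 by rewrite divr_gt0.
have [f' [M [cf fM ff']]] := Hf _ e2; have [g' [N [cg gN gg']]] := Hg _ e2.
have fi' := int1_continuous_bdd nu cf fM; have gi' := int1_continuous_bdd nu cg gN.
exists (fun x => f' x + g' x), (M + N); split.
- suff H (x : E) : (fun x => f' x + g' x) @ x --> f' x + g' x by move=> x; exact: H.
  exact: (cvgD (cf x) (cg x)).
- by move=> x; apply: le_trans (ler_normD _ _) _; exact: lerD.
- rewrite [leRHS](splitr e); apply: le_trans (lerD ff' gg').
  rewrite -meanD; [|exact/int1_norm/int1B|exact/int1_norm/int1B].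
  apply: mean_le.
  + by apply: int1_norm; apply: int1B; exact: int1D.
  + by apply: int1D; apply: int1_norm; exact: int1B.
  + by move=> x; rewrite opprD addrACA; exact: ler_normD.
Qed.

Lemma L1_approximableZ (c : R) f : L1_approximable f -> L1_approximable (fun x => c * f x).
Proof.
move=> [fi Hf]; split; first exact: int1Z.
move=> e e0; have c0 : 0 < `|c| + 1 by rewrite ltr_wpDl.
have e2 : 0 < e / (`|c| + 1) by rewrite divr_gt0.
have [f' [M [cf fM ff']]] := Hf _ e2.
have fi' := int1_continuous_bdd nu cf fM.
exists (fun x => c * f' x), (`|c| * M); split.
- suff H (x : E) : (fun x => c * f' x) @ x --> c * f' x by move=> x; exact: H.
  exact: (cvgM (cvg_cst _) (cf x)).
- by move=> x; rewrite normrM ler_wpM2l.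
- have -> : (fun x => `|c * f x - c * f' x|) = (fun x => `|c| * `|f x - f' x|).
    by apply/funext => x; rewrite -mulrBr normrM.
  rewrite meanZ; last exact/int1_norm/int1B.
  apply: (@le_trans _ _ ((`|c| + 1) * mean nu (fun x => `|f x - f' x|))).
    by rewrite ler_wpM2r ?lerDl // mean_ge0.
  by rewrite mulrC -ler_pdivlMr.
Qed.

Lemma L1_approximable_indic A : measurable (A : set (borel E)) ->
  L1_approximable (\1_A).
Proof.
move=> mA; split; first exact: int1_indic.
move=> e e0; have [_ /(_ e e0)[g [cg g01 gA]]] := approximable_measurable nu mA.
by exists g, 1; split => // x; have /andP[g0 g1] := g01 x; rewrite ger0_norm.
Qed.

Lemma L1_approximable_sum (s : seq R) (f : R -> E -> R) :
  (forall y, L1_approximable (f y)) -> L1_approximable (fun x => \sum_(y <- s) f y x).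
Proof.
move=> H; elim: s => [|y s IH].
  have -> : (fun x : E => \sum_(y <- [::]) f y x) = (fun x => 0 * f 0 x).
    by apply/funext => x; rewrite big_nil mul0r.
  exact: L1_approximableZ.
have -> : (fun x : E => \sum_(z <- y :: s) f z x) = (fun x => f y x + \sum_(z <- s) f z x).
  by apply/funext => x; rewrite big_cons.
exact: L1_approximableD.
Qed.

(** Integrable functions are L1-limits of simple functions, and indicators of
    Borel sets are L1-limits of continuous functions. *)
Lemma L1_density (f : E -> R) (e : R) : int1 nu f -> 0 < e ->
  exists (g : E -> R) (M : R),
    [/\ continuous g, forall x, `|g x| <= M & mean nu (fun x => `|f x - g x|) <= e].
Proof.
move=> fi e0; have e2 : 0 < e / 2 by rewrite divr_gt0.
have [g_ [gi _ gf]] := approximation_sfun_integrable measurableT fi.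
have h : mean nu (fun x => `|f x - g_ n x|) @[n --> \oo] --> 0.
  by move/fine_cvg : gf; exact: cvg_trans.
have [N HN] := cvg_eps h e2; have {}HN := HN N (leqnn _); rewrite subr0 in HN.
have [_ /(_ _ e2)[g [M [cg gM gg]]]] : L1_approximable (g_ N).
  have -> : (g_ N : E -> R) = fun x => \sum_(y <- finmap.enum_fset (fset_set (range (g_ N)))) y * \1_(g_ N @^-1` [set y]) x.
    apply/funext => x; rewrite [LHS]fimfunE fsbig_finite //.
  apply: L1_approximable_sum => y; apply: L1_approximableZ; apply: L1_approximable_indic.
  by rewrite -[X in measurable X]setTI; exact: (measurable_funP (g_ N)).
exists g, M; split => //; rewrite [leRHS](splitr e).
apply: le_trans (lerD (le_trans (ler_norm _) HN) gg).
have gi' := int1_continuous_bdd nu cg gM; have giN := gi N.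
rewrite -meanD; [|exact/int1_norm/int1B|exact/int1_norm/int1B].
apply: mean_le.
- exact/int1_norm/int1B.
- by apply: int1D; apply: int1_norm; exact: int1B.
- by move=> x; exact: ler_distD.
Qed.

End L1Density.

(** * Gaussian vectors *)

Section Gaussian.
Context {R : realType}.

Definition quad {m : nat} (C : 'M[R]_m) (t : 'cV[R]_m) : R := (t^T *m C *m t) 0 0.

Definition psd {m : nat} (C : 'M[R]_m) := C^T = C /\ forall t, 0 <= quad C t.

(** Cosines with an arbitrary phase carry the real and the imaginary part of the
    characteristic function. *)
Definition gaussian_cos {m : nat} (C : 'M[R]_m) (mu : probability (borel 'cV[R]_m) R) :=
  forall (t : 'cV[R]_m) (b : R),
    mean mu (fun x => cos (dotp t x + b)) = cos b * expR (- (quad C t / 2)).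

Let mcos {m : nat} (t : 'cV[R]_m) (b : R) :
  measurable_fun setT (fun x : borel 'cV[R]_m => cos (dotp t x + b)).
Proof. exact: (continuous_measurable_borel (trig_continuous (trig_cos t b))). Qed.

Lemma int1_cos d (T : measurableType d) (P : probability T R) (X : T -> R) :
  measurable_fun setT X -> int1 P (fun w => cos (X w)).
Proof.
move=> mX; apply: (@int1_bdd _ _ _ _ _ 1) => [|w]; last exact: cos_max.
apply: measurableT_comp mX; apply: continuous_measurable_fun; exact: continuous_cos.
Qed.

(** A projection of [mu] and the one-dimensional normal law have the same cosine
    means, hence are equal. The comparison takes place on column vectors of length
    one, and a vanishing variance gives a Dirac mass. *)
Lemma gaussian_centered_normal m (C : 'M[R]_m) mu : psd C -> gaussian_cos C mu ->
  is_centered_normal C mu.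
Proof.
move=> [_ Cpos] Hmu t A mA; set v := (_ 0 0).
have v0 : 0 <= v by exact: Cpos.
pose c1 (y : R) : 'cV[R]_1 := \col__ y.
have c1E y : c1 y 0 0 = y by rewrite mxE.
have mc1 : measurable_fun setT (c1 : R -> borel 'cV[R]_1).
  apply: measurable_cV => i; rewrite (_ : (fun y => c1 y i 0) = id); first exact: measurable_id.
  by apply/funext => y; rewrite mxE.
have md : measurable_fun setT (fun x : borel 'cV[R]_m => dotp t x).
  by apply: continuous_measurable_borel; exact: continuous_dotp.
have mX : measurable_fun setT ((fun x => c1 (dotp t x)) : borel 'cV[R]_m -> borel 'cV[R]_1).
  exact: (measurableT_comp mc1 md).
pose B : set 'cV[R]_1 := [set z | A (z 0 0)].
have mB : measurable (B : set (borel 'cV[R]_1)).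
  by rewrite -[X in measurable X]setTI; exact: (measurable_coord 0).
have dot1 (u : 'cV[R]_1) (y : R) : dotp u (c1 y) = u 0 0 * y.
  by rewrite dotpE big_ord1 mxE.
suff [nu nuA nucos] : exists2 nu : probability (measurableTypeR R) R, nu A = normal_law v A &
    forall u b, mean nu (fun y => cos (u * y + b)) = cos b * expR (- (v * u ^+ 2 / 2)).
  have E1 : law mu mX B = law nu mc1 B.
    apply: probability_eq_continuous => //; apply: mean_eq_continuous => u b.
    have mu1 : measurable_fun setT (fun y : R => u 0 0 * y + b).
      by apply: measurable_funD => //; apply: measurable_funM.
    rewrite (mean_law _ (mcos u b)); last first.
      rewrite /comp /=; under eq_fun do rewrite dot1.
      exact: (int1_cos mu (measurableT_comp mu1 md)).
    rewrite (mean_law _ (mcos u b)); last first.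
      by rewrite /comp /=; under eq_fun do rewrite dot1; exact: (int1_cos nu mu1).
    rewrite /comp; under [in RHS]eq_fun do rewrite dot1; rewrite nucos.
    have -> : (fun x : 'cV[R]_m => cos (dotp u (c1 (dotp t x)) + b)) =
              (fun x => cos (dotp (u 0 0 *: t) x + b)).
      by apply/funext => x; rewrite dot1 !dotpE mulr_sumr; congr (cos (_ + _)); apply: eq_bigr => i _; rewrite mxE mulrA.
    rewrite Hmu; congr (_ * expR (- (_ / 2))).
    have trZ : (u 0 0 *: t)^T = u 0 0 *: t^T by apply/matrixP => i j; rewrite !mxE.
    by rewrite /quad trZ -!scalemxAl -scalemxAr [LHS]mxE [X in _ * X]mxE /v; ring.
  have e1 : law mu mX B = mu [set x | A ((t^T *m (x : 'cV_m)) 0 0)].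
    rewrite -[LHS]/(mu ((fun x => c1 (dotp t x)) @^-1` B)); congr (mu _).
    by apply/seteqP; split => x; rewrite /B /= c1E.
  have e2 : law nu mc1 B = nu A.
    rewrite -[LHS]/(nu (c1 @^-1` B)); congr (nu _).
    by apply/seteqP; split => x; rewrite /B /= c1E.
  by rewrite -e1 E1 e2 nuA.
rewrite /normal_law; case: eqP => [v00|/eqP vn0].
  exists (\d_(0 : measurableTypeR R)) => // u b.
  rewrite /mean /Rintegral integral_dirac //=; last first.
    apply/measurable_EFinP; apply: measurableT_comp.
      by apply: continuous_measurable_fun; exact: continuous_cos.
    by apply: measurable_funD => //; apply: measurable_funM.
  rewrite v00 !mul0r oppr0 expR0 mulr1 mulr0 add0r.
  by rewrite indicE in_setT mul1r.
have s0 : Num.sqrt v != 0 by rewrite sqrtr_eq0 -ltNge lt_neqAle eq_sym vn0.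
exists (normal_prob 0 (Num.sqrt v)) => // u b.
by rewrite normal_cos // sqr_sqrtr.
Qed.

Lemma dotpC m (s t : 'cV[R]_m) : dotp s t = dotp t s.
Proof. by rewrite !dotpE; apply: eq_bigr => i _; rewrite mulrC. Qed.

Lemma dotp_col_mx m (s s' : R) (t x : 'cV[R]_m) :
  dotp (col_mx (s%:M : 'M[R]_1) t) (col_mx (s'%:M : 'M[R]_1) x) = s * s' + dotp t x.
Proof.
rewrite /dotp tr_col_mx mul_row_col mxE tr_scalar_mx -scalar_mxM.
by rewrite [X in X + _]mxE eqxx mulr1n.
Qed.

Let mx11D (A B : 'M[R]_1) : (A + B) 0 0 = A 0 0 + B 0 0. Proof. by rewrite mxE. Qed.
Let mx11B (A B : 'M[R]_1) : (A - B) 0 0 = A 0 0 - B 0 0. Proof. by rewrite !mxE. Qed.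
Let mx11Z (c : R) (A : 'M[R]_1) : (c *: A) 0 0 = c * A 0 0. Proof. by rewrite mxE. Qed.

(** A covariance matrix of dimension [1 + m] is cut into a scalar [a], a vector
    [b] and a block [D]. *)
Lemma quad_block m (a : R) (b : 'cV[R]_m) (D : 'M[R]_m) (s : R) (t : 'cV[R]_m) :
  quad (block_mx a%:M b^T b D : 'M[R]_(1 + m)) (col_mx (s%:M : 'M[R]_1) t) =
  a * s ^+ 2 + 2 * s * dotp b t + quad D t.
Proof.
rewrite /quad tr_col_mx mul_row_block mul_row_col tr_scalar_mx.
rewrite !mulmxDl !mul_scalar_mx -!scalemxAl !mul_mx_scalar.
rewrite !mx11D !mx11Z [a%:M 0 0]mxE eqxx mulr1n.
rewrite -/(dotp t b) -/(dotp b t) (dotpC t b); ring.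
Qed.

Lemma quad_subrank1 m (b : 'cV[R]_m) (D : 'M[R]_m) (c : R) (t : 'cV[R]_m) :
  quad (D - c *: (b *m b^T)) t = quad D t - c * dotp b t ^+ 2.
Proof.
have E : (t^T *m (b *m b^T) *m t) 0 0 = dotp b t ^+ 2.
  rewrite mulmxA -(mulmxA (t^T *m b)) [LHS]mxE big_ord1.
  by rewrite -/(dotp t b) -/(dotp b t) (dotpC t b) expr2.
by rewrite /quad mulmxBr mulmxBl -scalemxAr -scalemxAl mx11B mx11Z E.
Qed.

Lemma std_normal_cos : exists N : probability R R, forall u c : R,
  mean N (fun y => cos (u * y + c)) = cos c * expR (- (u ^+ 2 / 2)).
Proof.
have mid : measurable_fun setT (id : measurableTypeR R -> R) by move=> _ A mA; rewrite setTI.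
pose N01 : probability (measurableTypeR R) R := normal_prob 0 1.
exists (law N01 mid) => u c.
have mu : measurable_fun setT (fun y : R => u * y + c).
  by apply: measurable_funD => //; apply: measurable_funM.
have mcu : measurable_fun setT (fun y : R => cos (u * y + c)).
  by apply: measurableT_comp mu; apply: continuous_measurable_fun; exact: continuous_cos.
rewrite mean_law //; last exact: (int1_cos N01 mu).
have := @normal_cos R 1 (oner_neq0 R) c u.
by rewrite expr1n mul1r.
Qed.

(** One step of the Cholesky recursion: with [N] standard normal and [G]
    independent of [N] with the Schur complement [D - a^-1 *: (b *m b^T)] as
    covariance matrix, the vector with head [sqrt a * N] and tail
    [G + (N / sqrt a) *: b] has covariance [C]. When [a = 0], nonnegativity forces
    [b = 0], and the same formulas hold because [0^-1 = 0]. *)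
Lemma exists_gaussian m (C : 'M[R]_m) : psd C -> exists mu : probability (borel 'cV[R]_m) R, gaussian_cos C mu.
Proof.
elim: m C => [|m IH] C [Csym Cpos].
  exists (\d_(0 : borel 'cV[R]_0)) => t b.
  have -> : (fun x : 'cV[R]_0 => cos (dotp t x + b)) = fun=> cos b.
    by apply/funext => x; rewrite dotpE big_ord0 add0r.
  by rewrite mean_cst /quad mxE big_ord0 mul0r oppr0 expR0 mulr1.
pose C' : 'M[R]_(1 + m) := C.
pose a := C' 0 0; pose b := dlsubmx C'; pose D := drsubmx C'.
have CE : C' = block_mx a%:M b^T b D.
  rewrite -[LHS]submxK; congr block_mx.
    by rewrite [LHS]mx11_scalar; congr (_%:M); rewrite /a !mxE; congr (C' _ _); apply/val_inj.
  by rewrite /b trmx_dlsub [in RHS]Csym.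
have qE (s : R) (t : 'cV[R]_m) : quad C (col_mx (s%:M : 'M[R]_1) t : 'cV[R]_m.+1) = a * s ^+ 2 + 2 * s * dotp b t + quad D t.
  by rewrite -quad_block -CE.
have a0 : 0 <= a.
  have := Cpos (col_mx (1%:M : 'M[R]_1) (0 : 'cV[R]_m) : 'cV[R]_m.+1); rewrite qE expr1n mulr1 dotpC dotp0 mulr0 addr0.
  by rewrite /quad mulmx0 mxE addr0.
have ab0 t : a = 0 -> dotp b t = 0.
  move=> a00; apply/eqP; apply: contraT => bt0.
  (* the quadratic form is affine in the first coordinate: make it -1 *)
  have := Cpos (col_mx ((- (quad D t + 1) / (2 * dotp b t))%:M : 'M[R]_1) t : 'cV[R]_m.+1).
  rewrite qE a00 mul0r add0r.
  have -> : 2 * (- (quad D t + 1) / (2 * dotp b t)) * dotp b t + quad D t = -1 by field.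
  by rewrite ler0N1.
have Dpsd : psd (D - a^-1 *: (b *m b^T)).
  split.
    have DT : D^T = D by rewrite /D trmx_drsub Csym.
    by rewrite linearB /= linearZ /= trmx_mul trmxK DT.
  move=> t; rewrite quad_subrank1.
  have [a00|an0] := eqVneq a 0.
    rewrite (ab0 t a00) expr0n /= mulr0 subr0.
    by have := Cpos (col_mx (0%:M : 'M[R]_1) t : 'cV[R]_m.+1); rewrite qE expr0n /= !mulr0 mul0r !add0r.
  (* the first coordinate that minimizes the form for fixed t *)
  have := Cpos (col_mx ((- (dotp b t / a))%:M : 'M[R]_1) t : 'cV[R]_m.+1); rewrite qE.
  by have -> : a * (- (dotp b t / a)) ^+ 2 + 2 * - (dotp b t / a) * dotp b t + quad D t =
    quad D t - a^-1 * dotp b t ^+ 2 by field.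
have [mu' Hmu'] := IH _ Dpsd.
pose F (z : R * borel 'cV[R]_m) : 'cV[R]_(1 + m) :=
  col_mx ((Num.sqrt a * z.1)%:M : 'M[R]_1) ((z.2 : 'cV[R]_m) + (z.1 / Num.sqrt a) *: b).
have mF : measurable_fun setT (F : R * borel 'cV[R]_m -> borel 'cV[R]_(1 + m)).
  apply: measurable_cV => i; rewrite /F.
  case: (split_ordP i) => j ->.
    rewrite (_ : (fun _ => _) = (fun z : R * borel 'cV[R]_m => Num.sqrt a * z.1)).
      by apply: measurable_funM.
    by apply/funext => z; rewrite col_mxEu mxE (ord1 j) eqxx mulr1n.
  rewrite (_ : (fun _ => _) = (fun z : R * borel 'cV[R]_m => (z.2 : 'cV[R]_m) j 0 + z.1 / Num.sqrt a * b j 0)).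
    apply: measurable_funD.
      exact: (measurableT_comp (measurable_coord j) (@measurable_snd _ _ _ _)).
    by apply: measurable_funM => //; apply: measurable_funM.
  by apply/funext => z; rewrite col_mxEd mxE [X in _ + X]mxE.
have [N Ncos] := std_normal_cos.
exists (law (N \x mu')%E mF) => t c.
rewrite mean_law; last 2 first.
- exact: mcos.
- apply: (int1_cos (N \x mu')%E).
  apply: (measurableT_comp (measurable_funD (continuous_measurable_borel (@continuous_dotp _ _ t)) (measurable_cst c)) mF).
pose s : R := t 0 0; pose t2 : 'cV[R]_m := dsubmx (t : 'cV[R]_(1 + m)).
have tE : t = (col_mx (s%:M : 'M[R]_1) t2 : 'cV[R]_m.+1).
  have tE' : usubmx (t : 'cV[R]_(1 + m)) = s%:M.
    rewrite [LHS]mx11_scalar; congr (_%:M); rewrite /s !mxE; congr (t _ _); exact/val_inj.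
  by rewrite -tE' [RHS]vsubmxK.
pose al := s * Num.sqrt a + dotp b t2 / Num.sqrt a.
have dF z : dotp t (F z) = dotp t2 z.2 + al * z.1.
  rewrite tE (@dotp_col_mx m) dotpDr dotpZr (dotpC t2 b) /al; ring.
have -> : (fun x => cos (dotp t x + c)) \o F = (fun z => cos (dotp t2 z.2 + (al * z.1 + c))).
  by apply/funext => z; rewrite /comp dF addrA.
have mal : measurable_fun setT (fun y : R => al * y + c).
  by apply: measurable_funD => //; apply: measurable_funM.
have icos : int1 (N \x mu')%E (fun z => cos (dotp t2 z.2 + (al * z.1 + c))).
  apply: (int1_cos (N \x mu')%E); apply: measurable_funD.
    exact: (measurableT_comp (continuous_measurable_borel (@continuous_dotp _ _ t2)) (@measurable_snd _ _ _ _)).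
  exact: (measurableT_comp mal (@measurable_fst _ _ _ _)).
rewrite {1}/mean /Rintegral -(integral12_prod_meas1 icos) /fubini_F.
transitivity (mean N (fun y => expR (- (quad (D - a^-1 *: (b *m b^T)) t2 / 2)) * cos (al * y + c))).
  rewrite /mean /Rintegral; congr fine; apply: eq_integral => y _.
  rewrite -[LHS]/(\int[mu']_x (cos (dotp t2 x + (al * y + c)))%:E)%E.
  rewrite EFin_mean; last exact: (int1_cos mu' (measurable_funD (continuous_measurable_borel (@continuous_dotp _ _ t2)) (measurable_cst _))).
  by rewrite Hmu' mulrC.
rewrite meanZ; last exact: (int1_cos N mal).
rewrite Ncos mulrCA -expRD; congr (_ * expR _).
rewrite [in RHS]tE qE quad_subrank1 /al.
have [a00|an0] := eqVneq a 0.
  by rewrite (ab0 t2 a00) a00 sqrtr0 invr0; field.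
have sa : Num.sqrt a ^+ 2 = a by rewrite sqr_sqrtr.
have san0 : Num.sqrt a != 0 by rewrite sqrtr_eq0 -ltNge lt_neqAle eq_sym an0.
move: sa san0; set r := Num.sqrt a => <- r0.
by field.
Qed.

End Gaussian.

(** * Taylor remainders with a quadratic bound *)

Section TrigonometricInequalities.
Context {R : realType}.
Implicit Types x y : R.

Lemma mean_value (f f' : R -> R) x y : (forall z : R, is_derive z 1 f (f' z)) ->
  exists2 c, `|c - x| <= `|y - x| & f y - f x = f' c * (y - x).
Proof.
move=> df; have cf : continuous f.
  by move=> z; apply/differentiable_continuous/derivable1_diffP; have [] := df z.
have [xy|yx|->] := ltgtP x y.
- have [c] := MVT xy (fun z _ => df z) (continuous_subspaceT cf).
  rewrite in_itv /= => /andP[xc cy] E; exists c => //.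
  by rewrite !gtr0_norm ?subr_gt0 //; lra.
- have [c] := MVT yx (fun z _ => df z) (continuous_subspaceT cf).
  rewrite in_itv /= => /andP[yc cx] E; exists c.
    by rewrite !ltr0_norm ?subr_lt0 //; lra.
  by rewrite -opprB E; ring.
- by exists y => //; rewrite !subrr mulr0.
Qed.

Lemma cos_lipschitz x y : `|cos x - cos y| <= `|x - y|.
Proof.
have [c _ ->] := mean_value y x (@is_derive_cos R).
by rewrite normrM normrN ler_piMl // sin_max.
Qed.

Lemma sin_le_norm x : `|sin x| <= `|x|.
Proof.
have [c _] := mean_value 0 x (@is_derive_sin R).
rewrite sin0 !subr0 => ->.
by rewrite normrM ler_piMl // cos_max.
Qed.

Lemma one_sub_cos_le x : `|1 - cos x| <= `|x| ^+ 2.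
Proof.
have [c] := mean_value 0 x (@is_derive_cos R).
rewrite cos0 !subr0 distrC => cx ->.
by rewrite normrM normrN expr2 ler_wpM2r // (le_trans (sin_le_norm c)).
Qed.

Lemma sub_sin_le x : `|x - sin x| <= `|x| ^+ 3.
Proof.
have d (z : R) : is_derive z 1 (fun z : R => z - sin z) (1 - cos z).
  by apply: is_derive_eq; rewrite /GRing.scale /=; ring.
have [c] := mean_value 0 x d.
rewrite sin0 !subr0 => cx ->.
rewrite normrM exprSr ler_wpM2r // (le_trans (one_sub_cos_le c)) //.
by rewrite lerXn2r ?nnegrE.
Qed.

(** The derivative is [z - sin z], bounded by the inequality before this one,
    which comes from [1 - cos z] in the same way. *)
Lemma cos_taylor2_le x : `|cos x - (1 - x ^+ 2 / 2)| <= `|x| ^+ 4.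
Proof.
have d (z : R) : is_derive z 1 (fun z : R => cos z - (1 - z ^+ 2 / 2)) (z - sin z).
  by apply: is_derive_eq; rewrite /GRing.scale /=; field.
have [c] := mean_value 0 x d.
rewrite cos0 expr0n /= mul0r !subr0 subrr subr0 => cx ->.
rewrite normrM exprSr ler_wpM2r // (le_trans (sub_sin_le c)) //.
by rewrite lerXn2r ?nnegrE.
Qed.

(** The bound is quadratic for large [x] and cubic for small [x]: its mean at
    [X / sqrt n] is finite and [o(1 / n)] as soon as [X] is square-integrable. *)
Definition lindeberg_rem x : R := x ^+ 2 * Num.min 1 `|x|.

Lemma lindeberg_rem_ge0 x : 0 <= lindeberg_rem x.
Proof. by rewrite mulr_ge0 ?sqr_ge0 // le_min ler01 normr_ge0. Qed.

Lemma sin_rem x : `|sin x - x| <= 3 * lindeberg_rem x.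
Proof.
rewrite /lindeberg_rem -(real_normK (num_real x)); set y := `|x|.
have y0 : 0 <= y by exact: normr_ge0.
have [y1|y1] := leP y 1.
  rewrite distrC; apply: le_trans (sub_sin_le x) _; rewrite -/y -exprSr.
  have : 0 <= y ^+ 3 by exact: exprn_ge0.
  lra.
rewrite mulr1; apply: le_trans (ler_normB _ _) _.
have := sin_le_norm x; rewrite -/y => h.
have : y <= y ^+ 2 by rewrite expr2 ler_peMl // ltW.
lra.
Qed.

Lemma cos_rem x : `|cos x - (1 - x ^+ 2 / 2)| <= 3 * lindeberg_rem x.
Proof.
rewrite /lindeberg_rem; have := cos_taylor2_le x.
rewrite -!(real_normK (num_real x)); set y := `|x| => h.
have y0 : 0 <= y by exact: normr_ge0.
have [y1|y1] := leP y 1.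
  apply: le_trans h _; rewrite -exprSr.
  have h3 : 0 <= y ^+ 3 by exact: exprn_ge0.
  by apply: (@le_trans _ _ (y ^+ 3)); [rewrite exprSr ler_piMr|lra].
rewrite mulr1; apply: le_trans (ler_normB _ _) _.
have := cos_max x.
have y2 : 1 <= y ^+ 2 by rewrite exprn_ege1 // ltW.
have : `|1 - y ^+ 2 / 2| <= 1 + y ^+ 2 / 2 by rewrite ler_norml; lra.
lra.
Qed.

Lemma cosD_rem A x :
  `|cos (A + x) - (cos A * (1 - x ^+ 2 / 2) - sin A * x)| <= 6 * lindeberg_rem x.
Proof.
rewrite cosD.
have -> : cos A * cos x - sin A * sin x - (cos A * (1 - x ^+ 2 / 2) - sin A * x) =
  cos A * (cos x - (1 - x ^+ 2 / 2)) - sin A * (sin x - x) by ring.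
apply: le_trans (ler_normB _ _) _; rewrite !normrM.
have h1 : `|cos A| * `|cos x - (1 - x ^+ 2 / 2)| <= 3 * lindeberg_rem x.
  by apply: le_trans (cos_rem x); rewrite ler_piMl // cos_max.
have h2 : `|sin A| * `|sin x - x| <= 3 * lindeberg_rem x.
  by apply: le_trans (sin_rem x); rewrite ler_piMl // sin_max.
lra.
Qed.

Lemma expRN_rem y : 0 <= y -> `|(1 - y) - expR (- y)| <= y ^+ 2.
Proof.
move=> y0; have h1 := expR_ge1Dx (- y).
have h2 : expR (- y) <= 1 - y + y ^+ 2.
  rewrite expRN -[leLHS]div1r ler_pdivrMr ?expR_gt0 //.
  have p : 0 <= 1 - y + y ^+ 2 by have := sqr_ge0 (y - 1); rewrite sqrrB; nra.
  apply: (@le_trans _ _ ((1 - y + y ^+ 2) * (1 + y))); last by rewrite ler_wpM2l // expR_ge1Dx.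
  have -> : (1 - y + y ^+ 2) * (1 + y) = 1 + y ^+ 3 by ring.
  by rewrite lerDl exprn_ge0.
by rewrite ler_norml; lra.
Qed.

End TrigonometricInequalities.

(** * A central limit theorem in reversed time *)

(** [U k] is a function of the innovations from index [k] on, and [V M k] a
    function of the [M] first ones among them that is close to [U k] uniformly in
    [k]. Since [U k.+1] and [zeta k] are independent, the products of
    [g (U k.+1)] and [zeta k] are martingale differences when time runs
    backwards. *)
Section ReverseMartingaleCLT.
Context {d0} {T : measurableType d0} {R : realType} (P : probability T R).
Variable zeta : nat -> {RV P >-> R}.
Hypothesis zeta_indep : mutually_independent zeta.
Hypothesis zeta_id : identically_distributed zeta.
Hypothesis zeta_int2 : int1 P (fun w => zeta 0%N w ^+ 2).
Hypothesis zeta_mean : mean P (zeta 0%N) = 0.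

Notation from k := (fun j : nat => (k <= j)%N).
Notation window k M := (fun j : nat => (k <= j < k + M)%N).

Context {d : nat}.
Variables (U : nat -> T -> 'cV[R]_d) (V : nat -> nat -> T -> 'cV[R]_d).
Hypothesis U_meas : forall k, measurable_fun setT (U k : sigT zeta (from k) -> borel 'cV[R]_d).
Hypothesis V_meas : forall M k, measurable_fun setT (V M k : sigT zeta (window k M) -> borel 'cV[R]_d).
Hypothesis U_law : forall k (A : set 'cV[R]_d), measurable (A : set (borel 'cV[R]_d)) ->
  P (U k @^-1` A) = P (U 0%N @^-1` A).
Hypothesis U_approx : forall (G : 'cV[R]_d -> R) (N : R), continuous G -> (forall x, `|G x| <= N) ->
  forall e : R, 0 < e -> exists M, forall k, mean P (fun w => `|G (U k w) - G (V M k w)|) <= e.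
Variable g : 'cV[R]_d -> R.
Hypothesis g_meas : measurable_fun setT (g : borel 'cV[R]_d -> R).
Hypothesis g_int2 : int1 P (fun w => g (U 0%N w) ^+ 2).

Let sigma2 := mean P (fun w => zeta 0%N w ^+ 2).
Let m2 := mean P (fun w => g (U 0%N w) ^+ 2).
Definition clt_variance := sigma2 * m2.
Let v := clt_variance.

Let zm k : measurable_fun setT (zeta k).
Proof. exact: measurable_funP. Qed.
Arguments zm : clear implicits.
Let Um k : measurable_fun setT (U k : T -> borel 'cV[R]_d) := sigT_meas (@U_meas k).
Let Vm M k : measurable_fun setT (V M k : T -> borel 'cV[R]_d) := sigT_meas (@V_meas M k).

Let zeta_same k (rho : R -> R) : measurable_fun setT rho -> int1 P (rho \o zeta 0%N) ->
  int1 P (rho \o zeta k) /\ mean P (rho \o zeta k) = mean P (rho \o zeta 0%N).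
Proof.
move=> mr ir; have Z A : measurable A -> P (zeta 0%N @^-1` A) = P (zeta k @^-1` A).
  by move=> mA; exact: esym (zeta_id k mA).
split; first exact: (same_law_int1 (zm 0) (zm k) mr Z ir).
exact: esym (same_law_mean (zm 0) (zm k) mr Z ir).
Qed.

Let U_same k (rho : 'cV[R]_d -> R) : measurable_fun setT (rho : borel 'cV[R]_d -> R) ->
  int1 P (rho \o U 0%N) ->
  int1 P (rho \o U k) /\ mean P (rho \o U k) = mean P (rho \o U 0%N).
Proof.
move=> mr ir; have Z (A : set (borel 'cV[R]_d)) : measurable A -> P (U 0%N @^-1` A) = P (U k @^-1` A).
  by move=> mA; rewrite [RHS](U_law k mA).
split; first exact: (same_law_int1 (Um 0) (Um k) mr Z ir).
exact: esym (same_law_mean (Um 0) (Um k) mr Z ir).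
Qed.

Let m2X : measurable_fun setT (fun x : R => x ^+ 2).
Proof. exact: measurable_funX. Qed.

Let int1_of_sq (f : T -> R) : measurable_fun setT f -> int1 P (fun w => f w ^+ 2) -> int1 P f.
Proof.
move=> mf if2; apply: (@int1_le _ _ _ _ _ (fun w => 1 + f w ^+ 2)) => //.
  by move=> w; have := sqr_ge0 (`|f w| - 1); rewrite sqrrB real_normK ?num_real //; have := normr_ge0 (f w); have := sqr_ge0 (f w); lra.
by apply: int1D => //; exact: int1_cst.
Qed.

Let int1_mul_sq (f h : T -> R) : measurable_fun setT f -> measurable_fun setT h ->
  int1 P (fun w => f w ^+ 2) -> int1 P (fun w => h w ^+ 2) -> int1 P (fun w => f w * h w).
Proof.
move=> mf mh if2 ih2; apply: (@int1_le _ _ _ _ _ (fun w => f w ^+ 2 + h w ^+ 2)).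
- exact: measurable_funM.
- move=> w; have := sqr_ge0 (`|f w| - `|h w|); rewrite sqrrB !real_normK ?num_real // normrM.
  have := sqr_ge0 (f w); have := sqr_ge0 (h w); lra.
- exact: int1D.
Qed.

Let zeta_sq k : int1 P (fun w => zeta k w ^+ 2) /\ mean P (fun w => zeta k w ^+ 2) = sigma2.
Proof. exact: (zeta_same k m2X zeta_int2). Qed.

Let zeta_1 k : int1 P (zeta k) /\ mean P (zeta k) = 0.
Proof.
have i0 : int1 P (id \o zeta 0%N) := int1_of_sq (zm 0) zeta_int2.
have [h1 h2] := zeta_same k (@measurable_id _ _ setT) i0.
by split; [exact: h1|rewrite -[LHS]/(mean P (id \o zeta k)) h2].
Qed.

Let g_sq k : int1 P (fun w => g (U k w) ^+ 2) /\ mean P (fun w => g (U k w) ^+ 2) = m2.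
Proof.
have mg2 : measurable_fun setT (fun x : borel 'cV[R]_d => g x ^+ 2).
  exact: (measurableT_comp m2X g_meas).
exact: (U_same k mg2 g_int2).
Qed.

(** [X] is a function of the innovations after [k], hence independent of
    [zeta k]. *)
Let future_mean k (X : T -> R) (rho : R -> R) :
  measurable_fun setT (X : sigT zeta (from k.+1) -> R) -> int1 P X ->
  measurable_fun setT rho -> int1 P (rho \o zeta k) ->
  int1 P (fun w => X w * rho (zeta k w)) /\
  mean P (fun w => X w * rho (zeta k w)) = mean P X * mean P (rho \o zeta k).
Proof.
move=> mX iX mr ir; apply: (indep_mean iX ir).
apply: (sigT_indep zeta_indep (D1 := from k.+1) (D2 := pred1 k)) => //.
  by move=> j; apply/negP => /andP[+ /eqP jk]; rewrite jk ltnn.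
apply: (measurableT_comp mr); apply: sigT_Z; exact: eqxx.
Qed.

Definition xi k w : R := g (U k.+1 w) * zeta k w.
Definition tail_sum k n w : R := \sum_(k <= j < n) xi j w.

Let gU_meas k : measurable_fun setT ((fun w => g (U k w)) : sigT zeta (from k) -> R).
Proof. exact: (measurableT_comp g_meas (@U_meas k)). Qed.

Arguments gU_meas : clear implicits.
Let xi_meas k j : (k <= j)%N -> measurable_fun setT (xi j : sigT zeta (from k) -> R).
Proof.
move=> kj; apply: measurable_funM.
  have sub : {subset from j.+1 <= from k}.
    by move=> i ji; exact: leq_trans kj (ltnW ji).
  exact: (sigT_sub sub (gU_meas j.+1)).
exact: sigT_Z.
Qed.

Arguments xi_meas : clear implicits.
Let tail_meas k l n : (k <= l)%N -> measurable_fun setT (tail_sum l n : sigT zeta (from k) -> R).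
Proof.
move=> kl.
have H (s : seq nat) : measurable_fun setT
    ((fun w => \sum_(j <- s | (l <= j)%N) xi j w) : sigT zeta (from k) -> R).
  elim: s => [|j s IH].
    have -> : (fun w => \sum_(j <- [::] | (l <= j)%N) xi j w) = (fun=> 0).
      by apply/funext => w; rewrite big_nil.
    exact: measurable_cst.
  have [lj|lj] := boolP (l <= j)%N.
    have -> : (fun w => \sum_(i <- j :: s | (l <= i)%N) xi i w) =
              (fun w => xi j w + \sum_(j <- s | (l <= j)%N) xi j w).
      by apply/funext => w; rewrite big_cons lj.
    by apply: measurable_funD => //; apply: (xi_meas k); exact: leq_trans lj.
  have -> : (fun w => \sum_(i <- j :: s | (l <= i)%N) xi i w) =
            (fun w => \sum_(j <- s | (l <= j)%N) xi j w).
    by apply/funext => w; rewrite big_cons (negPf lj).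
  exact: IH.
have -> : tail_sum l n = (fun w => \sum_(j <- index_iota l n | (l <= j)%N) xi j w).
  apply/funext => w; rewrite /tail_sum big_seq_cond [RHS]big_seq_cond; apply: eq_bigl => j.
  by rewrite mem_index_iota; case: (l <= j)%N.
exact: H.
Qed.

Arguments tail_meas : clear implicits.
Let tail_measT l n : measurable_fun setT (tail_sum l n) := sigT_meas (tail_meas l l n (leqnn l)).

Arguments tail_measT : clear implicits.
Lemma tail_sum_rec k n w : (k < n)%N -> tail_sum k n w = tail_sum k.+1 n w + xi k w.
Proof. by move=> kn; rewrite /tail_sum big_ltn // addrC. Qed.

Lemma tail_sum_geq k n w : (n <= k)%N -> tail_sum k n w = 0.
Proof. by move=> nk; rewrite /tail_sum big_geq. Qed.

Let xi_sq k : int1 P (fun w => xi k w ^+ 2) /\ mean P (fun w => xi k w ^+ 2) = v.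
Proof.
have [ig mg] := g_sq k.+1; have [iz mz] := zeta_sq k.
have mg2 : measurable_fun setT ((fun w => g (U k.+1 w) ^+ 2) : sigT zeta (from k.+1) -> R).
  exact: (measurableT_comp m2X (gU_meas k.+1)).
have [h1 h2] := future_mean mg2 ig m2X iz.
have -> : (fun w => xi k w ^+ 2) = (fun w => g (U k.+1 w) ^+ 2 * zeta k w ^+ 2).
  by apply/funext => w; rewrite exprMn.
split => //; rewrite h2 mg; rewrite -[X in _ * X]/(mean P (fun w => zeta k w ^+ 2)) mz.
by rewrite /v /clt_variance mulrC.
Qed.

Let xi_measT k : measurable_fun setT (xi k) := sigT_meas (xi_meas k k (leqnn k)).
Arguments xi_measT : clear implicits.
Let xi_int k : int1 P (xi k) := int1_of_sq (xi_measT k) (xi_sq k).1.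

Lemma clt_variance_ge0 : 0 <= v.
Proof. by have [_ <-] := xi_sq 0; apply: mean_ge0 => w; exact: sqr_ge0. Qed.

Let xi_abs k : mean P (fun w => `|xi k w|) <= 1 + v.
Proof.
have [i2 m2'] := xi_sq k.
rewrite -m2' -[X in X + _](mean_cst P) -meanD //; last exact: int1_cst.
apply: mean_le; [exact: int1_norm|by apply: int1D => //; exact: int1_cst|].
move=> w; have := sqr_ge0 (`|xi k w| - 1); rewrite sqrrB real_normK ?num_real //; have := normr_ge0 (xi k w); have := sqr_ge0 (xi k w); lra.
Qed.

(** The increment [xi k] is orthogonal to the tail sum from [k.+1] on, since
    [zeta k] is centred and independent of everything else in the product. *)
Lemma tail_sum_sq k n : int1 P (fun w => tail_sum k n w ^+ 2) /\
  mean P (fun w => tail_sum k n w ^+ 2) = (n - k)%:R * v.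
Proof.
have [nk|/ltnW kn] := leqP n k.
  have -> : (fun w => tail_sum k n w ^+ 2) = fun=> 0.
    by apply/funext => w; rewrite tail_sum_geq // expr0n.
  split; first exact: int1_cst.
  by rewrite mean_cst (eqP nk) mul0r.
rewrite -(subKn kn); move: (n - k)%N (leq_subr k n) => l ln {k kn}.
elim: l ln => [|l IH] ln.
  rewrite subn0 subnn mul0r; split.
    have -> : (fun w => tail_sum n n w ^+ 2) = fun=> 0.
      by apply/funext => w; rewrite tail_sum_geq // expr0n.
    exact: int1_cst.
  have -> : (fun w => tail_sum n n w ^+ 2) = fun=> 0.
    by apply/funext => w; rewrite tail_sum_geq // expr0n.
  exact: mean_cst.
have [i1 e1] := IH (ltnW ln); set k := (n - l.+1)%N.
have k1 : (n - l)%N = k.+1 by rewrite /k subnSK.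
rewrite k1 in i1 e1.
have kn : (k < n)%N by rewrite /k ltn_subrL /= (leq_trans _ ln).
have [ig mg] := g_sq k.+1; have [iz mz] := zeta_1 k.
have [ix mx] := xi_sq k.
have mS := tail_meas k.+1 k.+1 n (leqnn k.+1).
have iSg := int1_mul_sq (tail_measT k.+1 n) (sigT_meas (gU_meas k.+1)) i1 ig.
have [i3 e3] := future_mean (measurable_funM mS (gU_meas k.+1)) iSg (@measurable_id _ _ setT) iz.
have -> : (fun w => tail_sum k n w ^+ 2) = (fun w => tail_sum k.+1 n w ^+ 2 +
   (2 * (tail_sum k.+1 n w * g (U k.+1 w) * zeta k w) + xi k w ^+ 2)).
  by apply/funext => w; rewrite (tail_sum_rec _ kn) /xi; ring.
have i4 := int1Z 2 i3.
split; first by apply: int1D => //; exact: int1D.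
rewrite meanD //; last exact: int1D.
rewrite meanD // meanZ // [X in 2 * X]e3 [mean P (id \o zeta k)]mz mulr0 mulr0 add0r e1 mx.
rewrite (_ : (n - (n - l.+1))%N = l.+1); last by rewrite subKn.
by rewrite -k1 subKn ?(ltnW ln) // -natr1 mulrDl mul1r.
Qed.

(** Dropping [M] terms costs a bound in L1 that is free of [n], which becomes
    negligible after division by [sqrt n]. *)
Let tail_gap k M n :
  int1 P (fun w => `|tail_sum k n w - tail_sum (k + M) n w|) /\
  mean P (fun w => `|tail_sum k n w - tail_sum (k + M) n w|) <= M%:R * (1 + v).
Proof.
have iS j : int1 P (tail_sum j n).
  by apply: int1_of_sq; [exact: tail_measT|exact: (tail_sum_sq j n).1].
have iG j l : int1 P (fun w => `|tail_sum j n w - tail_sum l n w|).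
  by apply: int1_norm; exact: int1B.
split; first exact: iG.
elim: M => [|M IH].
  have -> : (fun w => `|tail_sum k n w - tail_sum (k + 0) n w|) = fun=> 0.
    by apply/funext => w; rewrite addn0 subrr normr0.
  by rewrite mean_cst mul0r.
rewrite -natr1 mulrDl mul1r; apply: le_trans (lerD IH (xi_abs (k + M)%N)).
rewrite -meanD //; last exact: int1_norm.
apply: mean_le => //.
  by apply: int1D => //; exact: int1_norm.
move=> w; apply: le_trans (ler_distD (tail_sum (k + M) n w) _ _) _.
rewrite lerD2l addnS; have [kn|nk] := ltnP (k + M) n.
  by rewrite (tail_sum_rec _ kn) addrAC subrr add0r.
by rewrite !tail_sum_geq ?subrr ?normr0 //; exact: leqW.
Qed.

Definition cos_tail (a c : R) k n w := cos (a * tail_sum k n w + c).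

Let cos_tail_meas a c k n : measurable_fun setT (cos_tail a c k n : sigT zeta (from k) -> R).
Proof.
apply: (measurableT_comp (continuous_measurable_fun (@continuous_cos R))).
apply: measurable_funD => //; apply: measurable_funM => //.
exact: (tail_meas k k n (leqnn k)).
Qed.
Arguments cos_tail_meas : clear implicits.

Let cos_tail_le1 a c k n w : `|cos_tail a c k n w| <= 1.
Proof. exact: cos_max. Qed.

Let cos_tail_int a c k n : int1 P (cos_tail a c k n).
Proof.
apply: (@int1_bdd _ _ _ _ _ 1); last exact: cos_tail_le1.
exact: (sigT_meas (cos_tail_meas a c k n)).
Qed.

Lemma invsqrt_small (K e : R) : 0 <= K -> 0 < e ->
  exists n0, forall n, (n0 <= n)%N -> (Num.sqrt n%:R)^-1 * K <= e.
Proof.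
move=> K0 e0; exists (Num.bound ((K / e) ^+ 2)).+1 => n hn.
have Ke0 : 0 <= K / e by rewrite divr_ge0 // ltW.
have nb : (K / e) ^+ 2 <= n%:R.
  apply: (@le_trans _ _ (Num.bound ((K / e) ^+ 2))%:R); last by rewrite ler_nat ltnW.
  by apply/ltW/archi_boundP; exact: sqr_ge0.
have n0 : 0 < n%:R :> R by rewrite ltr0n (leq_trans _ hn).
have s0 : 0 < Num.sqrt n%:R :> R by rewrite sqrtr_gt0.
rewrite mulrC ler_pdivrMr // -ler_pdivrMl // mulrC.
by rewrite -(ger0_norm Ke0) -sqrtr_sqr ler_sqrt // ltW.
Qed.

(** Mixing: [g (U k) ^+ 2] is L1-close to [G (U k)] with [G] bounded and
    continuous, hence to [G (V M k)], a function of the window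
    [zeta k, ..., zeta (k + M - 1)]; after division by [sqrt n] the tail sum hardly
    changes when its first [M] terms are dropped, and what is left is independent
    of the window. *)
Lemma cos_tail_decoupling (e : R) : 0 < e -> exists n0, forall n, (n0 <= n)%N ->
  forall c k, `|mean P (fun w => cos_tail (Num.sqrt n%:R)^-1 c k n w * g (U k w) ^+ 2) -
      mean P (cos_tail (Num.sqrt n%:R)^-1 c k n) * m2| <= e.
Proof.
move=> e0; have e8 : 0 < e / 8 by rewrite divr_gt0.
have mg2 : measurable_fun setT (fun x : borel 'cV[R]_d => g x ^+ 2).
  exact: (measurableT_comp m2X g_meas).
have inu : int1 (law P (Um 0)) (fun x : borel 'cV[R]_d => g x ^+ 2).
  exact: int1_law.
have [G [N [cG GN Gd]]] := L1_density inu e8.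
have mG := continuous_measurable_borel cG.
have N0 : 0 <= N := le_trans (normr_ge0 _) (GN 0).
have mdiff : measurable_fun setT (fun x : borel 'cV[R]_d => `|g x ^+ 2 - G x|).
  by apply: measurableT_comp => //; exact: measurable_funB.
have iGU k : int1 P (fun w => G (U k w)).
  apply: (@int1_bdd _ _ _ _ _ N) => [|w]; last exact: GN.
  exact: (measurableT_comp mG (Um k)).
have iGV M k : int1 P (fun w => G (V M k w)).
  apply: (@int1_bdd _ _ _ _ _ N) => [|w]; last exact: GN.
  exact: (measurableT_comp mG (Vm M k)).
have dGU k : int1 P (fun w => `|g (U k w) ^+ 2 - G (U k w)|) /\
    mean P (fun w => `|g (U k w) ^+ 2 - G (U k w)|) <= e / 8.
  have [ig _] := g_sq 0.
  have i0 : int1 P ((fun x : borel 'cV[R]_d => `|g x ^+ 2 - G x|) \o U 0%N).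
    by apply: int1_norm; apply: int1B.
  have [h1 h2] := U_same k mdiff i0; split; first exact: h1.
  rewrite [leLHS]h2; apply: le_trans Gd.
  by rewrite (mean_law (Um 0) mdiff i0).
have [M HM] := U_approx cG GN e8.
have K0 : 0 <= M%:R * (1 + v) * (2 * N).
  by rewrite !mulr_ge0 // addr_ge0 // clt_variance_ge0.
have [n0 Hn0] := invsqrt_small K0 (divr_gt0 e0 (ltr0n R 2)).
exists n0 => n nn c k; set a := (Num.sqrt n%:R)^-1.
have a0 : 0 <= a by rewrite invr_ge0 sqrtr_ge0.
have {}Hn0 : a * (M%:R * (1 + v) * (2 * N)) <= e / 2 := Hn0 n nn.
pose C := cos_tail a c k n; pose C' := cos_tail a c (k + M) n.
have iC : int1 P C := cos_tail_int a c k n.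
have iC' : int1 P C' := cos_tail_int a c (k + M) n.
have mC := int1_meas iC; have mC' := int1_meas iC'.
have C1 w : `|C w| <= 1 by exact: cos_tail_le1.
have C'1 w : `|C' w| <= 1 by exact: cos_tail_le1.
have [ig mg] := g_sq k.
have [idg dg] := dGU k.
pose H w := G (V M k w).
have iH : int1 P H := iGV M k.
have HN w : `|H w| <= N by exact: GN.
have i1 : int1 P (fun w => g (U k w) ^+ 2 - G (U k w)) by exact: int1B.
have i2 : int1 P (fun w => G (U k w) - H w) by exact: int1B.
have j1 := int1_mul_bdd mC C1 i1.
have j2 := int1_mul_bdd mC C1 i2.
have iCC : int1 P (fun w => C w - C' w) by exact: int1B.
have j3 : int1 P (fun w => H w * (C w - C' w)) := int1_mul_bdd (int1_meas iH) HN iCC.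
have [j4 e4] : int1 P (fun w => C' w * H w) /\ mean P (fun w => C' w * H w) = mean P C' * mean P H.
  apply: indep_mean => //.
  apply: (sigT_indep zeta_indep (D1 := from (k + M)%N) (D2 := window k M)).
  - by move=> j; apply/negP => /andP[h1 /andP[_ h2]]; rewrite ltnNge h1 in h2.
  - exact: cos_tail_meas.
  - exact: (measurableT_comp mG (@V_meas M k)).
have CC : `|mean P C - mean P C'| <= a * (M%:R * (1 + v)).
  rewrite -meanB //; have [ig1 gap] := tail_gap k M n.
  apply: le_trans (_ : mean P (fun w => a * `|tail_sum k n w - tail_sum (k + M) n w|) <= _).
    apply: mean_norm_le; [exact: int1_meas iCC|exact: int1Z|move=> w].
    apply: le_trans (cos_lipschitz _ _) _.
    by rewrite opprD addrACA subrr addr0 -mulrBr normrM (ger0_norm a0).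
  by rewrite meanZ // ler_wpM2l.
have b1 : `|mean P (fun w => C w * (g (U k w) ^+ 2 - G (U k w)))| <= e / 8.
  apply: le_trans dg; apply: mean_norm_le => //; first exact: int1_meas j1.
  by move=> w; rewrite normrM ler_piMl.
have b2 : `|mean P (fun w => C w * (G (U k w) - H w))| <= e / 8.
  apply: le_trans (HM k); apply: mean_norm_le => //; first exact: int1_meas j2.
    exact: int1_norm.
  by move=> w; rewrite normrM ler_piMl.
have b3 : `|mean P (fun w => H w * (C w - C' w))| <= N * (a * (M%:R * (1 + v))).
  have [ig1 gap] := tail_gap k M n.
  apply: le_trans (_ : mean P (fun w => (N * a) * `|tail_sum k n w - tail_sum (k + M) n w|) <= _).
    apply: mean_norm_le; [exact: int1_meas j3|exact: int1Z|move=> w].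
    rewrite normrM -mulrA ler_pM //; apply: le_trans (cos_lipschitz _ _) _.
    by rewrite opprD addrACA subrr addr0 -mulrBr normrM (ger0_norm a0).
  by rewrite meanZ // -mulrA ler_wpM2l // ler_wpM2l.
have b4 : `|mean P H| <= N by apply: mean_norm_le_cst => //; exact: int1_meas iH.
have b5 : `|mean P H - m2| <= e / 4.
  rewrite -mg distrC.
  have -> : mean P (fun w => g (U k w) ^+ 2) - mean P H =
    mean P (fun w => g (U k w) ^+ 2 - G (U k w)) + mean P (fun w => G (U k w) - H w).
    by rewrite !meanB //; ring.
  apply: le_trans (ler_normD _ _) _.
  have h1 := le_trans (mean_norm i1) dg.
  have h2 := le_trans (mean_norm i2) (HM k).
  lra.
have E : mean P (fun w => C w * g (U k w) ^+ 2) - mean P C * m2 =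
  mean P (fun w => C w * (g (U k w) ^+ 2 - G (U k w))) +
  mean P (fun w => C w * (G (U k w) - H w)) +
  mean P (fun w => H w * (C w - C' w)) +
  (mean P C' - mean P C) * mean P H + mean P C * (mean P H - m2).
  have -> : (fun w => C w * g (U k w) ^+ 2) = (fun w => C w * (g (U k w) ^+ 2 - G (U k w)) +
     (C w * (G (U k w) - H w) + (H w * (C w - C' w) + C' w * H w))).
    by apply/funext => w; ring.
  rewrite meanD //; last by apply: int1D => //; exact: int1D.
  rewrite meanD //; last exact: int1D.
  rewrite meanD // e4; ring.
have b6 : `|mean P C| <= 1 by exact: mean_norm_le_cst.
have b7 : `|(mean P C' - mean P C) * mean P H| <= a * (M%:R * (1 + v)) * N.
  by rewrite normrM distrC ler_pM.
have b8 : `|mean P C * (mean P H - m2)| <= e / 4.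
  by rewrite normrM; apply: le_trans b5; rewrite ler_piMl.
(* the five errors: g^2 by G, U by V, tail from k by tail from k + M in the
   product and in the mean, mean of G (V M k) by m2 *)
rewrite [X in `|X|]E.
move: b1 b2 b3 b7 b8 Hn0.
set x1 := mean P (fun w => C w * _); set x2 := mean P (fun w => C w * _); set x3 := mean P (fun w => H w * _).
set x4 := _ * mean P H; set x5 := mean P C * _.
set y := a * (M%:R * (1 + v)).
have -> : a * (M%:R * (1 + v) * (2 * N)) = 2 * (y * N) by rewrite /y; ring.
rewrite (mulrC N y) => b1 b2 b3 b7 b8 Hn.
move: b1 b2 b3 b7 b8; rewrite !ler_norml; lra.
Qed.

Let xi_rem_int (a : R) k : int1 P (fun w => lindeberg_rem (a * xi k w)).
Proof.
have mrem : measurable_fun setT (@lindeberg_rem R).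
  apply: measurable_funM; first exact: m2X.
  by apply: measurable_minr => //; exact: normr_measurable.
apply: (@int1_le _ _ _ _ _ (fun w => a ^+ 2 * xi k w ^+ 2)).
- apply: (measurableT_comp mrem); apply: measurable_funM => //; exact: xi_measT.
- move=> w; rewrite ger0_norm ?lindeberg_rem_ge0 // /lindeberg_rem exprMn.
  have m1 : Num.min 1 `|a * xi k w| <= 1 by rewrite ge_min lexx.
  by apply: ler_piMr m1; rewrite mulr_ge0 ?sqr_ge0.
- by apply: int1Z; exact: (xi_sq k).1.
Qed.

(** [U k.+1] and [zeta k] are independent with laws that do not depend on [k]. *)
Let xi_rem_same (a : R) k :
  mean P (fun w => lindeberg_rem (a * xi k w)) = mean P (fun w => lindeberg_rem (a * xi 0 w)).
Proof.
pose f (z : borel 'cV[R]_d * R) : R := lindeberg_rem (a * (g z.1 * z.2)).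
have mrem : measurable_fun setT (@lindeberg_rem R).
  apply: measurable_funM; first exact: m2X.
  by apply: measurable_minr => //; exact: normr_measurable.
have mf : measurable_fun setT f.
  apply: (measurableT_comp mrem); apply: measurable_funM => //; apply: measurable_funM => //.
  exact: (measurableT_comp g_meas (@measurable_fst _ _ _ _)).
have ind j : indep P (U j.+1 : T -> borel 'cV[R]_d) (zeta j).
  apply: (sigT_indep zeta_indep (D1 := from j.+1) (D2 := pred1 j)).
  - by move=> i; apply/negP => /andP[+ /eqP ij]; rewrite ij ltnn.
  - exact: U_meas.
  - by apply: sigT_Z; exact: eqxx.
have mp j : measurable_fun setT (fun w => ((U j.+1 w : borel 'cV[R]_d), zeta j w)).
  by apply: measurable_fun_pair; [exact: (Um j.+1)|exact: zm].
have L := indep_same_law (Um k.+1) (zm k) (Um 1%N) (zm 0%N) (ind k) (ind 0%N)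
  (fun A mA => etrans (U_law k.+1 mA) (esym (U_law 1%N mA)))
  (fun A mA => zeta_id k mA).
exact: (same_law_mean (mp k) (mp 0%N) mf L (xi_rem_int a k)).
Qed.

(** After multiplication by [n] the remainder is dominated by [xi 0 ^+ 2] and
    tends to [0] pointwise. *)
Let xi_rem_small (e : R) : 0 < e -> exists n0, forall n, (n0 <= n)%N ->
  mean P (fun w => lindeberg_rem ((Num.sqrt n%:R)^-1 * xi 0 w)) <= e * (Num.sqrt n%:R)^-1 ^+ 2.
Proof.
move=> e0.
pose f n w := xi 0 w ^+ 2 * Num.min 1 `|(Num.sqrt n%:R)^-1 * xi 0 w|.
have mf n : measurable_fun setT (f n).
  apply: measurable_funM; first exact: (measurableT_comp m2X (xi_measT 0%N)).
  apply: measurable_minr => //; apply: measurableT_comp => //.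
  by apply: measurable_funM => //; exact: xi_measT.
have fle n w : `|f n w| <= xi 0 w ^+ 2.
  have m0 : 0 <= Num.min 1 `|(Num.sqrt n%:R)^-1 * xi 0 w| by rewrite le_min ler01 normr_ge0.
  have m1 : Num.min 1 `|(Num.sqrt n%:R)^-1 * xi 0 w| <= 1 by rewrite ge_min lexx.
  rewrite /f ger0_norm; last by rewrite mulr_ge0 ?sqr_ge0.
  by apply: ler_piMr m1; exact: sqr_ge0.
have h : mean P (f n) @[n --> \oo] --> mean P (fun=> 0).
  apply: (@mean_dct _ _ _ P f (fun=> 0) (fun w => xi 0 w ^+ 2)) => //.
  - apply: aeW => w; apply: cvg_le_eps => e' e'0.
    have K0 : 0 <= xi 0 w ^+ 2 * `|xi 0 w| by rewrite mulr_ge0 // sqr_ge0.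
    have [n0 Hn0] := invsqrt_small K0 e'0.
    exists n0 => n nn; rewrite subr0 ger0_norm; last first.
      by rewrite mulr_ge0 ?sqr_ge0 // le_min ler01 normr_ge0.
    apply: le_trans (Hn0 n nn); rewrite mulrCA ler_wpM2l ?sqr_ge0 //.
    have -> : `|(Num.sqrt n%:R)^-1 * xi 0 w| = (Num.sqrt n%:R)^-1 * `|xi 0 w|.
      by rewrite normrM ger0_norm // invr_ge0 sqrtr_ge0.
    by rewrite ge_min lexx orbT.
  - exact: (xi_sq 0%N).1.
rewrite mean_cst in h; have [n0 Hn0] := cvg_eps h e0.
exists n0 => n nn; have := Hn0 n nn; rewrite subr0 => {}Hn0.
have -> : (fun w => lindeberg_rem ((Num.sqrt n%:R)^-1 * xi 0 w)) =
  (fun w => (Num.sqrt n%:R)^-1 ^+ 2 * f n w).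
  by apply/funext => w; rewrite /lindeberg_rem exprMn -mulrA.
rewrite meanZ; last exact: (int1_le (mf n) (fle n) (xi_sq 0%N).1).
by rewrite mulrC ler_wpM2r ?sqr_ge0 // (le_trans (ler_norm _)).
Qed.

Let sin_tail_meas a c k n : measurable_fun setT
  ((fun w => sin (a * tail_sum k n w + c)) : sigT zeta (from k) -> R).
Proof.
apply: (measurableT_comp (continuous_measurable_fun (@continuous_sin R))).
apply: measurable_funD => //; apply: measurable_funM => //.
exact: (tail_meas k k n (leqnn k)).
Qed.
Arguments sin_tail_meas : clear implicits.

(** One step of the recursion, by a Taylor expansion in [xi k] around the tail
    sum from [k.+1] on. The term of first order has mean zero, and in the term of
    second order independence from the future replaces [zeta k ^+ 2] by its
    mean. *)
Lemma cos_tail_step (a c : R) k n : (k < n)%N ->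
  `|mean P (cos_tail a c k n) - (mean P (cos_tail a c k.+1 n) -
      a ^+ 2 / 2 * (mean P (fun w => cos_tail a c k.+1 n w * g (U k.+1 w) ^+ 2) * sigma2))|
  <= 6 * mean P (fun w => lindeberg_rem (a * xi 0 w)).
Proof.
move=> kn; rewrite -(xi_rem_same a k).
have [ig _] := g_sq k.+1; have [iz mz] := zeta_1 k; have [iz2 mz2] := zeta_sq k.
pose C := cos_tail a c k.+1 n; pose S w := sin (a * tail_sum k.+1 n w + c).
have iC : int1 P C := cos_tail_int a c k.+1 n.
have S1 w : `|S w| <= 1 by exact: sin_max.
have C1 w : `|C w| <= 1 by exact: cos_max.
have mS := sin_tail_meas a c k.+1 n; have mC := cos_tail_meas a c k.+1 n.
have igU : int1 P (fun w => g (U k.+1 w)) by apply: int1_of_sq => //; exact: (sigT_meas (gU_meas k.+1)).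
have iSg := int1_mul_bdd (sigT_meas mS) S1 igU.
have iCg := int1_mul_bdd (sigT_meas mC) C1 ig.
have [i1 e1] := future_mean (measurable_funM mS (gU_meas k.+1)) iSg (@measurable_id _ _ setT) iz.
have mg2 : measurable_fun setT ((fun w => g (U k.+1 w) ^+ 2) : sigT zeta (from k.+1) -> R).
  exact: (measurableT_comp m2X (gU_meas k.+1)).
have [i2 e2] := future_mean (measurable_funM mC mg2) iCg m2X iz2.
have {}e1 : mean P (fun w => S w * g (U k.+1 w) * zeta k w) = 0.
  by rewrite [LHS]e1 [mean P (id \o zeta k)]mz mulr0.
have {}e2 : mean P (fun w => C w * g (U k.+1 w) ^+ 2 * zeta k w ^+ 2) =
  mean P (fun w => C w * g (U k.+1 w) ^+ 2) * sigma2.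
  by rewrite [LHS]e2 [X in _ * X]mz2.
rewrite -e2.
have -> : mean P C - a ^+ 2 / 2 * mean P (fun w => C w * g (U k.+1 w) ^+ 2 * zeta k w ^+ 2) =
  mean P (fun w => C w * (1 - (a * xi k w) ^+ 2 / 2) - S w * (a * xi k w)).
  have -> : (fun w => C w * (1 - (a * xi k w) ^+ 2 / 2) - S w * (a * xi k w)) =
    (fun w => (C w - a ^+ 2 / 2 * (C w * g (U k.+1 w) ^+ 2 * zeta k w ^+ 2)) -
       a * (S w * g (U k.+1 w) * zeta k w)).
    by apply/funext => w; rewrite /xi; field.
  rewrite meanB; [|by apply: int1B => //; exact: int1Z|exact: int1Z].
  rewrite meanB //; last exact: int1Z.
  by rewrite !meanZ // e1 mulr0 subr0.
have E w : cos_tail a c k n w = cos ((a * tail_sum k.+1 n w + c) + a * xi k w).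
  by rewrite /cos_tail (tail_sum_rec _ kn); congr cos; ring.
have mD : measurable_fun setT (fun w => C w * (1 - (a * xi k w) ^+ 2 / 2) - S w * (a * xi k w)).
  have mx : measurable_fun setT (fun w => a * xi k w) by apply: measurable_funM => //; exact: xi_measT.
  apply: measurable_funB; apply: measurable_funM => //; try exact: (sigT_meas mC); try exact: (sigT_meas mS).
  apply: measurable_funB => //; apply: measurable_funM => //; exact: (measurableT_comp m2X mx).
have bD w : `|cos_tail a c k n w - (C w * (1 - (a * xi k w) ^+ 2 / 2) - S w * (a * xi k w))|
  <= 6 * lindeberg_rem (a * xi k w) by rewrite E; exact: cosD_rem.
have mCk := sigT_meas (cos_tail_meas a c k n).
have irem := int1Z 6 (xi_rem_int a k).
have idiff := int1_le (measurable_funB mCk mD) bD irem.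
have iD : int1 P (fun w => C w * (1 - (a * xi k w) ^+ 2 / 2) - S w * (a * xi k w)).
  have := int1B (cos_tail_int a c k n) idiff.
  by congr (P.-integrable _ _); apply/funext => w /=; congr (_%:E); ring.
have iCk := cos_tail_int a c k n.
rewrite -meanB // -meanZ; last exact: xi_rem_int.
by apply: mean_norm_le => //; exact: measurable_funB.
Qed.

(** Up to errors that sum to [o(1)] over the [n] steps, the cosine mean of the
    tail sum from [k] on is [expR (- v / (2 * n))] times that of the tail sum from
    [k.+1] on, and the empty tail sum gives [cos c]. *)
Theorem reverse_martingale_clt (c : R) :
  mean P (fun w => cos ((Num.sqrt n%:R)^-1 * tail_sum 0 n w + c)) @[n --> \oo] -->
  cos c * expR (- (clt_variance / 2)).
Proof.
have v0 : 0 <= v := clt_variance_ge0.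
have s0 : 0 <= sigma2 by apply: mean_ge0 => w; exact: sqr_ge0.
apply: cvg_le_eps => e e0.
have e24 : 0 < e / 24 by rewrite divr_gt0.
have s1 : 0 < sigma2 + 1 by rewrite ltr_wpDl.
have es : 0 < e / (sigma2 + 1) by rewrite divr_gt0.
have [n1 H1] := xi_rem_small e24.
have [n2 H2] := cos_tail_decoupling es.
have [n3 H3] := @invsqrt_small (v ^+ 2 / 4) (e / 4) (divr_ge0 (sqr_ge0 v) (ler0n _ 4)) (divr_gt0 e0 (ltr0n _ 4)).
exists (maxn 1 (maxn n1 (maxn n2 n3))) => n; rewrite !geq_max => /and4P[n_gt0 nn1 nn2 nn3].
have {}H1 := H1 n nn1; have {}H2 := H2 n nn2 c; have {}H3 := H3 n nn3.
have nR : 0 < n%:R :> R by rewrite ltr0n.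
set a := (Num.sqrt n%:R)^-1 in H1 H2 H3 *.
have a0 : 0 <= a by rewrite invr_ge0 sqrtr_ge0.
have a2 : a ^+ 2 = n%:R^-1 by rewrite exprVn sqr_sqrtr // ltW.
pose y := a ^+ 2 / 2 * v.
have y0 : 0 <= y by rewrite mulr_ge0 // divr_ge0 // sqr_ge0.
pose phi k := mean P (cos_tail a c k n).
pose eta := 6 * (e / 24 * a ^+ 2) + a ^+ 2 / 2 * e + y ^+ 2.
have phi1 k : `|phi k| <= 1.
  by apply: mean_norm_le_cst; [exact: int1_meas (cos_tail_int a c k n)|exact: cos_tail_le1].
have step k : (k < n)%N -> `|phi k - expR (- y) * phi k.+1| <= eta.
  move=> kn; have h1 := cos_tail_step a c kn.
  have h1' := le_trans h1 (ler_wpM2l (ler0n _ 6) H1).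
  pose m := mean P (fun w => cos_tail a c k.+1 n w * g (U k.+1 w) ^+ 2).
  have -> : phi k - expR (- y) * phi k.+1 =
    (phi k - (phi k.+1 - a ^+ 2 / 2 * (m * sigma2))) -
    a ^+ 2 / 2 * sigma2 * (m - phi k.+1 * m2) + ((1 - y) - expR (- y)) * phi k.+1.
    by rewrite /y /v /clt_variance; ring.
  apply: le_trans (ler_normD _ _) _; apply: lerD; last first.
    rewrite normrM; apply: le_trans (_ : y ^+ 2 * 1 <= _); last by rewrite mulr1.
    by apply: ler_pM => //; exact: expRN_rem.
  apply: le_trans (ler_normB _ _) _; apply: lerD => //.
  have a2h : 0 <= a ^+ 2 / 2 by rewrite divr_ge0 // sqr_ge0.
  rewrite -mulrA normrM (ger0_norm a2h) ler_wpM2l // normrM (ger0_norm s0).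
  apply: (@le_trans _ _ (sigma2 * (e / (sigma2 + 1)))); first by apply: ler_wpM2l => //; exact: (H2 k.+1).
  rewrite mulrA ler_pdivrMr // mulrC ler_wpM2l ?ltW //; lra.
have tele l : (l <= n)%N -> `|phi (n - l)%N - expR (- (y * l%:R)) * cos c| <= l%:R * eta.
  elim: l => [|l IH] ln.
    rewrite subn0 mulr0 oppr0 expR0 mul1r mul0r.
    have -> : phi n = cos c; last by rewrite subrr normr0.
    rewrite /phi (_ : cos_tail a c n n = fun=> cos c) ?mean_cst //.
    by apply/funext => w; rewrite /cos_tail tail_sum_geq // mulr0 add0r.
  have {}IH := IH (ltnW ln).
  have kn : (n - l.+1 < n)%N by rewrite ltn_subrL /= (leq_trans _ ln).
  have := step _ kn; rewrite subnSK // => h.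
  have -> : phi (n - l.+1)%N - expR (- (y * l.+1%:R)) * cos c =
    (phi (n - l.+1)%N - expR (- y) * phi (n - l)%N) +
    expR (- y) * (phi (n - l)%N - expR (- (y * l%:R)) * cos c).
    have -> : - (y * l.+1%:R) = - y + - (y * l%:R) by rewrite -natr1; ring.
    by rewrite expRD; ring.
  rewrite -natr1 mulrDl mul1r addrC; apply: le_trans (ler_normD _ _) _; apply: lerD => //.
  rewrite normrM (ger0_norm (expR_ge0 _)); apply: le_trans IH.
  by rewrite ler_piMl // -[leRHS]expR0 ler_expR oppr_le0.
have := tele n (leqnn n); rewrite subnn.
have -> : y * n%:R = clt_variance / 2.
  by rewrite /y a2 /v; field; rewrite gt_eqF.
rewrite mulrC => h; apply: le_trans h _.
have -> : n%:R * eta = e / 4 + e / 2 + v ^+ 2 / 4 * a ^+ 2.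
  rewrite /eta /y a2; field; rewrite gt_eqF //.
have a1 : a <= 1.
  rewrite invf_le1 ?sqrtr_gt0 //.
  by rewrite -[leLHS]sqrtr1 ler_sqrt ?ler1n.
have : v ^+ 2 / 4 * a ^+ 2 <= e / 4.
  apply: le_trans H3; rewrite mulrC ler_wpM2r ?divr_ge0 ?sqr_ge0 //.
  by rewrite expr2 ler_piMl.
lra.
Qed.

End ReverseMartingaleCLT.

(** * The stationary solution of an explosive recursion *)

Section ExplosiveRecursion.
Context {d0} {T : measurableType d0} {R : realType} (P : probability T R).
Variable zeta : nat -> {RV P >-> R}.
Hypothesis zeta_indep : mutually_independent zeta.
Hypothesis zeta_id : identically_distributed zeta.
Context {d : nat}.
Variable B : 'M[R]_d.
Hypothesis B_unit : B \in unitmx.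
Variable U : nat -> T -> 'cV[R]_d.
Hypothesis U_rec : forall k, {ae P, forall w, U k.+1 w = B *m U k w + first_coord (zeta k w)}.
Hypothesis U_lim : {ae P, forall w,
  \sum_(j < N) (invmx B) ^+ j.+1 *m first_coord (zeta j w) @[N --> \oo] --> - U 0%N w}.

Notation from k := (fun j : nat => (k <= j)%N).
Notation window k M := (fun j : nat => (k <= j < k + M)%N).
Notation Binv := (invmx B).

(** The series for the state, cut after [M] innovations. Written as [M] steps of
    the inverted recursion [x |-> B^-1 (x - zeta k e_1)], it allows inductions in
    which the first innovation is independent of the rest. *)
Fixpoint truncation (M k : nat) (w : T) : 'cV[R]_d :=
  if M is M'.+1 then Binv *m (truncation M' k.+1 w - first_coord (zeta k w)) else 0.

Lemma truncation_sum M k w :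
  truncation M k w = - \sum_(j < M) Binv ^+ j.+1 *m first_coord (zeta (k + j)%N w).
Proof.
elim: M k => [|M IH] k; first by rewrite big_ord0 oppr0.
rewrite /= IH big_ord_recl /= expr1 addn0 mulmxBr mulmxN mulmx_sumr opprD addrC.
congr (_ - _); apply: eq_bigr => j _.
by rewrite /bump /= add1n (exprS _ j.+1) -mulmxE mulmxA addSnnS.
Qed.

(** What a truncation leaves out is a linear image of a later state, which does
    not involve the innovations of the window. *)
Lemma state_truncation M k : {ae P, forall w,
  U k w = truncation M k w + Binv ^+ M *m U (k + M)%N w}.
Proof.
elim: M k => [|M IH] k.
  by apply: aeW => w; rewrite expr0 mul1mx add0r addn0.
have h := IH k.+1; have r := U_rec k.
apply: filterS2 r h => w r h /=.
rewrite -addSnnS.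
have -> : U k w = Binv *m (U k.+1 w - first_coord (zeta k w)).
  by rewrite r addrK mulKmx.
by rewrite {1}h exprS -mulmxE -mulmxA !mulmxBr mulmxDr addrAC.
Qed.

(** The convergence of the series is given at time [0] only: the error of a
    truncation at time [k] is [B ^+ k] times that of a longer truncation at time
    [0]. *)
Lemma truncation_cvg : {ae P, forall w, forall k i,
  truncation M k w i 0 @[M --> \oo] --> U k w i 0}.
Proof.
have H : {ae P, forall w, forall k M, U k w = truncation M k w + Binv ^+ M *m U (k + M)%N w}.
  apply: ae_foralln => k; apply: ae_foralln => M; exact: state_truncation.
apply: filterS2 U_lim H => w lim0 H k i.
have lim1 : truncation M 0 w @[M --> \oo] --> U 0%N w.
  rewrite -[U 0%N w]opprK.
  have -> : (fun M => truncation M 0 w) = (fun M => - \sum_(j < M) Binv ^+ j.+1 *m first_coord (zeta j w)).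
    by apply/funext => M; rewrite truncation_sum.
  exact: cvgN.
have coord M : truncation M k w i 0 = U k w i 0 - dotp ((row i (B ^+ k))^T) (U 0%N w - truncation (k + M) 0 w).
  have -> : U 0%N w - truncation (k + M) 0 w = Binv ^+ k *m (U k w - truncation M k w).
    rewrite (H 0%N (k + M)%N) (H k M) addrAC subrr add0r add0n.
    by rewrite addrAC subrr add0r mulmxA mulmxE -exprD.
  rewrite /dotp trmxK -row_mul.
  have -> : B ^+ k *m (Binv ^+ k *m (U k w - truncation M k w)) = U k w - truncation M k w.
    rewrite mulmxA; have -> : B ^+ k *m Binv ^+ k = 1%:M; last by rewrite mul1mx.
    elim: k {i} => [|k IH]; first by rewrite !expr0 mulmx1.
    by rewrite exprSr exprS -!mulmxE -mulmxA (mulmxA B) mulmxV // mul1mx.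
  by rewrite !mxE; ring.
have -> : (fun M => truncation M k w i 0) = (fun M => U k w i 0 - dotp ((row i (B ^+ k))^T) (U 0%N w - truncation (k + M) 0 w)).
  by apply/funext => M; exact: coord.
have lim2 : U 0%N w - truncation (k + M) 0 w @[M --> \oo] --> (0 : 'cV[R]_d).
  rewrite -(subrr (U 0%N w)); apply: cvgB; first exact: cvg_cst.
  by have := lim1; rewrite -(cvg_shiftn k); under eq_fun do rewrite addnC.
pose D := dotp ((row i (B ^+ k))^T).
have lim3 : D (U 0%N w - truncation (k + M) 0 w) @[M --> \oo] --> D 0.
  apply: (cvg_comp _ _ lim2); exact: (@continuous_dotp R d _ 0).
have D0 : D 0 = 0 by rewrite /D /dotp mulmx0 mxE.
rewrite D0 in lim3.
rewrite -[X in _ --> X]subr0; exact: (cvgB (cvg_cst _) lim3).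
Qed.

Let affine_step (x : 'cV[R]_d) (z : R) : 'cV[R]_d := Binv *m (x - first_coord z).

Let affine_step_meas d1 (S : measurableType d1) (X : S -> 'cV[R]_d) (Y : S -> R) :
  measurable_fun setT (X : S -> borel 'cV[R]_d) -> measurable_fun setT Y ->
  measurable_fun setT ((fun s => affine_step (X s) (Y s)) : S -> borel 'cV[R]_d).
Proof.
move=> mX mY; apply: measurable_cV => i.
have -> : (fun s => affine_step (X s) (Y s) i 0) =
  (fun s => \sum_j Binv i j * (X s j 0 - (if j == 0%N :> nat then Y s else 0))).
  by apply/funext => s; rewrite mxE; apply: eq_bigr => j _; rewrite !mxE.
apply: measurable_sum => j; apply: measurable_funM => //; apply: measurable_funB.
  exact: (measurableT_comp (measurable_coord j) mX).
by case: (nat_of_ord j == 0%N).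
Qed.

Lemma truncation_meas M k :
  measurable_fun setT (truncation M k : sigT zeta (window k M) -> borel 'cV[R]_d).
Proof.
elim: M k => [|M IH] k; first exact: measurable_cst.
apply: affine_step_meas.
  have sub : {subset window k.+1 M <= window k M.+1}.
    by move=> j /andP[h1 h2]; apply/andP; split; [exact: ltnW|rewrite addnS -addSn].
  exact: (sigT_sub sub (IH k.+1)).
by apply: sigT_Z; rewrite /= leqnn addnS ltnS leq_addr.
Qed.

Let trunc_measT M k : measurable_fun setT (truncation M k : T -> borel 'cV[R]_d) :=
  sigT_meas (@truncation_meas M k).

Lemma truncation_law M k (A : set (borel 'cV[R]_d)) : measurable A ->
  P (truncation M k @^-1` A) = P (truncation M 0 @^-1` A).
Proof.
elim: M k A => [//|M IH] k A mA.
have ind j : indep P (truncation M j.+1 : T -> borel 'cV[R]_d) (zeta j).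
  apply: (sigT_indep zeta_indep (D1 := window j.+1 M) (D2 := pred1 j)).
  - by move=> i; apply/negP => /andP[/andP[+ _] /eqP ij]; rewrite ij ltnn.
  - exact: truncation_meas.
  - by apply: sigT_Z; exact: eqxx.
have zm j : measurable_fun setT (zeta j) by exact: measurable_funP.
have L := indep_same_law (@trunc_measT M k.+1) (zm k) (@trunc_measT M 1%N) (zm 0%N) (ind k) (ind 0%N)
  (fun A mA => etrans (IH k.+1 A mA) (esym (IH 1%N A mA)))
  (fun A mA => zeta_id k mA).
pose f (z : borel 'cV[R]_d * R) : borel 'cV[R]_d := affine_step z.1 z.2.
have mf : measurable_fun setT f by exact: affine_step_meas.
have := L (f @^-1` A); apply.
by rewrite -[X in measurable X]setTI; exact: mf.
Qed.

(** The state is a function of the innovations from [k] on only up to a null set.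
    An upper limit of truncations is such a function everywhere, and it is
    measurable without any convergence; where it is infinite, [fine] returns
    [0]. *)
Definition state_version (k : nat) (w : T) : 'cV[R]_d :=
  \col_i fine (limn_esup (fun M => (truncation M k w i 0)%:E)).

Lemma state_version_meas k :
  measurable_fun setT (state_version k : sigT zeta (from k) -> borel 'cV[R]_d).
Proof.
apply: measurable_cV => i.
have -> : (fun w => state_version k w i 0) = fine \o (fun w => limn_esup (fun M => (truncation M k w i 0)%:E)).
  by apply/funext => w; rewrite mxE.
apply: (measurableT_comp (@fine_measurable R setT measurableT)).
apply: measurable_fun_limn_esup => M; apply/measurable_EFinP.
apply: (measurableT_comp (measurable_coord i)).
have sub : {subset window k M <= from k} by move=> j /andP[].
exact: (sigT_sub sub (@truncation_meas M k)).
Qed.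

Lemma state_versionE : {ae P, forall w, forall k, state_version k w = U k w}.
Proof.
apply: filterS truncation_cvg => w H k; apply/colP => i; rewrite mxE.
have h : (truncation M k w i 0)%:E @[M --> \oo] --> (U k w i 0)%:E.
  by apply: cvg_EFin; [exact: nearW|exact: H].
by rewrite is_cvg_limn_esupE; [rewrite (cvg_lim _ h)|apply/cvg_ex; exists (U k w i 0)%:E].
Qed.

Let stateT_meas k : measurable_fun setT (state_version k : T -> borel 'cV[R]_d) :=
  sigT_meas (@state_version_meas k).

Let trunc_cvg : {ae P, forall w, forall k i,
  truncation M k w i 0 @[M --> \oo] --> state_version k w i 0}.
Proof. by apply: filterS2 truncation_cvg state_versionE => w h E k i; rewrite E. Qed.

Let mean_trunc_cvg (G : 'cV[R]_d -> R) (N : R) k : continuous G -> (forall x, `|G x| <= N) ->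
  {ae P, forall w, G (truncation M k w) @[M --> \oo] --> G (state_version k w)}.
Proof.
move=> cG GN; apply: filterS trunc_cvg => w h.
apply: (@cvg_comp _ _ _ (fun M => truncation M k w) G _ (nbhs (state_version k w))); last exact: cG.
apply/cvg_ballP => e e0.
have H i : \forall M \near \oo, ball (state_version k w i 0) e (truncation M k w i 0).
  by have /cvg_ballP := h k i; apply.
suff : \forall M \near \oo, ball (state_version k w) e (truncation M k w) by [].
have Hall := filter_forall _ H.
near=> M; split => // i j; rewrite (ord1 j).
by move: i; near: M; exact: Hall.
Unshelve. all: end_near. Qed.

(** Truncations of the same length have the same law at all times, and their
    limits inherit it through bounded continuous functions. *)
Lemma state_version_law k (A : set (borel 'cV[R]_d)) : measurable A ->
  P (state_version k @^-1` A) = P (state_version 0 @^-1` A).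
Proof.
move=> mA.
rewrite -[LHS]/(law P (@stateT_meas k) A) -[RHS]/(law P (@stateT_meas 0) A).
apply: probability_eq_continuous => // G N cG GN.
have mG := continuous_measurable_borel cG.
have iG j : int1 P (G \o state_version j).
  apply: (@int1_bdd _ _ _ _ _ N) => [|w]; last exact: GN.
  exact: (measurableT_comp mG (@stateT_meas j)).
rewrite !mean_law //.
have h j : mean P (G \o truncation M j) @[M --> \oo] --> mean P (G \o state_version j).
  apply: (@mean_dct _ _ _ P _ _ (fun=> N)).
  - by move=> M; exact: (measurableT_comp mG (@trunc_measT M j)).
  - exact: (measurableT_comp mG (@stateT_meas j)).
  - exact: mean_trunc_cvg.
  - exact: int1_cst.
  - by move=> M w; exact: GN.
have E : (fun M => mean P (G \o truncation M k)) = (fun M => mean P (G \o truncation M 0)).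
  apply/funext => M; apply: (same_law_mean (@trunc_measT M k) (@trunc_measT M 0%N) mG).
    by move=> A' mA'; exact: truncation_law.
  apply: (@int1_bdd _ _ _ _ _ N) => [|w]; last exact: GN.
  exact: (measurableT_comp mG (@trunc_measT M k)).
have hk := h k; rewrite E in hk.
exact: cvg_unique hk (h 0%N).
Qed.

(** At a fixed time this is dominated convergence. The same [M] serves all times
    because the error is a function of the pair formed by the truncation and the
    later state [state_version (k + M)], which are independent with laws that do
    not depend on [k]. *)
Lemma state_version_approx (G : 'cV[R]_d -> R) (N : R) : continuous G -> (forall x, `|G x| <= N) ->
  forall e : R, 0 < e -> exists M, forall k,
    mean P (fun w => `|G (state_version k w) - G (truncation M k w)|) <= e.
Proof.
move=> cG GN e e0; have mG := continuous_measurable_borel cG.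
have mdiff M k : measurable_fun setT (fun w => `|G (state_version k w) - G (truncation M k w)|).
  apply: measurableT_comp => //; apply: measurable_funB.
    exact: (measurableT_comp mG (@stateT_meas k)).
  exact: (measurableT_comp mG (@trunc_measT M k)).
have h : mean P (fun w => `|G (state_version 0 w) - G (truncation M 0 w)|) @[M --> \oo] --> mean P (fun=> 0).
  apply: (@mean_dct _ _ _ P _ _ (fun=> N + N)) => //.
  - apply: filterS (mean_trunc_cvg 0 cG GN) => w hw.
    rewrite -[X in _ --> X](@normr0 _ R) -(subrr (G (state_version 0 w))).
    by apply: cvg_norm; apply: cvgB => //; exact: cvg_cst.
  - exact: int1_cst.
  - by move=> M w; rewrite normr_id; apply: le_trans (ler_normB _ _) _; exact: lerD.
rewrite mean_cst in h; have [M HM] := cvg_eps h e0; exists M => k.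
have {}HM := HM M (leqnn _); rewrite subr0 in HM.
apply: le_trans HM; apply: le_trans (ler_norm _).
pose f (z : borel 'cV[R]_d * borel 'cV[R]_d) : R :=
  `|G ((z.1 : 'cV[R]_d) + Binv ^+ M *m (z.2 : 'cV[R]_d)) - G z.1|.
have mf : measurable_fun setT f.
  apply: measurableT_comp => //; apply: measurable_funB; last first.
    exact: (measurableT_comp mG (@measurable_fst _ _ _ _)).
  apply: (measurableT_comp mG); apply: measurable_cV => i.
  have -> : (fun z : borel 'cV[R]_d * borel 'cV[R]_d => ((z.1 : 'cV[R]_d) + Binv ^+ M *m (z.2 : 'cV[R]_d)) i 0) =
    (fun z => (z.1 : 'cV[R]_d) i 0 + \sum_j (Binv ^+ M) i j * (z.2 : 'cV[R]_d) j 0).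
    by apply/funext => z; rewrite !mxE.
  apply: measurable_funD.
    exact: (measurableT_comp (measurable_coord i) (@measurable_fst _ _ _ _)).
  apply: measurable_sum => j; apply: measurable_funM => //.
  exact: (measurableT_comp (measurable_coord j) (@measurable_snd _ _ _ _)).
have ind j : indep P (truncation M j : T -> borel 'cV[R]_d) (state_version (j + M) : T -> borel 'cV[R]_d).
  apply: (sigT_indep zeta_indep (D1 := window j M) (D2 := from (j + M)%N)).
  - by move=> i; apply/negP => /andP[/andP[_ h1] h2]; rewrite ltnNge h2 in h1.
  - exact: truncation_meas.
  - exact: state_version_meas.
have mp j : measurable_fun setT (fun w => ((truncation M j w : borel 'cV[R]_d), (state_version (j + M) w : borel 'cV[R]_d))).
  by apply: measurable_fun_pair; [exact: (@trunc_measT M j)|exact: (@stateT_meas (j + M))].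
have L := indep_same_law (@trunc_measT M k) (@stateT_meas (k + M)) (@trunc_measT M 0%N)
  (@stateT_meas (0 + M)) (ind k) (ind 0%N)
  (fun A mA => @truncation_law M k A mA)
  (fun A mA => etrans (state_version_law (k + M) mA) (esym (state_version_law (0 + M) mA))).
have E j : {ae P, forall w, f (truncation M j w, state_version (j + M) w) = `|G (state_version j w) - G (truncation M j w)|}.
  apply: filterS2 state_versionE (state_truncation M j) => w Ev Et.
  by rewrite /f /= !Ev -Et.
have fm j : measurable_fun setT (fun w => f (truncation M j w, state_version (j + M) w)).
  exact: (measurableT_comp mf (mp j)).
have fi j : int1 P (fun w => f (truncation M j w, state_version (j + M) w)).
  apply: (@int1_bdd _ _ _ _ _ (N + N)) => // w.
  by rewrite normr_id; apply: le_trans (ler_normB _ _) _; exact: lerD.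
rewrite -(mean_ext_ae (fm k) (mdiff M k) (E k)) -(mean_ext_ae (fm 0%N) (mdiff M 0%N) (E 0%N)).
by rewrite le_eqVlt; apply/orP; left; apply/eqP; exact: (same_law_mean (mp k) (mp 0%N) mf L (fi k)).
Qed.

End ExplosiveRecursion.

(** * Companion matrices and second moments *)

(** A singular matrix has the eigenvalue [0], of modulus less than [1]. *)
Lemma companion_unit (R : realType) (d : nat) (theta : 'cV[R]_d) :
  purely_explosive theta -> companion theta \in unitmx.
Proof.
move=> H; apply: contraT => nu.
have /H : eigenvalue (map_mx (real_complex R) (companion theta)) 0.
  rewrite /eigenvalue /eigenspace raddf0 subr0 kermx_eq0 row_free_unit map_unitmx.
  exact: nu.
by rewrite normr0 ltr10.
Qed.

Lemma state_rec (R : realType) (disp : measure_display) (T : measurableType disp)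
  (P : probability T R) (d : nat) (theta : 'cV[R]_d) (Z : nat -> {RV P >-> R})
  (Y : int -> {RV P >-> R}) (n : nat) (w : T) :
  Y n.+1%:Z w = \sum_(i < d) theta i 0 * Y (n.+1%:Z - i.+1%:Z) w + Z n.+1 w ->
  state Y n.+1 w = companion theta *m @state R disp T P d Y n w + first_coord (Z n.+1 w).
Proof.
move=> H; apply/colP => i; rewrite !mxE.
under eq_bigr do rewrite !mxE.
case: i => -[|i] id /=.
  rewrite subr0 H; congr (_ + _); apply: eq_bigr => j _; congr (_ * _).
  by congr (Y _ w); lia.
have i1 : (i < d)%N by exact: ltnW.
rewrite (bigD1 (Ordinal i1)) //= eqxx mul1r big1 ?addr0; last first.
  move=> j ji; rewrite eqSS; case: eqP => [E|_]; last by rewrite mul0r.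
  by move: ji; rewrite -val_eqE /= E eqxx.
by congr (Y _ w); lia.
Qed.

Section Covariance.
Context {d0} {T : measurableType d0} {R : realType} (P : probability T R).

Lemma int1_sum (I : Type) (s : seq I) (f : I -> T -> R) : (forall i, int1 P (f i)) ->
  int1 P (fun w => \sum_(i <- s) f i w).
Proof.
move=> H; elim: s => [|i s IH].
  by under eq_fun do rewrite big_nil; exact: int1_cst.
by under eq_fun do rewrite big_cons; exact: int1D.
Qed.

Lemma mean_sum (I : Type) (s : seq I) (f : I -> T -> R) : (forall i, int1 P (f i)) ->
  mean P (fun w => \sum_(i <- s) f i w) = \sum_(i <- s) mean P (f i).
Proof.
move=> H; elim: s => [|i s IH].
  by under eq_fun do rewrite big_nil; rewrite mean_cst big_nil.
under eq_fun do rewrite big_cons.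
by rewrite meanD ?IH ?big_cons //; exact: int1_sum.
Qed.

Context {m : nat}.
Variable X : T -> 'cV[R]_m.
Hypothesis mX : measurable_fun setT (X : T -> borel 'cV[R]_m).
Hypothesis X2 : int1 P (fun w => \sum_i X w i 0 ^+ 2).

Let mXi i : measurable_fun setT (fun w => X w i 0).
Proof. exact: (measurableT_comp (measurable_coord i) mX). Qed.
Arguments mXi : clear implicits.

Let Xij i j : int1 P (fun w => X w i 0 * X w j 0).
Proof.
apply: (@int1_le _ _ _ _ _ (fun w => 2 * \sum_i X w i 0 ^+ 2)); last exact: int1Z.
  by apply: measurable_funM; exact: mXi.
move=> w; have S k : X w k 0 ^+ 2 <= \sum_i X w i 0 ^+ 2.
  by rewrite [leRHS](bigD1 k) //= lerDl sumr_ge0 // => l _; exact: sqr_ge0.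
have := sqr_ge0 (`|X w i 0| - `|X w j 0|); rewrite sqrrB !real_normK ?num_real // normrM.
have := S i; have := S j; have := sqr_ge0 (X w i 0); lra.
Qed.

Lemma dotp_sqr (t x : 'cV[R]_m) : dotp t x ^+ 2 =
  \sum_i \sum_j (t i 0 * t j 0) * (x i 0 * x j 0).
Proof.
rewrite dotpE expr2 mulr_suml; apply: eq_bigr => i _.
by rewrite mulr_sumr; apply: eq_bigr => j _; ring.
Qed.

Lemma dotp_delta (i : 'I_m) (x : 'cV[R]_m) : dotp (delta_mx i 0) x = x i 0.
Proof.
rewrite dotpE (bigD1 i) //= mxE !eqxx mul1r big1 ?addr0 // => j /negPf ji.
by rewrite mxE ji mul0r.
Qed.

Lemma int1_dotp_sqr (t : 'cV[R]_m) : int1 P (fun w => dotp t (X w) ^+ 2).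
Proof.
under eq_fun do rewrite dotp_sqr.
by apply: int1_sum => i; apply: int1_sum => j; exact: int1Z.
Qed.

Lemma quad_mx_expectation (t : 'cV[R]_m) :
  quad (mx_expectation P (fun w => X w *m (X w)^T)) t = mean P (fun w => dotp t (X w) ^+ 2).
Proof.
have -> : (fun w => dotp t (X w) ^+ 2) =
  (fun w => \sum_i \sum_j (t i 0 * t j 0) * (X w i 0 * X w j 0)).
  by apply/funext => w; exact: dotp_sqr.
rewrite mean_sum; last by move=> i; apply: int1_sum => j; exact: int1Z.
rewrite /quad -mulmxA mxE; apply: eq_bigr => i _.
rewrite !mxE mulr_sumr mean_sum; last by move=> j; exact: int1Z.
apply: eq_bigr => j _; rewrite meanZ // mxE mulrA mulrAC; congr (_ * _).
rewrite /mean /Rintegral unlock; congr fine; apply: eq_integral => w _.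
by rewrite mxE big_ord1 mxE.
Qed.

Lemma psd_mx_expectation (c : R) : 0 <= c -> psd (c *: mx_expectation P (fun w => X w *m (X w)^T)).
Proof.
move=> c0; split.
  apply/matrixP => i j; rewrite !mxE; congr (_ * fine _); rewrite unlock.
  by apply: eq_integral => w _; rewrite !mxE !big_ord1 !mxE mulrC.
move=> t; rewrite /quad -scalemxAr -scalemxAl mxE mulr_ge0 //.
by rewrite -/(quad _ t) quad_mx_expectation; apply: mean_ge0 => w; exact: sqr_ge0.
Qed.

(** Chebyshev's inequality: outside of the cube some squared coordinate exceeds
    [r ^+ 2]. *)
Lemma cube_tail (r : R) : 0 < r ->
  fine (P (X @^-1` (~` cube r))) <= mean P (fun w => \sum_i X w i 0 ^+ 2) / r ^+ 2.
Proof.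
move=> r0; rewrite ler_pdivlMr ?exprn_gt0 //.
have mc : measurable (X @^-1` (~` cube r)).
  by rewrite -[X in measurable X]setTI; apply: mX => //; apply: measurableC; exact: measurable_cube.
rewrite -mean_indic // mulrC -meanZ; last exact: int1_indic.
apply: mean_le => //; first by apply: int1Z; exact: int1_indic.
move=> w; rewrite indicE; have [xr|xr] := pselect (cube r (X w)).
  rewrite memNset ?mulr0; last by move=> /=; apply.
  by apply: sumr_ge0 => i _; exact: sqr_ge0.
rewrite mem_set // mulr1.
have [i /negP xi] : exists i, ~ (`|X w i 0| <= r) by apply/existsNP.
apply: (@le_trans _ _ (X w i 0 ^+ 2)).
  by rewrite -(real_normK (num_real (X w i 0))) lerXn2r ?nnegrE ?(ltW r0) // ltW // ltNge.
by rewrite [leRHS](bigD1 i) //= lerDl sumr_ge0 // => l _; exact: sqr_ge0.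
Qed.

End Covariance.

(** * The central limit theorem for the explosive autoregression *)

Theorem proposition3p2 (R : realType) (disp : measure_display)
  (T : measurableType disp) (P : probability T R)
  (d : nat) (hd : (0 < d)%N) (theta : 'cV[R]_d)
  (htheta : purely_explosive theta)
  (Z : nat -> {RV P >-> R}) (hZ : iid (fun n => Z n.+1))
  (hZ2 : (Z 1%N : T -> R) \in Lfun P 2%:E) (hZ0 : ('E_P[Z 1%N] = 0)%E)
  (sigma : R) (hsigma : 0 < sigma) (hvar : ('V_P[Z 1%N] = (sigma ^+ 2)%:E)%E)
  (Y : int -> {RV P >-> R}) (hY : explosive_AR theta Z Y)
  (U : nat -> T -> 'cV[R]_d) (hU : U = state Y)
  (m : nat) (hm : (0 < m)%N)
  (h : borel 'cV[R]_d -> borel 'cV[R]_m)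
  (hmeas : measurable_fun [set: borel 'cV[R]_d] h)
  (hint : (fun w => euclid_norm (h (U 0%N w))) \in Lfun P 2%:E) :
  exists2 mu : probability (borel 'cV[R]_m) R,
    is_centered_normal
      (sigma ^+ 2 *: mx_expectation P (fun w => h (U 1%N w) *m (h (U 1%N w))^T))
      mu &
    cvg_in_distribution P
      (fun n w => (Num.sqrt n%:R)^-1 *:
         \sum_(1 <= k < n.+1) Z k w *: (h (U k w) : 'cV[R]_m))
      mu.
Proof.
have [Zind Zid] := hZ.
(* innovations are counted from 0, so that U k is a function of zeta k, zeta k.+1, ... *)
pose zeta n : {RV P >-> R} := Z n.+1.
have sZ : int1 P (fun w => zeta 0%N w ^+ 2) := Lfun2_integrable_sqr hZ2.
have mZ0 : mean P (zeta 0%N) = 0.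
  by have := hZ0; rewrite unlock => E; rewrite /mean /Rintegral E.
have varZ : mean P (fun w => zeta 0%N w ^+ 2) = sigma ^+ 2.
  have := hvar; rewrite varianceE // hZ0 expe2 mule0 sube0 unlock => E.
  by rewrite /mean /Rintegral E.
pose B := companion theta.
have Bu : B \in unitmx := companion_unit htheta.
have Urec k : {ae P, forall w, U k.+1 w = B *m U k w + first_coord (zeta k w)}.
  rewrite hU; apply: filterS (hY.1 k.+1 isT) => w; exact: state_rec.
have Ulim : {ae P, forall w,
  \sum_(j < N) (invmx B) ^+ j.+1 *m first_coord (zeta j w) @[N --> \oo] --> - U 0%N w}.
  rewrite hU; apply: filterS hY.2 => w.
  have -> : (fun N => \sum_(1 <= j < N.+1) invmx (companion theta) ^+ j *m first_coord (Z j w)) =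
    (fun N => \sum_(j < N) (invmx B) ^+ j.+1 *m first_coord (zeta j w)).
    by apply/funext => N; rewrite big_add1 /= big_mkord.
  exact.
have mU k : measurable_fun setT (U k : T -> borel 'cV[R]_d).
  apply: measurable_cV => i; rewrite hU.
  have -> : (fun w => state Y k w i 0) = Y (k%:Z - i%:Z) by apply/funext => w; rewrite mxE.
  exact: measurable_funP.
(* a version of U k that depends on zeta j with j >= k at every point *)
pose V k := state_version zeta B k.
have VE : {ae P, forall w k, V k w = U k w} := state_versionE Bu Urec Ulim.
have mVs k := @state_version_meas _ _ _ _ zeta _ B k.
have mV k : measurable_fun setT (V k : T -> borel 'cV[R]_d) := sigT_meas (mVs k).
have VL k (A : set 'cV[R]_d) : measurable (A : set (borel 'cV[R]_d)) ->
    P (V k @^-1` A) = P (V 0%N @^-1` A).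
  by move=> mA; exact: (state_version_law Zind Zid Bu Urec Ulim k mA).
have mhV k : measurable_fun setT ((fun w => h (V k w)) : T -> borel 'cV[R]_m).
  exact: (measurableT_comp hmeas (mV k)).
have mhU k : measurable_fun setT ((fun w => h (U k w)) : T -> borel 'cV[R]_m).
  exact: (measurableT_comp hmeas (mU k)).
have msq (X : T -> 'cV[R]_m) : measurable_fun setT (X : T -> borel 'cV[R]_m) ->
    measurable_fun setT (fun w => \sum_i X w i 0 ^+ 2).
  move=> mX; apply: measurable_sum => i; apply: measurable_funX.
  exact: (measurableT_comp (measurable_coord i) mX).
have iU0 : int1 P (fun w => \sum_i (h (U 0%N w) : 'cV[R]_m) i 0 ^+ 2).
  have := Lfun2_integrable_sqr hint; congr (P.-integrable _ _).
  apply/funext => w /=; congr (_%:E); rewrite sqr_sqrtr //.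
  by apply: sumr_ge0 => i _; exact: sqr_ge0.
have iV0 : int1 P (fun w => \sum_i (h (V 0%N w) : 'cV[R]_m) i 0 ^+ 2).
  apply: (int1_ext_ae iU0); first exact: msq (mhV 0%N).
  by apply: filterS VE => w E; rewrite E.
have mh2 : measurable_fun setT (fun x : borel 'cV[R]_d => \sum_i (h x : 'cV[R]_m) i 0 ^+ 2).
  apply: measurable_sum => i; apply: measurable_funX.
  exact: (measurableT_comp (measurable_coord i) hmeas).
have iV1 : int1 P (fun w => \sum_i (h (V 1%N w) : 'cV[R]_m) i 0 ^+ 2).
  exact: (same_law_int1 (mV 0%N) (mV 1%N) mh2 (fun A mA => esym (VL 1%N A mA)) iV0).
have iU1 : int1 P (fun w => \sum_i (h (U 1%N w) : 'cV[R]_m) i 0 ^+ 2).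
  apply: (int1_ext_ae iV1); first exact: msq (mhU 1%N).
  by apply: filterS VE => w E; rewrite E.
(* C is a covariance matrix, so the limit law exists *)
set C := sigma ^+ 2 *: _.
have Cpsd : psd C by apply: (psd_mx_expectation (mhU 1%N) iU1); exact: sqr_ge0.
have [mu Hmu] := exists_gaussian Cpsd.
exists mu; first exact: gaussian_centered_normal Cpsd Hmu.
(* Cramer-Wold: the projection on t reduces the sum to the scalar case *)
pose g (t : 'cV[R]_m) (x : 'cV[R]_d) : R := dotp t (h x : 'cV[R]_m).
have mg t : measurable_fun setT (g t : borel 'cV[R]_d -> R).
  exact: (measurableT_comp (continuous_measurable_borel (@continuous_dotp _ _ t)) hmeas).
have ig t : int1 P (fun w => g t (V 0%N w) ^+ 2) := int1_dotp_sqr (mhV 0%N) iV0 t.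
have gvar t : mean P (fun w => zeta 0%N w ^+ 2) * mean P (fun w => g t (V 0%N w) ^+ 2) = quad C t.
  rewrite varZ /C /quad -scalemxAr -scalemxAl mxE -/(quad _ t); congr (_ * _).
  rewrite (quad_mx_expectation (mhU 1%N) iU1).
  have mg2 : measurable_fun setT (fun x : borel 'cV[R]_d => g t x ^+ 2) by exact: measurable_funX.
  transitivity (mean P (fun w => g t (V 1%N w) ^+ 2)).
    exact: (same_law_mean (mV 0%N) (mV 1%N) mg2 (fun A mA => esym (VL 1%N A mA)) (ig t)).
  apply: mean_ext_ae.
  - exact: (measurableT_comp mg2 (mV 1%N)).
  - exact: (measurableT_comp mg2 (mU 1%N)).
  - by apply: filterS VE => w E; rewrite E.
pose S n w := (Num.sqrt n%:R)^-1 *: \sum_(1 <= k < n.+1) Z k w *: (h (V k w) : 'cV[R]_m).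
pose S' n w := (Num.sqrt n%:R)^-1 *: \sum_(1 <= k < n.+1) Z k w *: (h (U k w) : 'cV[R]_m).
have SE t n w : dotp t (S n w) = (Num.sqrt n%:R)^-1 * tail_sum zeta V (g t) 0 n w.
  rewrite /S dotpZr; congr (_ * _); rewrite /tail_sum big_add1 /=.
  elim: n => [|n IH]; first by rewrite !big_geq // dotpE big1 // => i _; rewrite mxE mulr0.
  by rewrite !big_nat_recr //= dotpDr IH dotpZr mulrC.
have mS (W : nat -> T -> 'cV[R]_d) : (forall k, measurable_fun setT (W k : T -> borel 'cV[R]_d)) ->
    forall n, measurable_fun setT ((fun w => (Num.sqrt n%:R)^-1 *: \sum_(1 <= k < n.+1) Z k w *: (h (W k w) : 'cV[R]_m)) : T -> borel 'cV[R]_m).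
  move=> mW n; apply: measurable_cV => i.
  have -> : (fun w => ((Num.sqrt n%:R)^-1 *: \sum_(1 <= k < n.+1) Z k w *: (h (W k w) : 'cV[R]_m)) i 0) =
    (fun w => (Num.sqrt n%:R)^-1 * \sum_(1 <= k < n.+1) Z k w * (h (W k w) : 'cV[R]_m) i 0).
    apply/funext => w; rewrite mxE summxE; congr (_ * _).
    by apply: eq_bigr => k _; rewrite mxE.
  apply: measurable_funM => //; apply: measurable_sum => k; apply: measurable_funM.
    exact: measurable_funP.
  exact: (measurableT_comp (measurable_coord i) (measurableT_comp hmeas (mW k))).
have mSV n : measurable_fun setT (S n : T -> borel 'cV[R]_m) := mS V mV n.
have mSU n : measurable_fun setT (S' n : T -> borel 'cV[R]_m) := mS U mU n.
have Sapprox := state_version_approx Zind Zid Bu Urec Ulim.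
have cosS t b : mean P (fun w => cos (dotp t (S n w) + b)) @[n --> \oo] -->
    mean mu (fun x => cos (dotp t x + b)).
  rewrite Hmu -gvar.
  have -> : (fun n => mean P (fun w => cos (dotp t (S n w) + b))) =
    (fun n => mean P (fun w => cos ((Num.sqrt n%:R)^-1 * tail_sum zeta V (g t) 0 n w + b))).
    by apply/funext => n; congr mean; apply/funext => w; rewrite SE.
  exact: (reverse_martingale_clt Zind Zid sZ mZ0 mVs (@truncation_meas _ _ _ _ zeta _ B) VL Sapprox (mg t) (ig t)).
have S2 n : int1 P (fun w => \sum_i S n w i 0 ^+ 2) /\
    mean P (fun w => \sum_i S n w i 0 ^+ 2) <= \sum_i quad C (delta_mx i 0).
  have co i w : S n w i 0 ^+ 2 = (Num.sqrt n%:R)^-1 ^+ 2 * tail_sum zeta V (g (delta_mx i 0)) 0 n w ^+ 2.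
    by rewrite -exprMn -SE dotp_delta.
  have ts i := tail_sum_sq Zind Zid sZ mZ0 mVs VL (mg (delta_mx i 0)) (ig (delta_mx i 0)) 0 n.
  have iS i : int1 P (fun w => S n w i 0 ^+ 2).
    by under eq_fun do rewrite co; apply: int1Z; exact: (ts i).1.
  split; first exact: int1_sum.
  rewrite mean_sum //; apply: ler_sum => i _.
  have -> : (fun w => S n w i 0 ^+ 2) = (fun w => (Num.sqrt n%:R)^-1 ^+ 2 * tail_sum zeta V (g (delta_mx i 0)) 0 n w ^+ 2).
    by apply/funext => w; exact: co.
  rewrite meanZ ?(ts i).1 // (ts i).2 subn0 exprVn sqr_sqrtr //.
  rewrite /clt_variance gvar mulrA ler_piMl //; first exact: Cpsd.2.
  by case: n {co ts iS} => [|n]; [rewrite mulr0|rewrite mulVf].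
have tightS (e : R) : 0 < e -> exists r, forall n, fine (P (S n @^-1` (~` cube r))) <= e.
  move=> e0; pose L := \sum_i quad C (delta_mx i 0).
  have L0 : 0 <= L by apply: sumr_ge0 => i _; exact: Cpsd.2.
  exists (Num.sqrt ((L + 1) / e)) => n.
  have r2 : 0 < (L + 1) / e by rewrite divr_gt0 // ltr_wpDl.
  apply: le_trans (cube_tail (mSV n) (S2 n).1 _) _; first by rewrite sqrtr_gt0.
  rewrite sqr_sqrtr ?(ltW r2) // ler_pdivrMr //.
  have -> : e * ((L + 1) / e) = L + 1 by field; rewrite gt_eqF.
  by apply: le_trans (S2 n).2 _; rewrite lerDl.
move=> f cf [M [_ HM]].
have fM x : `|f x| <= `|M| + 1 by apply: HM => //; rewrite (le_lt_trans (ler_norm M)) // ltrDl.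
have mf := continuous_measurable_borel cf.
have imu : int1 mu f by apply: (@int1_bdd _ _ _ _ _ (`|M| + 1)).
have iS' n : int1 P (f \o S' n).
  apply: (@int1_bdd _ _ _ _ _ (`|M| + 1)) => [|w]; last exact: fM.
  exact: (measurableT_comp mf (mSU n)).
have := cvg_mean_continuous mSV tightS cosS cf fM => hcv.
rewrite (EFin_mean imu).
have -> : (fun n => 'E_P[f \o (fun w => (Num.sqrt n%:R)^-1 *: \sum_(1 <= k < n.+1) Z k w *: (h (U k w) : 'cV[R]_m))])%E =
  (fun n => (mean P (f \o S n))%:E).
  apply/funext => n; rewrite unlock (EFin_mean (iS' n)); congr (_%:E).
  apply: mean_ext_ae.
  - exact: (measurableT_comp mf (mSU n)).
  - exact: (measurableT_comp mf (mSV n)).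
  - apply: filterS VE => w E; rewrite /comp /S /S'; congr (f (_ *: _)).
    by apply: eq_bigr => k _; rewrite E.
by apply: cvg_EFin => //; exact: nearW.
Qed.
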